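(* Let $X$ be a locally finite $2$-dimensional contractible CW-complex and let $\Gamma$ be a non-uniform lattice on $X$, i.e. a non-uniform lattice in $\operatorname{Aut}(X)$. Then $\Gamma$ is not finitely presented.
   Context: For a locally finite contractible finite-dimensional CW-complex $X$, $\operatorname{Aut}(X)$ denotes its full group of automorphisms, understood as combinatorial (cell-permuting) automorphisms, so that every subgroup acts admissibly on the barycentric subdivision of $X$ (an action is admissible if the set-wise stabiliser of each cell coincides with its point-wise stabiliser). It carries the topology of uniform convergence on compact subsets of $X$ (for combinatorial automorphisms, point-wise stabilisers of finite subcomplexes of the subdivision form a basis of neighbourhoods of the identity), which makes it a locally compact group. A subgroup $\Gamma$ of a locally compact group $G$ with left-invariant Haar measure $\mu$ is a lattice if $\Gamma$ is discrete and $\mu(\Gamma\backslash G)<\infty$. A lattice is uniform if $\Gamma\backslash G$ is compact, and non-uniform otherwise. A lattice on $X$ is a lattice in $\operatorname{Aut}(X)$.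
   Formalization: The CW-complex is assumed combinatorial (each component of the preimage of an open cell in a closed ball maps bijectively onto that cell), so that its barycentric subdivision makes sense; automorphisms are identified when they agree on that subdivision. *)

(* Defs.v *)
From HB Require Import structures.
From mathcomp Require Import all_boot all_order all_algebra.
From mathcomp Require Import generic_quotient.
From mathcomp Require Import all_classical all_reals all_analysis.
Set Implicit Arguments.
Unset Strict Implicit.
Unset Printing Implicit Defensive.
Import Order.TTheory GRing.Theory Num.Theory numFieldNormedType.Exports.
Local Open Scope classical_set_scope.
Local Open Scope quotient_scope.
Local Open Scope ring_scope.

(** * Finite presentations and lattices *)

HB.mixin Record isTopologicalGroup G of Group G & PointedTopological G := {
  mulg_continuous : continuous (fun xy : G * G => (xy.1 * xy.2)%g);
  invg_continuous : continuous (fun x : G => x^-1%g)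
}.

#[short(type="topologicalGroupType")]
HB.structure Definition TopologicalGroup :=
  {G of isTopologicalGroup G & Group G & PointedTopological G}.

Record subgroup (G : groupType) := Subgroup {
  subgroup_set :> set G;
  subgroup1 : subgroup_set 1%g;
  subgroupM : forall x y,
    subgroup_set x -> subgroup_set y -> subgroup_set (x * y)%g;
  subgroupV : forall x, subgroup_set x -> subgroup_set x^-1%g
}.

Section FinitePresentation.

(* [(i, true)] is the generator [x_i] and [(i, false)] its formal inverse. *)
Definition word (n : nat) := seq ('I_n * bool).

(* The group presented by [rels] is the quotient of the monoid of words by
   this congruence. *)
Inductive word_conv n (rels : seq (word n)) : word n -> word n -> Prop :=
| word_conv_refl w : word_conv rels w w
| word_conv_sym v w : word_conv rels v w -> word_conv rels w v
| word_conv_trans u v w :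
    word_conv rels u v -> word_conv rels v w -> word_conv rels u w
| word_conv_cat v v' w w' :
    word_conv rels v v' -> word_conv rels w w' ->
    word_conv rels (v ++ w) (v' ++ w')
| word_conv_inv i b : word_conv rels [:: (i, b); (i, ~~ b)] [::]
| word_conv_rel r : r \in rels -> word_conv rels r [::].

Definition word_eval (G : groupType) n (x : 'I_n -> G) (w : word n) : G :=
  (\prod_(l <- w) if l.2 then x l.1 else (x l.1)^-1)%g.

Definition finitely_presented (G : groupType) (H : subgroup G) : Prop :=
  exists n (rels : seq (word n)) (x : 'I_n -> G),
    range (word_eval x) = H /\
    forall v w, word_eval x v = word_eval x w <-> word_conv rels v w.

End FinitePresentation.

Section OrbitSpace.
Variables (G : topologicalGroupType) (H : subgroup G).

Definition same_orbit (x y : G) : bool := `[< subgroup_set H (y * x^-1)%g >].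

Lemma same_orbit_equiv : equiv_class_of same_orbit.
Proof.
split=> [x|x y|y x z].
- by apply/asboolP; rewrite mulgV; exact: subgroup1.
- by apply/asboolP/asboolP => /subgroupV; rewrite invgF.
- move=> /asboolP xy /asboolP yz; apply/asboolP.
  by rewrite -[z](mulgVK y) -mulgA; exact: subgroupM.
Qed.

Canonical same_orbit_rel : equiv_rel G := EquivRelPack same_orbit_equiv.

(* [H \ G], for the action of [H] on [G] by left translations *)
Definition orbit_space := quotient_topology {eq_quot same_orbit_rel}.

End OrbitSpace.

Section Lattice.
Variables (R : realType) (G : topologicalGroupType).

Definition borel_measure :=
  {measure set (g_sigma_algebraType (@open G)) -> \bar R}.

Definition is_haar (mu : borel_measure) : Prop :=
  [/\ forall g (A : set G), <<s @open G >> A ->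
        mu [set (g * x)%g | x in A] = mu A,
      forall K : set G, compact K -> (mu K < +oo)%E,
      forall A : set G, <<s @open G >> A ->
        mu A = ereal_inf [set mu U | U in [set U | open U /\ A `<=` U]],
      forall U : set G, open U ->
        mu U = ereal_sup [set mu K | K in [set K | compact K /\ K `<=` U]] &
      mu [set: G] <> 0%E].

(* [F] meets every orbit of [H] on [G] exactly once; for discrete [H] the
   measure induced by [mu] on [H \ G] has total mass [mu F]. *)
Definition finite_covolume (mu : borel_measure) (H : subgroup G) : Prop :=
  exists F : set G,
    [/\ <<s @open G >> F,
        forall g, exists! x, F x /\ (exists2 h, subgroup_set H h & g = (h * x)%g) &
        (mu F < +oo)%E].

Definition discrete_subgroup (H : subgroup G) : Prop :=
  forall x, subgroup_set H x -> exists2 U : set G, open U & U `&` H = [set x].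

Definition is_lattice (H : subgroup G) : Prop :=
  discrete_subgroup H /\
  exists2 mu : borel_measure, is_haar mu & finite_covolume mu H.

Definition is_uniform (H : subgroup G) : Prop :=
  compact [set: orbit_space H].

Definition is_nonuniform_lattice (H : subgroup G) : Prop :=
  is_lattice H /\ ~ is_uniform H.

End Lattice.

(** * CW-complexes *)

Definition contractible (R : realType) (T : topologicalType) : Prop :=
  exists (H : T * R -> T) (x0 : T),
    [/\ {within [set: T] `*` `[0, 1], continuous H},
        forall x, H (x, 0) = x & forall x, H (x, 1) = x0].

Section Ball.
Variables (R : realType) (n : nat).

Definition cball : set 'rV[R]_n := [set x | \sum_i x 0 i ^+ 2 <= 1].
Definition oball : set 'rV[R]_n := [set x | \sum_i x 0 i ^+ 2 < 1].
Definition sphere : set 'rV[R]_n := [set x | \sum_i x 0 i ^+ 2 = 1].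

End Ball.

Arguments cball R n : clear implicits.
Arguments oball R n : clear implicits.
Arguments sphere R n : clear implicits.

(* That each characteristic map restricts to a homeomorphism from the open ball
   onto the open cell follows from the fields below, the closed ball being
   compact and [T] Hausdorff. *)
Record cw_complex (R : realType) (T : topologicalType) := CWComplex {
  cell : Type;
  dim : cell -> nat;
  char_map : forall c, 'rV[R]_(dim c) -> T;
  open_cell := fun c => @char_map c @` oball R (dim c);
  cw_hausdorff : hausdorff_space T;
  cw_continuous : forall c, {within cball R (dim c), continuous (@char_map c)};
  cw_injective : forall c, set_inj (oball R (dim c)) (@char_map c);
  cw_disjoint : forall c d, open_cell c `&` open_cell d !=set0 -> c = d;
  cw_cover : \bigcup_c open_cell c = [set: T];
  cw_closure_finite : forall c, exists2 F : set cell, finite_set F &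
    @char_map c @` sphere R (dim c)
      `<=` \bigcup_(d in [set d | F d /\ (dim d < dim c)%N]) open_cell d;
  cw_weak_topology : forall A : set T,
    (forall c, closed (cball R (dim c) `&` @char_map c @^-1` A)) -> closed A
}.

Arguments char_map {R T} X c u : rename.
Arguments open_cell {R T} X c : rename.

Section CWTheory.
Variables (R : realType) (T : topologicalType) (X : cw_complex R T).

Local Notation ball_of c := (cball R (dim (c : cell X))).

Definition closed_cell (c : cell X) : set T := char_map X c @` ball_of c.

Definition cw_locally_finite : Prop := forall x : T,
  exists2 U, nbhs x U & finite_set [set c | closed_cell c `&` U !=set0].

Definition cw_has_dim (n : nat) : Prop :=
  (forall c : cell X, (dim c <= n)%N) /\ exists c : cell X, dim c = n.

(* The attaching maps tile the boundary sphere of [c] by the connected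
   components of the preimages of the open cells [d]. *)
Definition is_face (c d : cell X) (s : set 'rV[R]_(dim c)) : Prop :=
  exists2 x, (ball_of c `&` char_map X c @^-1` open_cell X d) x &
    s = connected_component (ball_of c `&` char_map X c @^-1` open_cell X d) x.

(* The attaching maps are combinatorial: every face of the closed ball of [c]
   is a copy of the open cell it is sent to.  This is what makes the barycentric
   subdivision of [X] meaningful; it holds for every regular CW-complex, every
   polyhedral complex, and every 2-complex whose 2-cells are attached along
   edge paths of positive length. *)
Definition cw_combinatorial : Prop := forall c d s,
  is_face d s -> set_bij s (open_cell X d) (char_map X c).

(* The proper faces are the edges of the barycentric subdivision: [(c, s)] joins
   the barycentre of [c] to the barycentre of the cell onto which [s] is sent.
   The vertex at the barycentre of [c] is represented by the interior face
   [(c, oball)]. *)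
Record face := Face {
  face_cell : cell X;
  face_set : set 'rV[R]_(dim face_cell);
  faceP : exists d, is_face d face_set
}.

Arguments face_set : clear implicits.

Definition homeo (U V : topologicalType) (A : set U) (B : set V) (f : U -> V) :
    Prop :=
  exists g : V -> U,
    [/\ {within A, continuous f}, {within B, continuous g},
        set_fun A B f, set_fun B A g &
        {in A, cancel f g} /\ {in B, cancel g f}].

(* [f] sends the closed cell [face_cell p] to the closed cell
   [face_cell (s p)], lifts to the closed balls, and the lift sends the face
   [p] to the face [s p]. *)
Definition induces (f : T -> T) (s : face -> face) : Prop := forall p : face,
  exists a : 'rV[R]_(dim (face_cell p)) -> 'rV[R]_(dim (face_cell (s p))),
    [/\ homeo (ball_of (face_cell p)) (ball_of (face_cell (s p))) a,
        forall u, ball_of (face_cell p) u ->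
          f (char_map X (face_cell p) u) = char_map X (face_cell (s p)) (a u) &
        a @` face_set p = face_set (s p)].

(* A combinatorial automorphism is a cell-permuting homeomorphism, two of them
   being identified when they agree on the barycentric subdivision; it is
   recorded as the permutation of the faces that it induces. *)
Record cw_aut := CWAut {
  aut_fun :> face -> face;
  aut_inv : face -> face;
  aut_funK : cancel aut_fun aut_inv;
  aut_invK : cancel aut_inv aut_fun;
  aut_homeo : exists f g : T -> T,
    [/\ continuous f, continuous g, cancel f g, cancel g f &
        induces f aut_fun /\ induces g aut_inv]
}.


Lemma cw_aut_eq (x y : cw_aut) : x =1 y -> x = y.
Proof.
case: x y => [f f' fK f'K hf] [g g' gK g'K hg] /= /funext fg.
rewrite {}fg in fK f'K hf *.
have e : f' = g' by apply/funext => p; rewrite -[p in LHS]g'K fK.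
rewrite {}e in fK f'K hf *.
by congr CWAut; exact: Prop_irrelevance.
Qed.

Lemma homeo_id (U : topologicalType) (A : set U) : homeo A A idfun.
Proof.
by exists idfun; split=> //; apply: continuous_subspaceT => x; exact: cvg_id.
Qed.

Lemma within_comp (U V W : topologicalType) (A : set U) (B : set V)
  (f : U -> V) (g : V -> W) : {within A, continuous f} ->
  {within B, continuous g} -> set_fun A B f -> {within A, continuous (g \o f)}.
Proof.
move=> /subspace_continuousP cf /subspace_continuousP cg fAB.
apply/subspace_continuousP => x Ax.
apply: cvg_trans (cg _ (fAB _ Ax)) => P /= hP.
have := cf x Ax _ hP; rewrite /nbhs /= /within /=.
by apply: filterS => y hy Ay; apply: hy => //; exact: fAB.
Qed.

Lemma homeo_comp (U V W : topologicalType) (A : set U) (B : set V) (C : set W)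
  (f : U -> V) (g : V -> W) : homeo A B f -> homeo B C g -> homeo A C (g \o f).
Proof.
move=> [f' [cf cf' sf sf' [fK f'K]]] [g' [cg cg' sg sg' [gK g'K]]].
exists (f' \o g'); split.
- exact: within_comp cf cg sf.
- exact: within_comp cg' cf' sg'.
- by move=> x Ax; apply: sg; exact: sf.
- by move=> x Ax; apply: sf'; exact: sg'.
- split=> x /set_mem Ax /=.
  + by rewrite gK ?fK//; apply/mem_set => //; exact: sf.
  + by rewrite f'K ?g'K//; apply/mem_set => //; exact: sg'.
Qed.

Lemma induces_id : induces idfun idfun.
Proof.
by move=> p; exists idfun; split=> //; [exact: homeo_id | exact: image_id].
Qed.

Lemma induces_comp (f g : T -> T) (s t : face -> face) :
  induces f s -> induces g t -> induces (f \o g) (s \o t).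
Proof.
move=> fs gt p; have [a [ha ga aE]] := gt p; have [b [hb fb bE]] := fs (t p).
exists (b \o a); split=> /=.
- exact: homeo_comp ha hb.
- move=> u pu; rewrite ga// fb//.
  by case: ha => [? [_ _ + _ _]]; exact.
- by rewrite -image_comp aE bE.
Qed.

Lemma aut_homeo_id : exists f g : T -> T,
  [/\ continuous f, continuous g, cancel f g, cancel g f &
      induces f idfun /\ induces g idfun].
Proof.
exists idfun, idfun; split=> //; try by move=> x; exact: cvg_id.
by split; exact: induces_id.
Qed.

Definition cw_aut_one := CWAut (fun=> erefl) (fun=> erefl) aut_homeo_id.

Lemma aut_homeo_inv (x : cw_aut) : exists f g : T -> T,
  [/\ continuous f, continuous g, cancel f g, cancel g f &
      induces f (aut_inv x) /\ induces g x].
Proof.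
by have [f [g [cf cg fK gK [fx gx]]]] := aut_homeo x; exists g, f; split.
Qed.

Definition cw_aut_inv (x : cw_aut) :=
  CWAut (@aut_invK x) (@aut_funK x) (aut_homeo_inv x).

Lemma aut_homeo_mul (x y : cw_aut) : exists f g : T -> T,
  [/\ continuous f, continuous g, cancel f g, cancel g f &
      induces f (x \o y) /\ induces g (aut_inv y \o aut_inv x)].
Proof.
have [f [f' [cf cf' fK f'K [fx fx']]]] := aut_homeo x.
have [g [g' [cg cg' gK g'K [gy gy']]]] := aut_homeo y.
exists (f \o g), (g' \o f'); split.
- by move=> u; apply: continuous_comp; [exact: cg | exact: cf].
- by move=> u; apply: continuous_comp; [exact: cf' | exact: cg'].
- exact: can_comp.
- exact: can_comp.
- by split; exact: induces_comp.
Qed.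

Definition cw_aut_mul (x y : cw_aut) :=
  CWAut (can_comp (@aut_funK x) (@aut_funK y))
    (can_comp (@aut_invK y) (@aut_invK x)) (aut_homeo_mul x y).

HB.instance Definition _ := gen_eqMixin cw_aut.
HB.instance Definition _ := gen_choiceMixin cw_aut.

Lemma cw_aut_mulA : associative cw_aut_mul.
Proof. by move=> x y z; exact: cw_aut_eq. Qed.

Lemma cw_aut_mul1 : left_id cw_aut_one cw_aut_mul.
Proof. by move=> x; exact: cw_aut_eq. Qed.

Lemma cw_aut_mulr1 : right_id cw_aut_one cw_aut_mul.
Proof. by move=> x; exact: cw_aut_eq. Qed.

Lemma cw_aut_mulV : left_inverse cw_aut_one cw_aut_inv cw_aut_mul.
Proof. by move=> x; apply: cw_aut_eq => p /=; rewrite aut_funK. Qed.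

Lemma cw_aut_mulrV : right_inverse cw_aut_one cw_aut_inv cw_aut_mul.
Proof. by move=> x; apply: cw_aut_eq => p /=; rewrite aut_invK. Qed.

HB.instance Definition _ := isGroup.Build cw_aut
  cw_aut_mulA cw_aut_mul1 cw_aut_mulr1 cw_aut_mulV cw_aut_mulrV.

HB.instance Definition _ := isPointed.Build cw_aut 1%g.

(* The cosets of the pointwise stabilisers of finite sets of faces form a basis
   of open sets. *)
Definition aut_open (U : set cw_aut) : Prop := forall x, U x ->
  exists2 F : set face, finite_set F &
    forall y : cw_aut, (forall p, F p -> y p = x p) -> U y.

Lemma aut_openT : aut_open setT.
Proof. by move=> x _; exists set0. Qed.

Lemma aut_openI : setI_closed aut_open.
Proof.
move=> U V oU oV x [/oU[F fF FU] /oV[E fE EV]].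
exists (F `|` E); first by rewrite finite_setU.
by move=> y h; split; [apply: FU | apply: EV] => p hp; apply: h; [left|right].
Qed.

Lemma aut_open_bigU (I : Type) (U : I -> set cw_aut) :
  (forall i, aut_open (U i)) -> aut_open (\bigcup_i U i).
Proof.
move=> oU x [i _ /oU[F fF FU]]; exists F => // y /FU Uy.
by exists i.
Qed.

HB.instance Definition _ :=
  isOpenTopological.Build cw_aut aut_openT aut_openI aut_open_bigU.

Lemma aut_nbhsP (x : cw_aut) (A : set cw_aut) :
  nbhs x A <-> exists2 F : set face, finite_set F &
    forall y : cw_aut, (forall p, F p -> y p = x p) -> A y.
Proof.
split; first by rewrite nbhsE => -[B [oB Bx] BA];
  have [F fF FB] := oB x Bx; exists F => // y /FB /BA.
move=> [F fF FA]; rewrite nbhsE.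
have oF : open [set y : cw_aut | forall p, F p -> y p = x p].
  by move=> y Fy; exists F => // z zy p Fp; rewrite zy// Fy.
by exists [set y : cw_aut | forall p, F p -> y p = x p].
Qed.

Lemma aut_mul_continuous :
  continuous (fun xy : cw_aut * cw_aut => (xy.1 * xy.2)%g).
Proof.
move=> [x y] A /= /aut_nbhsP[F fF FA].
exists ([set z : cw_aut | forall p, (y @` F) p -> z p = x p],
        [set z : cw_aut | forall p, F p -> z p = y p]) => /=.
  split; apply/aut_nbhsP; last by exists F.
  by exists (y @` F) => //; exact: finite_image.
move=> [z w] /= [zx wy]; apply: FA => p Fp /=.
by rewrite wy// zx//; exists p.
Qed.

Lemma aut_inv_continuous : continuous (fun x : cw_aut => x^-1%g).
Proof.
move=> x A /= /aut_nbhsP[F fF FA]; apply/aut_nbhsP.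
exists (aut_inv x @` F); first exact: finite_image.
move=> y yx; apply: FA => p Fp /=.
by rewrite -{1}(aut_invK x p) -yx ?aut_funK//; exists p.
Qed.

HB.instance Definition _ :=
  isTopologicalGroup.Build cw_aut aut_mul_continuous aut_inv_continuous.

End CWTheory.

(* Main.v *)
(* The chain complex 0 -> C2 -> C1 -> C0 -> Q -> 0 of the contractible 2-complex is exact, and
   its terms are projective over the rational group ring of Gamma, because a discrete
   subgroup acts with finite cell stabilisers.  If Gamma is finitely presented, comparing
   this resolution with the free modules F2 -> F1 -> F0 of the presentation, which are
   finitely generated, gives an endomorphism t of F2 that is the identity modulo
   ker (F2 -> F1) and kills this kernel.  Multiplying t by a common denominator m and
   averaging over a finite subgroup S yields an S-invariant integral element of augmentation m
   in the group ring; so the order of S divides m.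

   Hence all finite subgroups of Gamma have order at most m.  Let U be a compact open
   subgroup of the automorphism group.  The intersections of Gamma with the conjugates of U
   are finite, so each double coset Gamma g U contributes at least mu(U) / m to the covolume.
   There are thus finitely many of them, and Gamma is uniform.

   The exactness of the chain complex is obtained by lifting maps along the contraction:
   circle-valued functions to R for C1, and maps to the sphere through the Hopf fibration
   for C2. *)
From HB Require Import structures.
From mathcomp Require Import all_boot all_order all_algebra.
From mathcomp Require Import all_classical all_reals all_analysis.
From mathcomp Require Import ring lra zify.
From mathcomp Require multinomials.freeg.
Require Import Defs.
Set Implicit Arguments.
Unset Strict Implicit.
Unset Printing Implicit Defensive.
Import Order.TTheory GRing.Theory Num.Theory numFieldNormedType.Exports.
Local Open Scope classical_set_scope.
Local Open Scope ring_scope.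

(** * Monomial modules over a group ring *)

Section FreeModules.
Import multinomials.freeg.
Variables (A : choiceType) (M : lmodType rat).
Implicit Type b : A -> M.

(** The endomorphism [t] is idempotent, and [1 - t] projects F2 onto the kernel of F2 -> F1: the
    comparison map through C2 vanishes on that kernel because C2 -> C1 is injective. This is where
    dimension 2 enters. One denominator m is enough because there are finitely many relators. Maps
    that are equivariant only on cycles are then extended, degree by degree, by averaging over the
    finite subgroup, which preserves integrality.

    Neither degrees of maps nor orientations of 2-cells are computed. Chains are tested against
    integral cochains; a cochain is encoded as a circle-valued function on the graph, and its value
    on the boundary of a 2-cell is a winding number. An automorphism is therefore only known to
    carry the boundary of a 2-cell to a multiple of the boundary of its image, and this suffices for
    modules that are permuted up to scalars.

    Local finiteness keeps the track of a compact set under the contraction within finitely many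
    cells, and continuity is only checked there. The compact open subgroup is extracted from the
    regularity of the Haar measure. *)

Definition basis_ext b (x : {freeg A / rat}) : M :=
  \sum_(a <- dom x) coeff a x *: b a.

Lemma basis_ext_big b (s : seq A) x : uniq s -> {subset dom x <= s} ->
  basis_ext b x = \sum_(a <- s) coeff a x *: b a.
Proof.
move=> us xs; rewrite [RHS](bigID (mem (dom x))) /= [X in _ + X]big1 ?addr0.
  rewrite /basis_ext -[RHS]big_filter; apply: perm_big.
  apply: uniq_perm; [exact: uniq_dom | exact: filter_uniq|].
  move=> a; rewrite mem_filter; case: (boolP (a \in dom x)) => //= /xs ->//.
by move=> a ax; rewrite coeff_outdom// scale0r.
Qed.

Lemma basis_ext_linear b : linear (basis_ext b).
Proof.
move=> k x y; set s := undup (dom (k *: x + y) ++ dom x ++ dom y).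
have us : uniq s by exact: undup_uniq.
rewrite !(@basis_ext_big _ s)//; try by move=> a ax; rewrite mem_undup !mem_cat ax ?orbT.
rewrite scaler_sumr -big_split; apply: eq_bigr => a _ /=.
by rewrite coeffD coeffZ scalerDl scalerA.
Qed.
HB.instance Definition _ b :=
  GRing.isLinear.Build rat {freeg A / rat} M _ (basis_ext b) (basis_ext_linear b).

Lemma basis_extE b a : basis_ext b << a >> = b a.
Proof.
by rewrite /basis_ext domU1 big_seq1 coeffU eqxx mulr1 scale1r.
Qed.

Lemma freeg_basisE (x : {freeg A / rat}) :
  x = \sum_(a <- dom x) coeff a x *: << a >>.
Proof.
rewrite -[LHS]freeg_sumE; apply: eq_bigr => a _.
by apply/eqP/freeg_eqP => c; rewrite coeffZ !coeffU mul1r.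
Qed.

Lemma linear_basisE (f : {linear {freeg A / rat} -> M}) x :
  f x = \sum_(a <- dom x) coeff a x *: f << a >>.
Proof.
by rewrite [in LHS](freeg_basisE x) linear_sum; apply: eq_bigr => a _; rewrite linearZ.
Qed.

Lemma linear_eq_basis (f g : {linear {freeg A / rat} -> M}) :
  (forall a, f << a >> = g << a >>) -> f =1 g.
Proof. by move=> fg x; rewrite !linear_basisE; apply: eq_bigr => a _; rewrite fg. Qed.

End FreeModules.

Section Actions.
Import multinomials.freeg.
Variable G : groupType.

Record gmodule := GModule {
  gmod :> lmodType rat;
  gact : G -> {linear gmod -> gmod};
  gact1 : forall x, gact 1%g x = x;
  gactM : forall g h x, gact (g * h)%g x = gact g (gact h x)
}.

Record gset := GSet {
  gset_sort :> choiceType;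
  sact : G -> gset_sort -> gset_sort;
  sact1 : forall a, sact 1%g a = a;
  sactM : forall g h a, sact (g * h)%g a = sact g (sact h a)
}.

Arguments gact : clear implicits.
Arguments sact : clear implicits.

Definition equivariant (M N : gmodule) (f : M -> N) :=
  forall g x, f (gact M g x) = gact N g (f x).

Definition finite_stabilizers (A : gset) :=
  forall a : A, finite_set [set g | sact A g a = a].

(** Only the lines through the basis vectors are permuted. The scalar is left open because a group
    element may reverse the orientation of a cell, and on 2-cells the factor is merely known to
    exist. *)
Record monomial (A : gset) := Monomial {
  mono_act : G -> {linear {freeg A / rat} -> {freeg A / rat}};
  mono_act1 : forall x, mono_act 1%g x = x;
  mono_actM : forall g h x, mono_act (g * h)%g x = mono_act g (mono_act h x);
  mono_actE : forall g a, exists k : rat, mono_act g << a >> = k *: << sact A g a >>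
}.

Definition mono_gmod A (M : monomial A) := GModule (@mono_act1 A M) (@mono_actM A M).
Coercion mono_gmod : monomial >-> gmodule.

Lemma gactVK (M : gmodule) g : cancel (gact M g^-1%g) (gact M g).
Proof. by move=> x; rewrite -gactM mulgV gact1. Qed.
Lemma gactB (M : gmodule) g (x y : M) : gact M g (x - y) = gact M g x - gact M g y.
Proof. exact: linearB. Qed.
Lemma gactZ (M : gmodule) g k (x : M) : gact M g (k *: x) = k *: gact M g x.
Proof. exact: linearZ. Qed.
Lemma sactK (M : gset) g : cancel (sact M g) (sact M g^-1%g).
Proof. by move=> x; rewrite -sactM mulVg sact1. Qed.

Section Orbits.
Variable A : gset.
Hypothesis finA : finite_stabilizers A.

(** The value of [choose] depends on the orbit as a predicate only, so it is the same at all points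
    of an orbit. *)
Definition orbit_rep (a : A) : A := choose (fun b => `[< exists g, sact A g a = b >]) a.

Lemma orbit_repP a : exists g, sact A g (orbit_rep a) = a.
Proof.
have /asboolP [g gE] := @chooseP A (fun b => `[< exists g, sact A g a = b >]) a
  (asboolT (ex_intro _ 1%g (sact1 a))).
by exists g^-1%g; rewrite -[LHS]/(sact A g^-1%g (orbit_rep a)) /orbit_rep -gE sactK.
Qed.

Lemma orbit_rep_act g a : orbit_rep (sact A g a) = orbit_rep a.
Proof.
rewrite /orbit_rep; set P := (fun b => `[< exists h, sact A h (sact A g a) = b >]).
set Q := (fun b => `[< exists h, sact A h a = b >]).
have PQ : P =1 Q.
  move=> b; apply/asboolP/asboolP => -[h <-]; first by exists (h * g)%g; rewrite sactM.
  by exists (h * g^-1)%g; rewrite sactM sactK.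
rewrite (eq_choose PQ); apply: choose_id; apply/asboolP; first by exists g.
by exists 1%g; rewrite sact1.
Qed.

(** A left coset of the stabiliser of the representative. Unlike the stabilisers, the transporters
    of two points of one orbit are translates of each other, so averages over them are compatible
    with the action. *)
Definition transporter a : set G := [set g | sact A g (orbit_rep a) = a].

Lemma finite_transporter a : finite_set (transporter a).
Proof.
have [g ga] := orbit_repP a.
apply: (@sub_finite_set _ _ ((fun h => (g * h)%g) @` [set h | sact A h (orbit_rep a) = orbit_rep a])).
  move=> h ha; exists (g^-1 * h)%g; rewrite ?mulgA ?mulgV ?mul1g//= sactM ha.
  by rewrite -[LHS]/(sact A g^-1%g a) -{1}ga sactK.
exact/finite_image/finA.
Qed.

Definition transporter_seq a : seq G := finmap.enum_fset (fset_set (transporter a)).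

Lemma mem_transporter a g : (g \in transporter_seq a) = `[< transporter a g >].
Proof.
rewrite /transporter_seq in_fset_set; last exact: finite_transporter.
by apply/idP/asboolP => [/set_mem//|?]; exact/mem_set.
Qed.

Lemma transporter_uniq a : uniq (transporter_seq a).
Proof. exact: finmap.fset_uniq. Qed.

Lemma transporter_act g a :
  perm_eq (transporter_seq (sact A g a)) [seq (g * h)%g | h <- transporter_seq a].
Proof.
apply: uniq_perm; first exact: transporter_uniq.
  by rewrite map_inj_uniq; [exact: transporter_uniq | exact: mulgI].
move=> h; rewrite mem_transporter; apply/asboolP/mapP => [|[k]].
  rewrite /transporter /= orbit_rep_act => hE; exists (g^-1 * h)%g.
    by rewrite mem_transporter; apply/asboolP; rewrite /transporter /= sactM hE sactK.
  by rewrite mulgA mulgV mul1g.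
rewrite mem_transporter => /asboolP ka ->; rewrite /transporter /= orbit_rep_act.
by rewrite sactM ka.
Qed.

Lemma size_transporter_gt0 a : (0 < size (transporter_seq a))%N.
Proof.
have [g ga] := orbit_repP a.
have : g \in transporter_seq a by rewrite mem_transporter; apply/asboolP.
by case: transporter_seq.
Qed.

(* The lift is averaged over the finite stabilisers, which requires rational coefficients. *)
Lemma monomial_projective (M : monomial A) (N N' : gmodule)
  (p : {linear N -> N'}) (psi : {linear {freeg A / rat} -> N'}) :
  equivariant p -> @equivariant M N' psi ->
  (forall a, exists n, p n = psi << a >>) ->
  exists f : {linear {freeg A / rat} -> N},
    @equivariant M N f /\ forall x, p (f x) = psi x.
Proof.
move=> pe psie /choice[tau0 tau0E].
pose tau := basis_ext tau0.
have tauE x : p (tau x) = psi x.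
  move: x; apply: (@linear_eq_basis _ N' (p \o basis_ext tau0) psi) => a /=.
  by rewrite basis_extE tau0E.
pose avg a : N := (size (transporter_seq a))%:R^-1 *:
   \sum_(g <- transporter_seq a) gact N g (tau (gact M g^-1%g << a >>)).
have avgE g a k : mono_act M g << a >> = k *: << sact A g a >> ->
   k *: avg (sact A g a) = gact N g (avg a).
  move=> gE; rewrite /avg (perm_size (transporter_act g a)) size_map.
  rewrite (perm_big _ (transporter_act g a)) big_map scalerA mulrC -scalerA [RHS]linearZ /=.
  rewrite [in RHS]linear_sum scaler_sumr; congr (_ *: _); apply: eq_bigr => h _.
  have -> : gact M h^-1%g << a >> = k *: gact M (g * h)^-1%g << sact A g a >>.
    by rewrite -linearZ -gE -[mono_act M g _]/(gact M g _) -gactM invgM -mulgA mulVg mulg1.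
  by rewrite /tau !linearZ /= gactM.
exists (basis_ext avg : {linear _ -> _}); split.
- move=> g; apply: (@linear_eq_basis _ _ (basis_ext avg \o gact M g) (gact N g \o basis_ext avg)).
  move=> a /=; have [k kE] := mono_actE M g a.
  by rewrite kE linearZ /= !basis_extE; exact: avgE.
- apply: (@linear_eq_basis _ _ (p \o basis_ext avg) psi) => a /=.
  rewrite basis_extE /avg linearZ linear_sum /=.
  under eq_bigr => g _ do rewrite pe tauE psie -/(gact M _ _) gactVK.
  rewrite big_const_seq count_predT iter_addr_0 -scaler_nat scalerA mulVf ?scale1r//.
  by rewrite pnatr_eq0 -lt0n size_transporter_gt0.
Qed.
End Orbits.
End Actions.
Arguments gact {G} _ _ : simpl never.
Arguments sact {G} _ _ _.

(** * Chains with integral coefficients *)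

Section Integrality.
Import multinomials.freeg.

Definition integral_chain (A : choiceType) (x : {freeg A / rat}) :=
  forall a, coeff a x \is a Num.int.

Definition integral_map (A B : choiceType) (f : {freeg A / rat} -> {freeg B / rat}) :=
  forall x, integral_chain x -> integral_chain (f x).

Section OneBasis.
Variable A : choiceType.

Lemma integral_basis (a : A) : integral_chain << a >>.
Proof. by move=> b; rewrite coeffU mul1r natr_int. Qed.

Lemma integral_chainD (x y : {freeg A / rat}) :
  integral_chain x -> integral_chain y -> integral_chain (x + y).
Proof. by move=> ix iy a; rewrite coeffD rpredD. Qed.

Lemma integral_chainN (x : {freeg A / rat}) : integral_chain x -> integral_chain (- x).
Proof. by move=> ix a; rewrite coeffN rpredN. Qed.

Lemma integral_chainZ k (x : {freeg A / rat}) :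
  k \is a Num.int -> integral_chain x -> integral_chain (k *: x).
Proof. by move=> ik ix a; rewrite coeffZ rpredM. Qed.

Lemma integral_chain0 : integral_chain (0 : {freeg A / rat}).
Proof. by move=> a; rewrite coeff0 rpred0. Qed.

Lemma integral_chain_sum (I : eqType) (s : seq I) (F : I -> {freeg A / rat}) :
  (forall i, i \in s -> integral_chain (F i)) -> integral_chain (\sum_(i <- s) F i).
Proof.
move=> iF; rewrite big_seq; elim/big_ind: _ => //; [exact: integral_chain0 | exact: integral_chainD].
Qed.

Lemma common_denominator (x : {freeg A / rat}) :
  exists2 m, (0 < m)%N & integral_chain (m%:R *: x).
Proof.
suff H (s : seq A) : exists2 m, (0 < m)%N & integral_chain (m%:R *: \sum_(a <- s) coeff a x *: << a >>).
  by have [m m0 mi] := H (dom x); exists m => //; rewrite [x]freeg_basisE.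
elim: s => [|a s [m m0 mi]].
  by exists 1%N => //; rewrite big_nil scaler0; exact: integral_chain0.
exists (`|denq (coeff a x)| * m)%N; first by rewrite muln_gt0 m0 absz_gt0 denq_neq0.
rewrite big_cons scalerDr; apply: integral_chainD.
  rewrite scalerA; apply: integral_chainZ; last exact: integral_basis.
  rewrite natrM mulrAC rpredM ?natr_int// -{2}[coeff a x]divq_num_den pmulrn absz_denq.
  by rewrite mulrC divfK ?intr_int// intr_eq0 denq_neq0.
by rewrite natrM -scalerA; apply: integral_chainZ; rewrite ?natr_int.
Qed.

End OneBasis.

Lemma integral_basis_ext (A B : choiceType) (b : A -> {freeg B / rat}) :
  (forall a, integral_chain (b a)) -> integral_map (basis_ext b).
Proof.
by move=> ib x ix; apply: integral_chain_sum => a _; apply: integral_chainZ.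
Qed.

End Integrality.

(** * Free modules over the group ring and averages over a finite subgroup *)

Section FreeActions.
Import multinomials.freeg.
Variable G : groupType.

Section Free.
Variable I : choiceType.

Definition free_act (g : G) (p : G * I) : G * I := ((g * p.1)%g, p.2).

Lemma free_act1 p : free_act 1%g p = p.
Proof. by case: p => h i; rewrite /free_act mul1g. Qed.
Lemma free_actM g h p : free_act (g * h)%g p = free_act g (free_act h p).
Proof. by rewrite /free_act mulgA. Qed.

Definition free_gset := GSet free_act1 free_actM.

Definition free_lact (g : G) := basis_ext (fun p : G * I => << free_act g p >>).

Lemma free_lact1 (x : {freeg (G * I) / rat}) : free_lact 1%g x = x.
Proof.
move: x; apply: (@linear_eq_basis _ _ (free_lact 1%g) idfun) => p /=.
by rewrite /free_lact basis_extE free_act1.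
Qed.

Lemma free_lactM g h (x : {freeg (G * I) / rat}) :
  free_lact (g * h)%g x = free_lact g (free_lact h x).
Proof.
move: x; apply: (@linear_eq_basis _ _ (free_lact _) (free_lact g \o free_lact h)) => p /=.
by rewrite /free_lact !basis_extE free_actM.
Qed.

Lemma free_lactE g (p : G * I) :
  exists k : rat, free_lact g << p >> = k *: << sact free_gset g p >>.
Proof. by exists 1; rewrite scale1r /free_lact basis_extE. Qed.

Definition free_mono : monomial free_gset :=
  @Monomial G free_gset free_lact free_lact1 free_lactM free_lactE.

Lemma free_finite_stabilizers : finite_stabilizers free_gset.
Proof.
move=> [h i]; apply: (@sub_finite_set _ _ [set 1%g]) => [g|]; last exact: finite_set1.
by case=> /eqP; rewrite -{2}[h]mul1g => /eqP/mulIg.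
Qed.

Lemma gact_free g p : gact free_mono g << p >> = << free_act g p >>.
Proof. exact: basis_extE. Qed.

Lemma integral_gact g : integral_map (gact free_mono g).
Proof. by apply: integral_basis_ext => p; exact: integral_basis. Qed.

End Free.

Section FiniteSubgroup.
Variable S : seq G.
Hypotheses (uS : uniq S) (S1 : 1%g \in S) (SM : {in S &, forall a b, (a * b)%g \in S})
  (SV : {in S, forall a, a^-1%g \in S}).

Definition coset_rep (g : G) : G := choose (fun h => has (fun s => (s * g)%g == h) S) g.

Lemma coset_repP g : exists2 s, s \in S & (s * g)%g = coset_rep g.
Proof.
have h : has (fun s => (s * g)%g == g) S by apply/hasP; exists 1%g; rewrite ?mul1g.
have /hasP [s sS /eqP sE] := @chooseP _ (fun h => has (fun s => (s * g)%g == h) S) g h.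
by exists s.
Qed.

Lemma coset_rep_mul s g : s \in S -> coset_rep (s * g)%g = coset_rep g.
Proof.
move=> sS; rewrite /coset_rep.
have e : (fun h => has (fun t => (t * (s * g))%g == h) S) =1 (fun h => has (fun t => (t * g)%g == h) S).
  move=> h; apply/hasP/hasP => -[t tS /eqP <-].
    by exists (t * s)%g; rewrite ?mulgA//; exact: SM.
  by exists (t * s^-1)%g; rewrite ?SM ?SV// mulgA mulgVK.
rewrite (eq_choose e); apply: choose_id; apply/hasP; first by exists s.
by exists 1%g; rewrite ?mul1g.
Qed.

Variable I : choiceType.

(** The projection onto the span of a transversal of the cosets of [S]. It does not commute with
    [S]; its conjugates add up to the identity. *)
Definition transversal_proj :=
  basis_ext (fun p : G * I => if coset_rep p.1 == p.1 then << p >> else 0 : {freeg (G * I) / rat}).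

Lemma integral_transversal_proj : integral_map transversal_proj.
Proof.
apply: integral_basis_ext => p; case: ifP => _; [exact: integral_basis | exact: integral_chain0].
Qed.

(** Each basis vector survives in exactly one summand, that of the element of [S] which brings it
    back from its coset representative. The module is induced from the span of the transversal. *)
Lemma sum_transversal_proj (x : {freeg (G * I) / rat}) :
  \sum_(s <- S) gact (free_mono I) s (transversal_proj (gact (free_mono I) s^-1%g x)) = x.
Proof.
move: x.
pose F s := (gact (free_mono I) s \o (transversal_proj \o gact (free_mono I) s^-1%g)).
have lF : linear (fun x => \sum_(s <- S) F s x).
  move=> k x y; rewrite scaler_sumr -big_split; apply: eq_bigr => s _.
  by rewrite /F /transversal_proj linearP.
pose L := GRing.isLinear.Build _ _ _ _ _ lF.
pose f : {linear _ -> _} := HB.pack (fun x => \sum_(s <- S) F s x) L.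
apply: (@linear_eq_basis _ _ f idfun) => -[g i] /=.
have [t tS tE] := coset_repP g.
rewrite (big_rem t^-1%g) ?SV//= /F /= invgK gact_free /transversal_proj basis_extE /free_act /= coset_rep_mul// tE eqxx.
rewrite gact_free /free_act -tE mulgA mulVg mul1g big_seq big1 ?addr0// => s.
rewrite mem_rem_uniq// inE => /andP[st sS].
rewrite /= gact_free basis_extE /= coset_rep_mul ?SV//.
case: ifPn => [/eqP|]; last by rewrite linear0.
by rewrite -tE => /mulIg e; rewrite e invgK eqxx in st.
Qed.

Variable J : choiceType.

(* Free modules are injective relative to maps that split over [rat]. *)
Definition average (f : {linear {freeg (G * J) / rat} -> {freeg (G * I) / rat}}) x :=
  \sum_(s <- S) gact (free_mono I) s (transversal_proj (f (gact (free_mono J) s^-1%g x))).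

Lemma average_linear f : linear (average f).
Proof.
move=> k x y; rewrite scaler_sumr -big_split; apply: eq_bigr => s _.
by rewrite /transversal_proj !linearP.
Qed.
HB.instance Definition _ f := GRing.isLinear.Build rat _ _ _ (average f) (average_linear f).

Lemma integral_average (f : {linear _ -> _}) : integral_map f -> integral_map (average f).
Proof.
move=> fi x xi; apply: integral_chain_sum => s _; apply/integral_gact.
by apply/integral_transversal_proj/fi/integral_gact.
Qed.

Lemma average_equivariant f t x : t \in S ->
  average f (gact (free_mono J) t x) = gact (free_mono I) t (average f x).
Proof.
move=> tS; rewrite /average linear_sum.
have pS : perm_eq S [seq (t * s)%g | s <- S].
  apply: uniq_perm; rewrite ?map_inj_uniq//; first exact: mulgI.
  move=> s; apply/idP/mapP => [sS|[r rS ->]]; last exact: SM.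
  by exists (t^-1 * s)%g; rewrite ?SM ?SV// mulgA mulgV mul1g.
rewrite (perm_big _ pS) big_map; apply: eq_bigr => s _.
by rewrite gactM -(gactM (t * s)^-1%g) invgM -mulgA mulVg mulg1.
Qed.

(** Equivariance is asked at the single vector [x]. So a map that is equivariant on a submodule only
    can be replaced by one that is equivariant everywhere and unchanged on the submodule. *)
Lemma average_id (f : {linear {freeg (G * J) / rat} -> {freeg (G * I) / rat}}) x :
  {in S, forall s, f (gact (free_mono J) s x) = gact (free_mono I) s (f x)} ->
  average f x = f x.
Proof.
move=> fx; rewrite -[RHS]sum_transversal_proj /average big_seq [RHS]big_seq.
by apply: eq_bigr => s sS; rewrite fx// SV.
Qed.

End FiniteSubgroup.
End FreeActions.

(** * Finite presentations *)

Section Presentation.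
Import multinomials.freeg.
Variables (G : groupType) (n : nat) (rels : seq (word n)) (x : 'I_n -> G).
Hypothesis word_eval_surj : forall g, exists w, word_eval x w = g.
Hypothesis word_evalP : forall v w, word_eval x v = word_eval x w <-> word_conv rels v w.

Local Notation gens := 'I_n.
Local Notation rel_index := 'I_(size rels).
Local Notation F0 := (free_mono G unit).
Local Notation F1 := (free_mono G gens).
Local Notation F2 := (free_mono G rel_index).

Lemma word_eval_cons l (w : word n) :
  word_eval x (l :: w) = ((if l.2 then x l.1 else (x l.1)^-1) * word_eval x w)%g.
Proof. by rewrite /word_eval big_cons. Qed.

Lemma word_eval_cat (v w : word n) : word_eval x (v ++ w) = (word_eval x v * word_eval x w)%g.
Proof. by rewrite /word_eval big_cat. Qed.

(* Fox calculus: the chain of the path of the Cayley graph that starts at [g] and reads [w]. *)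
Fixpoint fox (g : G) (w : word n) : {freeg (G * gens) / rat} :=
  if w isn't (i, b) :: w' then 0 else
  if b then << (g, i) >> + fox (g * x i)%g w'
  else fox (g * (x i)^-1)%g w' - << ((g * (x i)^-1)%g, i) >>.

Lemma fox_cat g v w : fox g (v ++ w) = fox g v + fox (g * word_eval x v)%g w.
Proof.
elim: v g => [g|[i b] v IH g] /=; first by rewrite add0r /word_eval big_nil mulg1.
by rewrite word_eval_cons; case: b; rewrite IH /= mulgA ?addrA// addrAC.
Qed.

Lemma gact_fox h g w : gact F1 h (fox g w) = fox (h * g)%g w.
Proof.
elim: w g => [g|[i b] w IH g]; first by rewrite linear0.
by case: b; rewrite /= ?linearD ?linearB IH ?(gact_free, linearN, basis_extE) /= ?basis_extE /free_act /= !mulgA.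
Qed.

Lemma integral_fox g w : integral_chain (fox g w).
Proof.
elim: w g => [g|[i b] w IH g] /=; first exact: integral_chain0.
case: b => /=; [apply: integral_chainD => // | apply: integral_chainD => //; apply: integral_chainN];
exact: integral_basis.
Qed.

Definition d1 := basis_ext (fun p : G * gens =>
  << ((p.1 * x p.2)%g, tt) >> - << (p.1, tt) >> : {freeg (G * unit) / rat}).
Definition d2 := basis_ext (fun p : G * rel_index => fox p.1 (tnth (in_tuple rels) p.2)).
Definition augmentation := basis_ext (fun _ : G * unit => 1 : rat^o).
Local Notation eps := augmentation.
HB.instance Definition _ := GRing.Linear.on d1.
HB.instance Definition _ := GRing.Linear.on d2.
HB.instance Definition _ := GRing.Linear.on eps.

Lemma d1E g i : d1 << (g, i) >> = << ((g * x i)%g, tt) >> - << (g, tt) >>.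
Proof. exact: basis_extE. Qed.
Lemma d2E g j : d2 << (g, j) >> = fox g (tnth (in_tuple rels) j).
Proof. exact: basis_extE. Qed.
Lemma epsE p : eps << p >> = 1.
Proof. exact: basis_extE. Qed.

Lemma d1_equiv : @equivariant G F1 F0 d1.
Proof.
move=> g; apply: (@linear_eq_basis _ _ (d1 \o gact F1 g) (gact F0 g \o d1)) => -[h i] /=.
by rewrite [X in d1 X]gact_free !d1E linearB /= !gact_free /free_act /= mulgA.
Qed.

Lemma d2_equiv : @equivariant G F2 F1 d2.
Proof.
move=> g; apply: (@linear_eq_basis _ _ (d2 \o gact F2 g) (gact F1 g \o d2)) => -[h i] /=.
by rewrite [X in d2 X]gact_free !d2E [RHS]gact_fox.
Qed.

Lemma eps_act g y : eps (gact F0 g y) = eps y.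
Proof.
move: y; apply: (@linear_eq_basis _ _ (eps \o gact F0 g) eps) => p /=.
by rewrite [X in eps X]gact_free !epsE.
Qed.

Lemma eps_d1 y : eps (d1 y) = 0.
Proof.
rewrite -[LHS]/((eps \o d1) y) linear_basisE big1// => -[g i] _ /=.
by rewrite d1E linearB /= !epsE subrr scaler0.
Qed.

(** The fundamental formula of Fox calculus: the boundary telescopes along the path. *)
Lemma d1_fox g w : d1 (fox g w) = << ((g * word_eval x w)%g, tt) >> - << (g, tt) >>.
Proof.
elim: w g => [g|[i b] w IH g].
  by rewrite linear0 /word_eval big_nil mulg1 subrr.
rewrite word_eval_cons; case: b => /=.
  by rewrite linearD /= IH d1E mulgA addrC subrKA.
by rewrite linearB /= IH d1E mulgA mulgVK opprB subrKA.
Qed.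

(** By induction on the congruence. A free cancellation leaves the chain of a path unchanged, and a
    relator read from [g] bounds one basis vector of the relator module. In a concatenation the two
    second factors start at the same vertex, because congruent words have the same value. *)
Lemma word_conv_fox v w : word_conv rels v w -> forall g,
  exists2 r, integral_chain r & d2 r = fox g v - fox g w.
Proof.
elim => {v w}.
- by move=> w g; exists 0; [exact: integral_chain0 | rewrite linear0 subrr].
- move=> v w _ IH g; have [r ri rE] := IH g.
  by exists (- r); [exact: integral_chainN | rewrite linearN /= rE opprB].
- move=> u v w _ IH _ IH' g; have [r ri rE] := IH g; have [s si sE] := IH' g.
  by exists (r + s); [exact: integral_chainD | rewrite linearD /= rE sE subrKA].
- move=> v v' w w' vv' IH _ IH' g; have [r ri rE] := IH g.
  have [s si sE] := IH' (g * word_eval x v)%g.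
  exists (r + s); first exact: integral_chainD.
  rewrite linearD /= rE sE !fox_cat; have -> : word_eval x v' = word_eval x v.
    by apply/esym/word_evalP.
  by rewrite opprD addrACA.
- move=> i b g; exists 0; first exact: integral_chain0.
  rewrite linear0 ?subr0 ?addr0; case: b => /=; first by rewrite mulgK add0r subrr.
  by rewrite addr0 subrr.
- move=> r rr g; have ir : (index r rels < size rels)%N by rewrite index_mem.
  exists << (g, Ordinal ir) >>; first exact: integral_basis.
  by rewrite d2E subr0 (tnth_nth [::]) /= nth_index.
Qed.

Lemma d1_d2 y : d1 (d2 y) = 0.
Proof.
rewrite -[LHS]/((d1 \o d2) y) linear_basisE big1// => -[g j] _ /=.
rewrite d2E d1_fox; have -> : word_eval x (tnth (in_tuple rels) j) = 1%g.
  transitivity (word_eval x [::]); last by rewrite /word_eval big_nil.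
  by apply/word_evalP/word_conv_rel/mem_tnth.
by rewrite mulg1 subrr scaler0.
Qed.

(* The integral contraction [s0] and the map [r1] witness the exactness of
   [F2 -> F1 -> F0 -> rat]. *)
Lemma presentation_contraction :
  exists (s0 : {linear {freeg (G * unit) / rat} -> {freeg (G * gens) / rat}})
         (r1 : {linear {freeg (G * gens) / rat} -> {freeg (G * rel_index) / rat}}),
  [/\ integral_map s0, integral_map r1,
      forall y, d1 (s0 y) = y - eps y *: << (1%g, tt) >> &
      forall k, d2 (r1 k) = k - s0 (d1 k)].
Proof.
have [wd wdE] := choice word_eval_surj.
pose s0 := basis_ext (fun p : G * unit => fox 1%g (wd p.1)).
have H (p : G * gens) : exists r, integral_chain r /\
    d2 r = << p >> - s0 (d1 << p >>).
  case: p => g i; rewrite d1E /s0 linearB /= !basis_extE /=.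
  (* The chosen path to [g] followed by one edge ends where the chosen path to the neighbour ends;
     the loop that they form is filled by relators. *)
  have c : word_conv rels (wd g ++ [:: (i, true)]) (wd (g * x i)%g).
    by apply/word_evalP; rewrite word_eval_cat !wdE word_eval_cons /word_eval big_nil mulg1.
  have [r ri rE] := word_conv_fox c 1%g; exists r; split=> //.
  by rewrite rE fox_cat /= addr0 mul1g wdE opprB addrA addrAC addrC addrA.
have [r1 r1P] := choice H.
exists (s0 : {linear _ -> _}), (basis_ext r1 : {linear _ -> _}); split.
- by apply: integral_basis_ext => p; exact: integral_fox.
- by apply: integral_basis_ext => p; case: (r1P p).
- move=> y; rewrite -[LHS]/((d1 \o s0) y) linear_basisE.
  rewrite [X in _ = X - _]freeg_basisE /augmentation /basis_ext scaler_suml -sumrB.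
  apply: eq_bigr => -[g []] _ /=.
  by rewrite /s0 basis_extE d1_fox mul1g wdE [_ *: 1]mulr1 scalerBr.
- pose f : {linear {freeg (G * gens) / rat} -> {freeg (G * gens) / rat}} := s0 \o d1.
  apply: (@linear_eq_basis _ _ (d2 \o basis_ext r1) (idfun \- f)) => p /=.
  by rewrite basis_extE (r1P p).2.
Qed.

(** * Comparison of the presentation with a projective resolution of length 2 *)

Section Comparison.
Variables (A0 A1 A2 : gset G) (C0 : monomial A0) (C1 : monomial A1) (C2 : monomial A2).
Hypotheses (fin0 : finite_stabilizers A0) (fin1 : finite_stabilizers A1)
  (fin2 : finite_stabilizers A2).
Variables (D1 : {linear {freeg A1 / rat} -> {freeg A0 / rat}})
  (D2 : {linear {freeg A2 / rat} -> {freeg A1 / rat}}) (v0 : A0).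
Hypotheses (D1_equiv : @equivariant G C1 C0 D1) (D2_equiv : @equivariant G C2 C1 D2).
Let e0 : {linear {freeg A0 / rat} -> rat^o} := basis_ext (fun _ : A0 => 1 : rat^o).
Hypothesis e0_act : forall g y, e0 (gact C0 g y) = e0 y.
Hypotheses (e0_D1 : forall y, e0 (D1 y) = 0) (D1_D2 : forall y, D1 (D2 y) = 0).
Hypothesis exact0 : forall y, e0 y = 0 -> exists z, D1 z = y.
Hypothesis exact1 : forall y, D1 y = 0 -> exists z, D2 z = y.
Hypothesis D2_inj : forall y, D2 y = 0 -> y = 0.

Definition trivial_gmod :=
  @GModule G rat^o (fun _ => idfun) (fun=> erefl) (fun _ _ _ => erefl).

(** The comparison maps [f0, f1, f2] and [g0, g1, g2] between the two complexes cover the identity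
    of the rationals, and [h0, h1] begin a homotopy from their composite to the identity. In degree
    2 the homotopy stops: [g2 f2 + h1 d2] differs from the identity by a map into the kernel of
    [d2]. On this kernel [D2 f2 = f1 d2] vanishes, hence so does [f2] by injectivity of [D2]. *)
Lemma relation_module_projective :
  exists t : {linear {freeg (G * rel_index) / rat} -> {freeg (G * rel_index) / rat}},
  [/\ @equivariant G F2 F2 t, forall y, d2 (t y) = d2 y &
      forall y, d2 y = 0 -> t y = 0].
Proof.
have [s0 [r1 [_ _ s0E r1E]]] := presentation_contraction.
have fF0 := @free_finite_stabilizers G unit.
have fF1 := @free_finite_stabilizers G gens.
have fF2 := @free_finite_stabilizers G rel_index.
have [f0 [f0_eq f0E]] : exists f0 : {linear {freeg (G * unit) / rat} -> {freeg A0 / rat}},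
    @equivariant G F0 C0 f0 /\ forall y, e0 (f0 y) = eps y.
  apply: (@monomial_projective _ _ fF0 F0 C0 trivial_gmod e0 eps).
  - by move=> g y; exact: e0_act.
  - by move=> g y; exact: eps_act.
  - by move=> a; exists << v0 >>; rewrite /e0 /= epsE basis_extE.
have [g0 [g0_eq g0E]] : exists g0 : {linear {freeg A0 / rat} -> {freeg (G * unit) / rat}},
    @equivariant G C0 F0 g0 /\ forall y, eps (g0 y) = e0 y.
  apply: (@monomial_projective _ _ fin0 C0 F0 trivial_gmod eps e0).
  - by move=> g y; exact: eps_act.
  - by move=> g y; exact: e0_act.
  - by move=> a; exists << (1%g, tt) >>; rewrite /e0 /= epsE basis_extE.
have [f1 [f1_eq f1E]] : exists f1 : {linear {freeg (G * gens) / rat} -> {freeg A1 / rat}},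
    @equivariant G F1 C1 f1 /\ forall y, D1 (f1 y) = f0 (d1 y).
  apply: (@monomial_projective _ _ fF1 F1 C1 C0 D1 (f0 \o d1)) => //.
  - by move=> g y; rewrite /= d1_equiv f0_eq.
  - by move=> a; apply: exact0; rewrite /= f0E eps_d1.
have [g1 [g1_eq g1E]] : exists g1 : {linear {freeg A1 / rat} -> {freeg (G * gens) / rat}},
    @equivariant G C1 F1 g1 /\ forall y, d1 (g1 y) = g0 (D1 y).
  apply: (@monomial_projective _ _ fin1 C1 F1 F0 d1 (g0 \o D1)) => //.
  - exact: d1_equiv.
  - by move=> g y; rewrite /= D1_equiv g0_eq.
  - by move=> a; exists (s0 (g0 (D1 << a >>))); rewrite /= s0E g0E e0_D1 scale0r subr0.
have [f2 [f2_eq f2E]] : exists f2 : {linear {freeg (G * rel_index) / rat} -> {freeg A2 / rat}},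
    @equivariant G F2 C2 f2 /\ forall y, D2 (f2 y) = f1 (d2 y).
  apply: (@monomial_projective _ _ fF2 F2 C2 C1 D2 (f1 \o d2)) => //.
  - by move=> g y; rewrite /= d2_equiv f1_eq.
  - by move=> a; apply: exact1; rewrite /= f1E d1_d2 linear0.
have [g2 [g2_eq g2E]] : exists g2 : {linear {freeg A2 / rat} -> {freeg (G * rel_index) / rat}},
    @equivariant G C2 F2 g2 /\ forall y, d2 (g2 y) = g1 (D2 y).
  apply: (@monomial_projective _ _ fin2 C2 F2 F1 d2 (g1 \o D2)) => //.
  - exact: d2_equiv.
  - by move=> g y; rewrite /= D2_equiv g1_eq.
  - move=> a; exists (r1 (g1 (D2 << a >>))).
    by rewrite /= r1E g1E D1_D2 !linear0 ?subr0 ?addr0.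
pose p0 : {linear {freeg (G * unit) / rat} -> {freeg (G * unit) / rat}} :=
  idfun \- (g0 \o f0).
have [h0 [h0_eq h0E]] : exists h0 : {linear {freeg (G * unit) / rat} -> {freeg (G * gens) / rat}},
    @equivariant G F0 F1 h0 /\ forall y, d1 (h0 y) = p0 y.
  apply: (@monomial_projective _ _ fF0 F0 F1 F0 d1 p0) => //.
  - exact: d1_equiv.
  - by move=> g y; rewrite /= linearB f0_eq g0_eq.
  - move=> a; exists (s0 (p0 << a >>)).
    by rewrite /= s0E [eps _]linearB /= g0E f0E subrr scale0r subr0.
pose p1 : {linear {freeg (G * gens) / rat} -> {freeg (G * gens) / rat}} :=
  idfun \- (g1 \o f1) \- (h0 \o d1).
have [h1 [h1_eq h1E]] : exists h1 : {linear {freeg (G * gens) / rat} -> {freeg (G * rel_index) / rat}},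
    @equivariant G F1 F2 h1 /\ forall y, d2 (h1 y) = p1 y.
  apply: (@monomial_projective _ _ fF1 F1 F2 F1 d2 p1) => //.
  - exact: d2_equiv.
  - by move=> g y; rewrite /= !linearB /= f1_eq g1_eq d1_equiv h0_eq.
  - move=> a; exists (r1 (p1 << a >>)); rewrite [LHS]r1E.
    have -> : d1 (p1 << a >>) = 0.
      by rewrite /p1 /= !linearB /= g1E f1E h0E /p0 /= subrr.
    by rewrite linear0 subr0.
exists ((g2 \o f2) \+ (h1 \o d2)); split.
- by move=> g y; rewrite /= f2_eq g2_eq d2_equiv h1_eq linearD.
- move=> y; rewrite [d2 _]linearD /= g2E f2E h1E /p1 /= d1_d2 linear0 ?subr0 ?addr0.
  by rewrite addrC subrK.
- move=> y y0 /=; have -> : f2 y = 0 by apply: D2_inj; rewrite f2E y0 linear0.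
  by rewrite y0 !linear0 addr0.
Qed.

(* Clear the denominators of the endomorphism [t] of [relation_module_projective] by [m] and
   average over [S]: this gives an [S]-invariant integral element [y0] of the group ring of
   augmentation [m], and [S] acts freely on the basis. *)
Theorem finite_subgroups_bounded : exists m : nat, forall S : seq G, uniq S ->
  1%g \in S -> {in S &, forall a b, (a * b)%g \in S} ->
  {in S, forall a, a^-1%g \in S} -> (size S <= m)%N.
Proof.
have [t [t_eq tE t0]] := relation_module_projective.
have [s0 [r1 [s0i r1i s0E r1E]]] := presentation_contraction.
have [m m0 mt] : exists2 m, (0 < m)%N & forall y, integral_chain y -> integral_chain (m%:R *: t y).
  have [m_ m_P] := choice (fun j : rel_index =>
    let: ex_intro2 m m0 mi := common_denominator (t << (1%g, j) >>) in
    ex_intro (fun m => (0 < m)%N /\ integral_chain (m%:R *: t << (1%g, j) >>)) m (conj m0 mi)).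
  (* The product over the finitely many relators clears the denominators of [t] on the generators of
     the module, and by equivariance on all of it. *)
  exists (\prod_j m_ j)%N; first by apply: prodn_gt0 => j; case: (m_P j).
  move=> y yi; rewrite (linear_basisE t) scaler_sumr; apply: integral_chain_sum => -[g j] _.
  rewrite scalerA mulrC -scalerA; apply: integral_chainZ => //.
  have -> : t << (g, j) >> = gact F2 g (t << (1%g, j) >>).
    by rewrite -t_eq gact_free /free_act /= mulg1.
  rewrite -linearZ; apply: integral_gact.
  rewrite (bigD1 j)//= mulnC natrM -scalerA; apply: integral_chainZ; rewrite ?natr_int//.
  by case: (m_P j).
exists m => S uS S1 SM SV.
pose T : {linear {freeg (G * rel_index) / rat} -> {freeg (G * rel_index) / rat}} :=
  m%:R \*: t.
pose TR : {linear {freeg (G * gens) / rat} -> {freeg (G * rel_index) / rat}} := T \o r1.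
have d2TR k : d1 k = 0 -> d2 (TR k) = m%:R *: k.
  by move=> k0; rewrite [LHS]linearZ /= tE r1E k0 linear0 ?subr0 ?addr0.
(* On cycles [r1] is a section of [d2], equivariant up to the kernel of [d2]; this ambiguity is
   killed by [t]. *)
have TR_act s k : d1 k = 0 -> TR (gact F1 s k) = gact F2 s (TR k).
  move=> k0; apply/eqP; rewrite -subr_eq0 /TR /T /= [gact F2 s (_ *: _)]linearZ /= -scalerBr.
  rewrite -t_eq -linearB t0 ?scaler0//.
  by rewrite linearB /= d2_equiv !r1E d1_equiv k0 !linear0 ?subr0 ?addr0 ?subrr.
(* [TR] commutes with the group on cycles only, but it will be applied to [s0 y], which need not be
   a cycle. *)
pose u : {linear {freeg (G * gens) / rat} -> {freeg (G * rel_index) / rat}} := average S TR.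
have uE k : d1 k = 0 -> u k = TR k.
  by move=> k0; apply: average_id => // s _; exact: TR_act.
(* The failure of [s0] to commute with [s] on the kernel of the augmentation is a cycle [k], and
   [d2 u] multiplies cycles by [m]. Subtracting [d2 u s0] from [m s0] thus removes the failure and
   leaves [d1 w] equal to multiplication by [m] there. *)
pose w : {linear {freeg (G * unit) / rat} -> {freeg (G * gens) / rat}} :=
  (m%:R \*: s0) \- (d2 \o (u \o s0)).
have wE y : eps y = 0 -> d1 (w y) = m%:R *: y.
  by move=> y0; rewrite linearB /= linearZ /= d1_d2 subr0 s0E y0 scale0r subr0.
have w_act s y : s \in S -> eps y = 0 -> w (gact F0 s y) = gact F1 s (w y).
  move=> sS y0; set k := s0 (gact F0 s y) - gact F1 s (s0 y).
  have k0 : d1 k = 0.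
    by rewrite linearB /= d1_equiv !s0E eps_act y0 !scale0r !subr0 subrr.
  have kE : d2 (u k) = m%:R *: k by rewrite uE// d2TR.
  have wl : d2 (u k) = d2 (u (s0 (gact F0 s y))) - gact F1 s (d2 (u (s0 y))).
    by rewrite /k !linearB /= -[in RHS]d2_equiv -average_equivariant.
  rewrite /w /= linearB /= [gact F1 s (_ *: _)]linearZ /=.
  apply/eqP; rewrite subr_eq -addrA [- _ + _]addrC -wl kE /k scalerBr.
  by rewrite addrC subrK.
pose q := basis_ext (fun _ : G * unit => << (1%g, tt) >> : {freeg (G * unit) / rat}).
pose f : {linear {freeg (G * unit) / rat} -> {freeg (G * gens) / rat}} :=
  w \o (idfun \- basis_ext (fun=> << (1%g, tt) >>)).
have qE y : q y = eps y *: << (1%g, tt) >>.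
  rewrite /q /augmentation /basis_ext scaler_suml.
  by apply: eq_bigr => p _; rewrite [_ *: 1]mulr1.
have fE y : eps y = 0 -> f y = w y.
  by move=> y0; rewrite /f /= -[basis_ext _ y]/(q y) qE y0 scale0r subr0.
pose w' := average S f.
have w'E y : eps y = 0 -> w' y = w y.
  move=> y0; rewrite -fE//; apply: average_id => // s sS.
  by rewrite !fE ?eps_act//; exact: w_act.
have w'_act s y : s \in S -> w' (gact F0 s y) = gact F1 s (w' y).
  by move=> sS; exact: average_equivariant.
(* The map that sends [y] to [m y - d1 (w' y)] commutes with [S] and vanishes on the kernel of the
   augmentation. The translates of the basis vector at 1 differ by elements of this kernel, so the
   value of the map at that vector is invariant. *)
pose y0 := m%:R *: << (1%g, tt) >> - d1 (w' << (1%g, tt) >>).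
have y0_act s : s \in S -> gact F0 s y0 = y0.
  move=> sS; pose b : {freeg (G * unit) / rat} := gact F0 s << (1%g, tt) >> - << (1%g, tt) >>.
  have b0 : eps b = 0 by rewrite linearB /= eps_act subrr.
  have wb : w' b = gact F1 s (w' << (1%g, tt) >>) - w' << (1%g, tt) >>.
    by rewrite -w'_act//; exact: linearB.
  have : d1 (w' b) = m%:R *: b by rewrite w'E// wE.
  rewrite wb linearB /= d1_equiv scalerBr => e.
  apply/eqP; rewrite /y0 (gactB (M := F0)) (gactZ (M := F0)).
  by rewrite subr_eq -addrA [- _ + _]addrC e addrC subrK.
have eps_y0 : eps y0 = m%:R.
  by rewrite linearB /= eps_d1 subr0 linearZ /= epsE [_ *: _]mulr1.
have y0i : integral_chain y0.
  have ui : integral_map u.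
    apply: integral_average => y yi; rewrite /TR /T /=; apply: mt; exact: r1i.
  have d1i : integral_map d1.
    apply: integral_basis_ext => p; apply: integral_chainD; first exact: integral_basis.
    by apply: integral_chainN; exact: integral_basis.
  have d2i : integral_map d2 by apply: integral_basis_ext => p; exact: integral_fox.
  have wi : integral_map w.
    move=> y yi; rewrite /w /=; apply: integral_chainD.
      by apply: integral_chainZ; rewrite ?natr_int//; exact: s0i.
    by apply/integral_chainN/d2i/ui/s0i.
  have fi : integral_map f.
    move=> y yi; rewrite /f /=; apply/wi/integral_chainD => //; apply: integral_chainN.
    by apply: (@integral_basis_ext _ _ (fun=> << (1%g, tt) >>)) => // p; exact: integral_basis.
  apply: integral_chainD.
    by apply: integral_chainZ; rewrite ?natr_int//; exact: integral_basis.
  by apply/integral_chainN/d1i/integral_average => //; exact: integral_basis.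
(* As [y0] is invariant, it is the sum of the translates of [z] by [S]; hence its augmentation [m]
   is the size of [S] times the integer [eps z]. *)
pose z := transversal_proj S y0.
have zi : eps z \is a Num.int.
  rewrite /augmentation /basis_ext; apply: rpred_sum => p _; rewrite [_ *: _]mulr1.
  exact: integral_transversal_proj.
have mE : m%:R = (size S)%:R * eps z.
  rewrite -eps_y0 -[in LHS](sum_transversal_proj uS S1 SM SV y0) linear_sum /= big_seq.
  transitivity (\sum_(s <- S | s \in S) eps z).
    by apply: eq_bigr => s sS; rewrite eps_act y0_act// SV.
  by rewrite -big_seq big_const_seq count_predT iter_addr_0 mulr_natl.
have S0 : (0 < size S)%N by rewrite lt0n size_eq0; apply: contraTneq S1 => ->.
have z1 : 1 <= eps z.
  have : 0 < eps z by rewrite -(@pmulr_rgt0 _ (size S)%:R) ?ltr0n// -mE ltr0n.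
  by case/intrP: zi => k ->; rewrite ltr0z ler1z gtz0_ge1.
by rewrite -(@ler_nat rat) mE -[X in X <= _]mulr1 ler_wpM2l.
Qed.
End Comparison.
End Presentation.

(** * Circle-valued functions *)

Section WithinContinuity.

Lemma closed_bigcup_type (T : topologicalType) (I : Type) (A : set I) (F : I -> set T) :
  finite_set A -> (forall i, A i -> closed (F i)) -> closed (\bigcup_(i in A) F i).
Proof. exact: (@closed_bigcup T {classic I}). Qed.

Lemma within_preimage_compact (U V : topologicalType) (K : set U) (f : U -> V) (B : set V) :
  compact K -> {within K, continuous f} -> closed B -> compact (K `&` f @^-1` B).
Proof.
move=> cK /continuous_closedP cf /cf /closed_subspaceP [C cC CE].
by rewrite setIC -CE setIC; exact: compact_closedI.
Qed.

(** The preimage of a closed set is the union of the images of finitely many compact sets, and these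
    images are closed because the space is Hausdorff. *)
Lemma continuous_glue (T V : topologicalType) (I : Type) (F : set I) (U : I -> topologicalType)
  (K : forall i, set (U i)) (chi : forall i, U i -> T) (g : T -> V) :
  hausdorff_space T -> finite_set F -> (forall i, F i -> compact (K i)) ->
  (forall i, F i -> {within K i, continuous (chi i)}) ->
  (forall i, F i -> {within K i, continuous (g \o chi i)}) ->
  {within \bigcup_(i in F) (chi i @` K i), continuous g}.
Proof.
move=> hT fF cK cchi cg; apply/continuous_closedP => B cB; apply/closed_subspaceP.
exists (\bigcup_(i in F) (chi i @` (K i `&` (g \o chi i) @^-1` B))).
  apply: closed_bigcup_type => // i Fi; apply: compact_closed => //.
  apply: continuous_compact; last by apply: within_preimage_compact => //; [exact: cK|exact: cg].
  by apply: continuous_subspaceW (cchi i Fi) => x [].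
apply/seteqP; split => x /=.
  by move=> [[i Fi [u [Ku Bu] <-]] h]; split.
move=> [Bx [i Fi [u Ku ux]]]; split; last by exists i => //; exists u.
by exists i => //; exists u => //; split=> //=; rewrite ux.
Qed.

Lemma within_id (U : topologicalType) (K : set U) : {within K, continuous id}.
Proof. by apply: continuous_subspaceT => x; exact: cvg_id. Qed.

Lemma within_global (U V W : topologicalType) (K : set U) (f : U -> V) (g : V -> W) :
  {within K, continuous f} -> continuous g -> {within K, continuous (g \o f)}.
Proof. by move=> cf cg x; apply: (continuous_comp (cf x)); exact: cg. Qed.

Lemma within_congr (U V : topologicalType) (K : set U) (f g : U -> V) :
  (forall x, K x -> f x = g x) -> {within K, continuous f} -> {within K, continuous g}.
Proof.
by move=> fg; apply: subspace_eq_continuous => x /set_mem Kx; exact: fg.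
Qed.

Variable R : realType.
Variables (U : topologicalType) (K : set U).
Implicit Types f g : U -> R.

Lemma within_cst (c : R) : {within K, continuous (fun _ : U => c)}.
Proof. by move=> x; exact: cvg_cst. Qed.
Lemma withinD f g : {within K, continuous f} -> {within K, continuous g} ->
  {within K, continuous (fun x => f x + g x)}.
Proof. by move=> cf cg x; exact: cvgD (cf x) (cg x). Qed.
Lemma withinN f : {within K, continuous f} -> {within K, continuous (fun x => - f x)}.
Proof. by move=> cf x; exact: cvgN (cf x). Qed.
Lemma withinB f g : {within K, continuous f} -> {within K, continuous g} ->
  {within K, continuous (fun x => f x - g x)}.
Proof. by move=> cf cg x; exact: cvgB (cf x) (cg x). Qed.
Lemma withinM f g : {within K, continuous f} -> {within K, continuous g} ->
  {within K, continuous (fun x => f x * g x)}.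
Proof. by move=> cf cg x; exact: cvgM (cf x) (cg x). Qed.
Lemma withinV f : (forall x, K x -> f x != 0) -> {within K, continuous f} ->
  {within K, continuous (fun x => (f x)^-1)}.
Proof.
move=> f0 /subspace_continuousP cf; apply/subspace_continuousP => x Kx.
by apply: cvgV; [exact: f0|exact: cf].
Qed.

End WithinContinuity.

Section Angles.
Variable R : realType.

Definition cs (x : R) := cos (pi *+ 2 * x).
Definition sn (x : R) := sin (pi *+ 2 * x).

Lemma csD (x y : R) : cs (x + y) = cs x * cs y - sn x * sn y.
Proof. by rewrite /cs mulrDr cosD. Qed.
Lemma snD (x y : R) : sn (x + y) = sn x * cs y + cs x * sn y.
Proof. by rewrite /sn mulrDr sinD. Qed.
Lemma csN (x : R) : cs (- x) = cs x.
Proof. by rewrite /cs mulrN cosN. Qed.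
Lemma snN (x : R) : sn (- x) = - sn x.
Proof. by rewrite /sn mulrN sinN. Qed.
Lemma csB (x y : R) : cs (x - y) = cs x * cs y + sn x * sn y.
Proof. by rewrite csD csN snN mulrN opprK. Qed.
Lemma snB (x y : R) : sn (x - y) = sn x * cs y - cs x * sn y.
Proof. by rewrite snD csN snN mulrN. Qed.
Lemma cs0 : cs 0 = 1 :> R. Proof. by rewrite /cs mulr0 cos0. Qed.
Lemma sn0 : sn 0 = 0 :> R. Proof. by rewrite /sn mulr0 sin0. Qed.
Lemma cs2Dsn2 (x : R) : cs x ^+ 2 + sn x ^+ 2 = 1.
Proof. exact: cos2Dsin2. Qed.

Lemma cs_int (x : R) : x \is a Num.int -> cs x = 1 /\ sn x = 0.
Proof.
have csn (n : nat) : cs n%:R = 1 /\ sn n%:R = 0.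
  elim: n => [|n [c s]]; first by rewrite cs0 sn0.
  rewrite -natr1 csD snD c s /cs /sn mulr1 cos2pi sin2pi.
  by rewrite !mul0r !mulr0 mulr1 subr0 addr0.
case/intrP => -[n|n] ->; first exact: csn.
by rewrite NegzE mulrNz csN snN; have [-> ->] := csn n.+1; rewrite oppr0.
Qed.

Lemma cs_eq1 (x : R) : cs x = 1 -> x \is a Num.int.
Proof.
move=> cx; pose d := x - (Num.floor x)%:~R.
have d0 : 0 <= d by rewrite subr_ge0 floor_le_tmp.
have d1 : d < 1 by have := floorD1_gt x; rewrite /d intrD; lra.
have [cf sf] : cs (Num.floor x)%:~R = 1 :> R /\ sn (Num.floor x)%:~R = 0 :> R.
  by apply: cs_int; rewrite intr_int.
have cd : cs d = 1 by rewrite csB cf sf mulr1 mulr0 addr0.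
have [d0'|d0'] := eqVneq d 0.
  by move/eqP: d0'; rewrite subr_eq0 => /eqP ->; rewrite intr_int.
have : 0 < sin (pi * d).
  have p0 := pi_gt0 R; apply: sin_gt0_pi; apply/andP; split; first by rewrite mulr_gt0// lt_def d0' d0.
  by rewrite -[X in _ < X]mulr1 ltr_pM2l.
move: cd; rewrite /cs mulrnAl cos_mulr2n cos2sin2.
by move=> e; suff : sin (pi * d) ^+ 2 = 0; [move/eqP; rewrite sqrf_eq0 => /eqP ->; rewrite ltxx | lra].
Qed.

Lemma cs_sn_int (x y : R) : cs x = cs y -> sn x = sn y -> x - y \is a Num.int.
Proof.
by move=> c s; apply: cs_eq1; rewrite csB c s -(cs2Dsn2 y) !expr2.
Qed.

Lemma cs_sn_congr (x y : R) : x - y \is a Num.int -> cs x = cs y /\ sn x = sn y.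
Proof.
move=> /cs_int; move: (x - y) (subrK y x) => d <- [c s]; rewrite csD snD c s.
by rewrite !mul1r !mul0r subr0 add0r.
Qed.

(** On the right half of the circle the arctangent is a continuous branch of the angle, here
    measured in full turns. *)
Lemma cs_sn_atan (x : R) : 0 < cs x -> x - atan (sn x / cs x) / (pi *+ 2) \is a Num.int.
Proof.
move=> c0; set a := atan _; have p0 : (pi *+ 2 : R) != 0 by rewrite mulrn_eq0 /= gt_eqF ?pi_gt0.
have ca : cos a = cs x.
  rewrite /a cos_atan; have -> : 1 + (sn x / cs x) ^+ 2 = (cs x)^-1 ^+ 2.
    have c20 : cs x ^+ 2 != 0 by rewrite sqrf_eq0 gt_eqF.
    by rewrite expr_div_n exprVn -[X in X + _](divff c20) -mulrDl cs2Dsn2 mul1r.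
  by rewrite sqrtr_sqr ger0_norm ?invrK// invr_ge0 ltW.
have sa : sin a = sn x.
  have ta : tan a = sn x / cs x by case: (atan_def (sn x / cs x)).
  by move: ta; rewrite /tan ca => /(congr1 (fun z => z * cs x)); rewrite !mulfVK ?gt_eqF.
have e : pi *+ 2 * (a / (pi *+ 2)) = a by rewrite mulrC divfK.
by apply: cs_sn_int; rewrite -?ca -?sa /cs /sn e.
Qed.

Lemma continuous_cs : continuous (cs : R -> R).
Proof. by move=> x; apply: continuous_comp; [exact: mulrl_continuous|exact: continuous_cos]. Qed.
Lemma continuous_sn : continuous (sn : R -> R).
Proof. by move=> x; apply: continuous_comp; [exact: mulrl_continuous|exact: continuous_sin]. Qed.


(* A map to the circle [R / Z] is represented by a real function, continuous only modulo [Z]. *)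
Definition circ_continuous (U : topologicalType) (K : set U) (alpha : U -> R) :=
  {within K, continuous (cs \o alpha)} /\ {within K, continuous (sn \o alpha)}.

Definition is_lift (U : topologicalType) (K : set U) (alpha lam : U -> R) :=
  {within K, continuous lam} /\ forall x, K x -> alpha x - lam x \is a Num.int.

Section Circ.
Variables (U : topologicalType) (K : set U).

Lemma circ_continuous_lift alpha lam : is_lift K alpha lam -> circ_continuous K alpha.
Proof.
move=> [cl al]; split.
- apply: (@within_congr _ _ _ (cs \o lam)); last exact: (@within_global U R R K lam cs cl continuous_cs).
  by move=> x /al /cs_sn_congr[].
- apply: (@within_congr _ _ _ (sn \o lam)); last exact: (@within_global U R R K lam sn cl continuous_sn).
  by move=> x /al /cs_sn_congr[].
Qed.

Lemma circ_continuousD alpha beta : circ_continuous K alpha -> circ_continuous K beta ->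
  circ_continuous K (fun x => alpha x + beta x).
Proof.
move=> [ca sa] [cb sb]; split.
- apply: (@within_congr _ _ _ (fun x => cs (alpha x) * cs (beta x) - sn (alpha x) * sn (beta x))).
    by move=> x _ /=; rewrite csD.
  by apply: withinB; exact: withinM.
- apply: (@within_congr _ _ _ (fun x => sn (alpha x) * cs (beta x) + cs (alpha x) * sn (beta x))).
    by move=> x _ /=; rewrite snD.
  by apply: withinD; exact: withinM.
Qed.

Lemma circ_continuousN alpha : circ_continuous K alpha -> circ_continuous K (fun x => - alpha x).
Proof.
move=> [ca sa]; split.
- by apply: within_congr ca => x _ /=; rewrite csN.
- by apply: within_congr (withinN sa) => x _ /=; rewrite snN.
Qed.

Lemma circ_continuous_congr alpha beta : (forall x, K x -> alpha x - beta x \is a Num.int) ->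
  circ_continuous K alpha -> circ_continuous K beta.
Proof.
by move=> ab [ca sa]; split; [apply: within_congr ca|apply: within_congr sa];
  move=> x /ab /cs_sn_congr[].
Qed.

(** The difference of the two functions stays in the right half of the circle, where the arctangent
    lifts it; this lift is added to that of [alpha]. *)
Lemma lift_step alpha beta : circ_continuous K alpha -> circ_continuous K beta ->
  (forall x, K x -> 0 < cs (beta x - alpha x)) ->
  (exists lam, is_lift K alpha lam) -> exists lam, is_lift K beta lam.
Proof.
move=> ca cb c0 [lam [clam lamE]].
exists (fun x => lam x + atan (sn (beta x - alpha x) / cs (beta x - alpha x)) / (pi *+ 2)).
have [cd sd] := circ_continuousD cb (circ_continuousN ca).
split.
- apply: withinD => //; apply: withinM; last exact: within_cst.
  apply: (@within_global U R R K _ (@atan R)); last by move=> x; exact: continuous_atan.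
  by apply: withinM => //; apply: withinV => // x Kx; rewrite gt_eqF// c0.
- move=> x Kx; have := rpredD (lamE x Kx) (cs_sn_atan (c0 x Kx)).
  by set a := atan _ / _; have -> : alpha x - lam x + (beta x - alpha x - a) =
    beta x - (lam x + a) by ring.
Qed.

End Circ.

Lemma circ_continuous_comp (U V : topologicalType) (A : set U) (B : set V) (f : U -> V) alpha :
  {within A, continuous f} -> (forall x, A x -> B (f x)) ->
  circ_continuous B alpha -> circ_continuous A (alpha \o f).
Proof.
by move=> cf fAB [c s]; split; [exact: within_comp cf c fAB|exact: within_comp cf s fAB].
Qed.

(** The indicator of [P] is continuous on the segment and would take the value 1/2. *)
Lemma locally_constant_segment (P : R -> Prop) :
  (forall t : R, 0 <= t <= 1 -> \forall s \near within `[0, 1] (nbhs t), P s <-> P t) -> P 1 -> P 0.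
Proof.
move=> PP P1; apply: contrapT => P0; pose f t : R := (`[< P t >])%:R.
have cf : {within `[0, 1], continuous f}.
  apply/subspace_continuousP => t t01; apply: cvg_near_cst.
  move: (PP t t01); apply: filterS => s Pst; rewrite /f.
  by congr ((nat_of_bool _)%:R); apply/asboolP/asboolP; apply Pst.
have [||c _ fc] := @IVT R f 0 1 2^-1 _ cf; first by [].
  rewrite /f (asboolF P0) (asboolT P1) /=; rewrite ge_min le_max.
  by rewrite invr_ge0 ler0n invf_le1// ler1n orbT.
move: fc; rewrite /f; case: asboolP => _ /=; lra.
Qed.

(** The common frame of the liftings to the line and through the Hopf fibration. Positivity of
    [D t (x, s)] says that the times [s] and [t] of the homotopy are close at [x]; compactness of
    [K] makes this uniform in [x] for [s] near [t], so [P] is locally constant in time. *)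
Lemma homotopy_transport (U : topologicalType) (K : set U) (P : R -> Prop)
  (D : R -> U * R -> R) : compact K ->
  (forall t, 0 <= t <= 1 -> {within K `*` `[0, 1], continuous (D t)}) ->
  (forall t x, 0 <= t <= 1 -> K x -> 0 < D t (x, t)) ->
  (forall s t, 0 <= s <= 1 -> 0 <= t <= 1 -> (forall x, K x -> 0 < D t (x, s)) -> P s <-> P t) ->
  P 1 -> P 0.
Proof.
move=> cK cD D0 DP; apply: locally_constant_segment => t t01.
have /near_covering_withinP nK := (compact_near_coveringP K).1 cK.
have H : \forall s \near within `[0, 1] (nbhs t), forall x, K x -> 0 <= s <= 1 -> 0 < D t (x, s).
  apply: (nK R (within `[0, 1] (nbhs t)) (fun s x => 0 <= s <= 1 -> 0 < D t (x, s))) => x Kx.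
  have /subspace_continuousP cDt := cD t t01.
  have := cDt (x, t) (conj Kx t01).
  move=> /(_ _ (lt_nbhsr (D0 t x t01 Kx))) -[[A B] /= [nA nB] AB].
  exists (A, B `&` `[0, 1]%classic) => /=.
    by split=> //; rewrite /within /=; move: nB; apply: filterS => s Bs s01.
  move=> [y s] /= [Ay [Bs s01]] Ky _; have := AB (y, s) (conj Ay Bs).
  by rewrite /= => /(_ (conj Ky s01)).
have near01 : \forall s \near within `[0, 1] (nbhs t), 0 <= s <= 1.
  by rewrite near_withinE; apply: nearW => s.
near=> s; apply: DP => //; first by near: s.
move=> x Kx; have s01 : 0 <= s <= 1 by near: s.
by move: Kx s01; move: x; near: s.
Unshelve. all: by end_near.
Qed.
End Angles.

Section Lifting.
Variable R : realType.

Lemma within_slice (U V : topologicalType) (K : set U) (h : U * R -> V) (t : R) :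
  0 <= t <= 1 -> {within K `*` `[(0 : R), 1]%classic, continuous h} ->
  {within K, continuous (fun x => h (x, t))}.
Proof.
move=> t01 ch; pose f (x : U) := (x, t).
apply: (@within_comp U (U * R)%type V K (K `*` `[(0 : R), 1]%classic) f h) => //.
apply: continuous_subspaceT => x; exact: (cvg_pair (@cvg_id _ (nbhs x)) (@cvg_cst _ t _ (nbhs x) _)).
Qed.

Lemma within_slice2 (U V : topologicalType) (K : set U) (h : U * R -> V) (t : R) :
  0 <= t <= 1 -> {within K `*` `[(0 : R), 1]%classic, continuous h} ->
  {within K `*` `[(0 : R), 1]%classic, continuous (fun p : U * R => h (p.1, t))}.
Proof.
move=> t01 ch; pose f (p : U * R) := (p.1, t).
apply: (@within_comp (U * R)%type (U * R)%type V _ (K `*` `[(0 : R), 1]%classic) f h) => //.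
  by apply: continuous_subspaceT => x; exact: (cvg_pair (@cvg_fst _ _ (nbhs x.1) (nbhs x.2) _) (@cvg_cst _ t _ (nbhs x) _)).
by move=> p [].
Qed.

Lemma homotopy_lift (U T : topologicalType) (K : set U) (Y : set T) (h : U * R -> T)
  (alpha : T -> R) : compact K -> {within K `*` `[(0 : R), 1]%classic, continuous h} ->
  (forall x t, K x -> 0 <= t <= 1 -> Y (h (x, t))) -> circ_continuous Y alpha ->
  (exists lam, is_lift K (fun x => alpha (h (x, 1))) lam) ->
  exists lam, is_lift K (fun x => alpha (h (x, 0))) lam.
Proof.
move=> cK ch hY ca.
have cKI : circ_continuous (K `*` `[(0 : R), 1]%classic) (alpha \o h).
  by apply: circ_continuous_comp ca => // -[x t] /= [Kx t01]; exact: hY.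
pose P t := exists lam, is_lift K (fun x => alpha (h (x, t))) lam.
have cP t : 0 <= t <= 1 -> circ_continuous K (fun x => alpha (h (x, t))).
  move=> t01; apply: (circ_continuous_comp (within_slice t01 ch)) ca => x Kx.
  exact: hY.
apply: (@homotopy_transport R U K P
  (fun t p => cs (alpha (h p) - alpha (h (p.1, t))))) => //.
- move=> t t01; have [cc ss] := cKI.
  apply: (@within_congr _ _ _ (fun p => cs (alpha (h p)) * cs (alpha (h (p.1, t))) +
     sn (alpha (h p)) * sn (alpha (h (p.1, t))))); first by move=> p _; rewrite csB.
  have c2 := within_slice2 t01 cc; have s2 := within_slice2 t01 ss.
  by apply: withinD; exact: withinM.
- by move=> t x t01 Kx /=; rewrite subrr cs0 ltr01.
- move=> s t s01 t01 st; split; apply: lift_step; try exact: cP.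
  + by move=> x Kx; rewrite -csN opprB; exact: st.
  + exact: st.
Qed.

Lemma contractible_lift (U : topologicalType) (K : set U) (h : U * R -> U) (x0 : U)
  (alpha : U -> R) :
  compact K -> {within K `*` `[(0 : R), 1]%classic, continuous h} ->
  (forall x t, K x -> 0 <= t <= 1 -> K (h (x, t))) ->
  (forall x, K x -> h (x, 0) = x) -> (forall x, K x -> h (x, 1) = x0) ->
  circ_continuous K alpha -> exists lam, is_lift K alpha lam.
Proof.
move=> cK ch hK h0 h1 ca; have [|lam [cl al]] := homotopy_lift cK ch hK ca.
  exists (fun=> alpha x0); split; first exact: within_cst.
  by move=> x Kx; rewrite h1// subrr rpred0.
by exists lam; split=> // x Kx; have := al x Kx; rewrite h0.
Qed.

Lemma star_lift (V : normedModType R) (K : set V) (v0 : V) (alpha : V -> R) :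
  compact K -> (forall x t, K x -> 0 <= t <= 1 -> K (x + t *: (v0 - x))) ->
  circ_continuous K alpha -> exists lam, is_lift K alpha lam.
Proof.
move=> cK starK; apply: (@contractible_lift _ K (fun p => p.1 + p.2 *: (v0 - p.1)) v0) => //=.
- apply: continuous_subspaceT => p; apply: cvgD; first exact: cvg_fst.
  by apply: cvgZ; [exact: cvg_snd|apply: cvgB; [exact: cvg_cst|exact: cvg_fst]].
- by move=> x _; rewrite scale0r addr0.
- by move=> x _; rewrite scale1r addrC subrK.
Qed.

Lemma segment_lift (a b : R) (alpha : R -> R) : a <= b ->
  circ_continuous `[a, b] alpha -> exists lam, is_lift `[a, b] alpha lam.
Proof.
move=> ab; apply: (@star_lift R^o _ a) => [|x t /=]; first exact: segment_compact.
rewrite !in_itv/= => /andP[ax xb] /andP[t0 t1]; rewrite -[_ *: _]/(_ * _).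
apply/andP; split; nra.
Qed.

Lemma integer_valued_constant (a b : R) (f : R -> R) : a <= b ->
  {within `[a, b], continuous f} -> (forall x, a <= x <= b -> f x \is a Num.int) ->
  f a = f b.
Proof.
move=> ab cf fi.
have ia : f a \is a Num.int by apply: fi; rewrite lexx.
have ib : f b \is a Num.int by apply: fi; rewrite lexx andbT.
apply: contrapT => /eqP fab.
have key (x y : R) : x \is a Num.int -> y \is a Num.int -> x < y -> x + 2^-1 <= y.
  move=> /intrP[k ->] /intrP[l ->]; rewrite ltr_int -lezD1 -(ler_int R) rmorphD /=; lra.
(* Distinct integers are at least 1 apart, so the half-integer above the smaller one would be a
   value of [f]. *)
have [c cab fc] : exists2 c, c \in `[a, b] & f c = Num.min (f a) (f b) + 2^-1.
  apply: IVT => //; rewrite lerDl invr_ge0 ler0n /=.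
  have [lab|lba|e] := ltgtP (f a) (f b); first exact: key.
    exact: key.
  by rewrite e eqxx in fab.
have im : Num.min (f a) (f b) \is a Num.int by rewrite minEle; case: ifP.
have : (2^-1 : R) \is a Num.int.
  by rewrite -[2^-1](addKr (Num.min (f a) (f b))) -fc rpredD ?rpredN// fi// -in_itv.
by move=> /intrP[k]; have := ltr0z R k; have := ltrz1 R k; move=> h1 h2 e; move: h1 h2; rewrite -e invf_lt1 ?ltr0n// ltr1n invr_gt0 ltr0n => /esym h1 /esym h2; move: h1 h2; case: k {e} => // -[].
Qed.

End Lifting.

Section Ball.
Variables (R : realType) (n : nat).

Lemma continuous_sum_sq (s : seq 'I_n) :
  continuous ((fun u => \sum_(i <- s) u 0 i ^+ 2) : 'rV[R]_n -> R).
Proof.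
elim: s => [|i s IH] u.
  rewrite (_ : (fun _ => _) = cst 0); first exact: cst_continuous.
  by apply/funext => v; rewrite big_nil.
rewrite (_ : (fun _ => _) =
    (fun v : 'rV[R]_n => v 0 i * v 0 i + \sum_(j <- s) v 0 j ^+ 2)).
  have ci : {for u, continuous ((fun v => v 0 i) : 'rV[R]_n -> R)} by exact: coord_continuous.
  exact: cvgD (cvgM ci ci) (IH u).
by apply/funext => v; rewrite big_cons.
Qed.

Lemma continuous_sqnorm :
  continuous ((fun u => \sum_i u 0 i ^+ 2) : 'rV[R]_n -> R).
Proof. exact: continuous_sum_sq. Qed.

Lemma cball_compact : compact (cball R n).
Proof.
have -> : cball R n = [set v : 'rV[R]_n | forall i, `[-1, 1]%classic (v ord0 i)] `&` cball R n.
  apply/seteqP; split => [v|v []//]; rewrite /cball /= => vB; split=> // i.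
  have : v ord0 i ^+ 2 <= 1.
    apply: le_trans vB; rewrite (bigD1 i)//= lerDl; apply: sumr_ge0 => j _; exact: sqr_ge0.
  by rewrite in_itv/= -ler_norml -[X in _ <= X](expr1n _ 2) -real_normK ?num_real// ler_sqr ?nnegrE//.
apply: compact_closedI; last first.
  have -> : cball R n = ((fun u => \sum_i u 0 i ^+ 2) : 'rV[R]_n -> R) @^-1` [set x | x <= 1] by [].
  by apply: closed_comp => [x _|]; [exact: continuous_sqnorm | exact: closed_le].
exact: (@rV_compact R n (fun=> `[-1, 1]%classic) (fun=> @segment_compact R _ _)).
Qed.

Lemma cball_star (u : 'rV[R]_n) (t : R) : cball R n u -> 0 <= t <= 1 -> cball R n (u + t *: (0 - u)).
Proof.
rewrite /cball /= => uB /andP[t0 t1]; apply: le_trans uB; apply: ler_sum => i _.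
rewrite !mxE sub0r; have -> : u 0 i + t * (- u 0 i) = (1 - t) * u 0 i by ring.
rewrite exprMn -[X in _ <= X]mul1r; apply: ler_wpM2r; first exact: sqr_ge0.
by rewrite expr2; nra.
Qed.

Lemma cball_lift (alpha : 'rV[R]_n -> R) : circ_continuous (cball R n) alpha ->
  exists lam, is_lift (cball R n) alpha lam.
Proof. exact: (@star_lift R 'rV[R]_n (cball R n) 0 alpha cball_compact cball_star). Qed.

End Ball.

Section Circle.
Variable R : realType.

Lemma cs_sn_surj (x y : R) : x ^+ 2 + y ^+ 2 = 1 ->
  exists2 t, 0 <= t <= 1 & cs t = x /\ sn t = y.
Proof.
move=> xy; have p0 := pi_gt0 R.
have x1 : -1 <= x <= 1.
  have y2 := sqr_ge0 y; have x2 : x ^+ 2 <= 1 by lra.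
  by apply/andP; split; nra.
have [/andP[a0 api] ca] := acos_def x1.
have s2 : sin (acos x) ^+ 2 = y ^+ 2.
  by rewrite sin2cos2 ca -xy addrC addKr.
have p2 : (pi *+ 2 : R) != 0 by rewrite mulrn_eq0 /= gt_eqF.
have e z : pi *+ 2 * (z / (pi *+ 2)) = z :> R by rewrite mulrC divfK.
have lt2 : 0 < (pi *+ 2 : R) by rewrite pmulrn_rgt0.
move/eqP: s2; rewrite eqf_sqr => /orP[] /eqP s2.
  exists (acos x / (pi *+ 2)); last by rewrite /cs /sn e ca s2.
  by rewrite divr_ge0 ?(ltW lt2)//= ler_pdivrMr// mul1r (le_trans api)// mulr2n lerDl ltW.
exists (1 - acos x / (pi *+ 2)); last first.
  by rewrite csB snB /cs /sn mulr1 e ca s2 cos2pi sin2pi !mul1r !mul0r addr0 sub0r opprK.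
by rewrite subr_ge0 lerBlDr lerDl divr_ge0 ?(ltW lt2)// andbT ler_pdivrMr// mul1r (le_trans api)// mulr2n lerDl ltW.
Qed.

Definition circ n (t : R) : 'rV[R]_n := \row_i (if (i : nat) == 0 then cs t else sn t).

Lemma cvg_rV (U : topologicalType) (F : set_system U) (FF : Filter F) n
  (f : U -> 'rV[R]_n) (v : 'rV[R]_n) :
  (forall i, (fun x => f x 0 i) @ F --> v 0 i) -> f @ F --> v.
Proof.
move=> cf A [P Pv PA].
have H : \forall x \near F, forall i, P 0 i (f x 0 i).
  by apply: filter_forall => i; exact: (cf i _ (Pv 0 i)).
apply: filterS H => x Px; apply: PA => i j; rewrite (ord1 i); exact: Px.
Qed.

Lemma within_rV (U : topologicalType) (K : set U) n (f : U -> 'rV[R]_n) :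
  (forall i, {within K, continuous (fun x => f x 0 i)}) -> {within K, continuous f}.
Proof. by move=> cf x; apply: cvg_rV => i; exact: cf. Qed.

Lemma circ_cont n (K : set R) : {within K, continuous (@circ n)}.
Proof.
apply: within_rV => i; apply: continuous_subspaceT => x.
rewrite /circ; under eq_fun do rewrite mxE.
by case: ifP => _; [exact: continuous_cs|exact: continuous_sn].
Qed.

Lemma sum_ord2 n (F : nat -> R) : n = 2%N -> \sum_(i < n) F i = F 0 + F 1.
Proof. by move=> ->; rewrite big_ord_recl big_ord1. Qed.

Lemma circ_sphere n t : n = 2%N -> sphere R n (circ n t).
Proof.
move=> n2; rewrite /sphere /=; under eq_bigr do rewrite mxE.
rewrite (@sum_ord2 n (fun i => (if i == 0 then cs t else sn t) ^+ 2))//=.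
exact: cs2Dsn2.
Qed.

Lemma circ_surj n (u : 'rV[R]_n) : n = 2%N -> sphere R n u ->
  exists2 t, 0 <= t <= 1 & circ n t = u.
Proof.
move=> n2; rewrite /sphere /=; move: u; rewrite n2 => u.
rewrite big_ord_recl big_ord1 => /cs_sn_surj[t t01 [ct st]]; exists t => //.
apply/rowP => i; rewrite mxE; case: ifPn => [/eqP i0|i0].
  by rewrite ct; congr (u _ _); apply/val_inj.
by rewrite st; congr (u _ _); apply/val_inj => /=; case: i i0 => -[|[|]].
Qed.

Lemma circ_eq n s t : n = 2%N -> circ n s = circ n t -> s - t \is a Num.int.
Proof.
move=> ->{n} e; apply: cs_sn_int.
  by move/rowP: e => /(_ 0); rewrite !mxE.
by move/rowP: e => /(_ 1); rewrite !mxE.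
Qed.

Lemma circ_periodic n s t : s - t \is a Num.int -> circ n s = circ n t.
Proof. by move=> /cs_sn_congr[c s']; apply/rowP => i; rewrite !mxE c s'. Qed.

(* Equal to [0] when [alpha] has no continuous lift. *)
Definition winding (alpha : R -> R) : R :=
  let lam := xget (fun=> 0) (is_lift `[(0 : R), 1]%classic alpha) in lam 1 - lam 0.

Lemma windingE alpha lam : is_lift `[(0 : R), 1]%classic alpha lam ->
  winding alpha = lam 1 - lam 0.
Proof.
move=> L; rewrite /winding; case: xgetP => [mu _ L'|/(_ lam)//].
have [cl la] := L; have [cm ma] := L'.
have := @integer_valued_constant R 0 1 (fun x => mu x - lam x) ler01 (withinB cm cl).
move=> H; have {}H : mu 0 - lam 0 = mu 1 - lam 1; last by lra.
apply: H => x x01; have := rpredB (la x x01) (ma x x01).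
by have -> : alpha x - lam x - (alpha x - mu x) = mu x - lam x by ring.
Qed.

Lemma winding_int alpha : circ_continuous `[(0 : R), 1]%classic alpha ->
  alpha 1 - alpha 0 \is a Num.int -> winding alpha \is a Num.int.
Proof.
move=> /(segment_lift ler01)[lam L] a10; rewrite (windingE L); have [_ al] := L.
have h0 : alpha 0 - lam 0 \is a Num.int by apply: al; rewrite /= in_itv/= lexx ler01.
have h1 : alpha 1 - lam 1 \is a Num.int by apply: al; rewrite /= in_itv/= lexx ler01.
have -> : lam 1 - lam 0 = (alpha 1 - alpha 0) - (alpha 1 - lam 1) + (alpha 0 - lam 0) by ring.
by rewrite rpredD// rpredB.
Qed.

Lemma windingD alpha beta : circ_continuous `[(0 : R), 1]%classic alpha ->
  circ_continuous `[(0 : R), 1]%classic beta ->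
  winding (fun t => alpha t + beta t) = winding alpha + winding beta.
Proof.
move=> /(segment_lift ler01)[la La] /(segment_lift ler01)[lb Lb].
rewrite (windingE La) (windingE Lb) (@windingE _ (fun t => la t + lb t)); first by ring.
split; first by apply: withinD; [case: La|case: Lb].
move=> t t01; have := rpredD (La.2 t t01) (Lb.2 t t01).
by rewrite opprD addrACA.
Qed.

(** Winding number zero means that the lift along the circle closes up to a continuous real function
    on the sphere, which Tietze's theorem extends. *)
Lemma disc_extension n (alpha : 'rV[R]_n -> R) : n = 2%N ->
  circ_continuous `[(0 : R), 1]%classic (alpha \o circ n) -> winding (alpha \o circ n) = 0 ->
  exists2 Lam : 'rV[R]_n -> R, continuous Lam &
    forall u, sphere R n u -> alpha u - Lam u \is a Num.int.
Proof.
move=> n2 /(segment_lift ler01)[lam L]; rewrite (windingE L) => /eqP; rewrite subr_eq0 => /eqP l10.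
pose tau (u : 'rV[R]_n) := xget 0 [set t | 0 <= t <= 1 /\ circ n t = u].
have tauP u : sphere R n u -> 0 <= tau u <= 1 /\ circ n (tau u) = u.
  move=> /(circ_surj n2)[t t01 tu]; rewrite /tau.
  by case: xgetP => [_ _ //|/(_ t)]; case.
(* Parameters in the unit interval that agree modulo 1 are equal or are the two ends, where [l10]
   applies. *)
have lamE s t : 0 <= s <= 1 -> 0 <= t <= 1 -> s - t \is a Num.int -> lam s = lam t.
  move=> /andP[s0 s1] /andP[t0 t1] /intrP[k kE].
  have k1 : k <= 1 by rewrite -(ler_int R) -kE rmorph1; lra.
  have kN1 : -1 <= k by rewrite -(ler_int R) -kE rmorphN1; lra.
  have : k = -1 \/ k = 0 \/ k = 1 by lia.
  move=> [|[|]] ke; move: kE; rewrite ke ?rmorphN1 ?rmorph0 ?rmorph1 => kE.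
  - have -> : s = 0 by lra.
    by have -> : t = 1 by lra.
  - by have -> : s = t by lra.
  - have -> : s = 1 by lra.
    by have -> : t = 0 by lra.
have sphereE : \bigcup_(i in [set tt]) (circ n @` `[(0 : R), 1]%classic) = sphere R n.
  apply/seteqP; split => [u [_ _ [t t01 <-]]|u /(circ_surj n2)[t t01 tu]]; first exact: circ_sphere.
  by exists tt => //; exists t.
have cL : {within sphere R n, continuous (lam \o tau)}.
  rewrite -sphereE; apply: (@continuous_glue _ R unit _ (fun=> R) (fun=> `[(0 : R), 1]%classic) (fun=> circ n)).
  - exact: norm_hausdorff.
  - exact: finite_set1.
  - by move=> _ _; exact: segment_compact.
  - by move=> _ _; exact: circ_cont.
  - move=> _ _; apply: within_congr L.1 => t t01 /=.
    have [tt01 tte] := tauP _ (circ_sphere t n2).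
    by apply: lamE => //; apply: (@circ_eq n); rewrite // tte.
have cS : closed (sphere R n).
  have -> : sphere R n = ((fun u => \sum_i u 0 i ^+ 2) : 'rV[R]_n -> R) @^-1` [set 1] by [].
  by apply: closed_comp => [x _|]; [exact: continuous_sqnorm | exact: closed_eq].
have sc : compact (sphere R n).
  by rewrite -sphereE bigcup_set1; apply: continuous_compact; [exact: circ_cont|exact: segment_compact].
have [M M0 bM] : exists2 M, 0 < M & forall u, sphere R n u -> `|lam (tau u)| <= M.
  have /compact_bounded[M [Mr MP]] := continuous_compact cL sc.
  exists (`|M| + 1); first by rewrite ltr_wpDl.
  move=> u uS; apply: (MP (`|M| + 1)); first by rewrite (le_lt_trans (ler_norm _))// ltrDl.
  by exists u.
have [Lam [LE cLam _]] := continuous_bounded_extension (@pseudometric_normal R 'rV[R]_n) cS M0 cL bM.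
exists Lam => // u uS; rewrite -LE ?inE//=.
have [t01 tu] := tauP u uS; have := L.2 (tau u) t01.
by rewrite /= tu.
Qed.

End Circle.

(** * Lifting through the Hopf fibration *)

Section Hopf.
Variable R : realType.

(* [(a + ib, c + id)] spans the line of [C^2] that corresponds to the unit vector
   [(p1, p2, p3)] under the Hopf fibration. *)
Definition hopf (a b c d p1 p2 p3 : R) : Prop :=
  let N := a ^+ 2 + b ^+ 2 + c ^+ 2 + d ^+ 2 in
  [/\ 0 < N, 2 * (a * c + b * d) = N * p1, 2 * (a * d - b * c) = N * p2 &
      a ^+ 2 + b ^+ 2 - c ^+ 2 - d ^+ 2 = N * p3].

(* The new vector is the orthogonal projection onto the line of [(q1, q2, q3)]. *)
Lemma hopf_proj (a b c d p1 p2 p3 q1 q2 q3 : R) :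
  hopf a b c d p1 p2 p3 -> q1 ^+ 2 + q2 ^+ 2 + q3 ^+ 2 = 1 ->
  0 < 1 + (p1 * q1 + p2 * q2 + p3 * q3) ->
  hopf ((1 + q3) * a + q1 * c + q2 * d) ((1 + q3) * b + q1 * d - q2 * c)
       (q1 * a - q2 * b + (1 - q3) * c) (q1 * b + q2 * a + (1 - q3) * d) q1 q2 q3.
Proof.
rewrite /hopf; set N := a ^+ 2 + b ^+ 2 + c ^+ 2 + d ^+ 2.
move=> [N0 S1 S2 S3] q_1 pq.
have q32 : q3 ^+ 2 = 1 - q1 ^+ 2 - q2 ^+ 2 by rewrite -q_1; ring.
have NE : ((1 + q3) * a + q1 * c + q2 * d) ^+ 2 + ((1 + q3) * b + q1 * d - q2 * c) ^+ 2 +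
   (q1 * a - q2 * b + (1 - q3) * c) ^+ 2 + (q1 * b + q2 * a + (1 - q3) * d) ^+ 2 =
   2 * N * (1 + (p1 * q1 + p2 * q2 + p3 * q3)).
  transitivity (2 * (N + (2 * (a * c + b * d)) * q1 + (2 * (a * d - b * c)) * q2 +
     (a ^+ 2 + b ^+ 2 - c ^+ 2 - d ^+ 2) * q3)).
    by rewrite /N; ring: q32.
  by rewrite S1 S2 S3; ring.
split; first by rewrite NE !mulr_gt0.
- by ring: q32.
- by ring: q32.
- by ring: q32.
Qed.

Lemma hopf_surj (p1 p2 p3 : R) : p1 ^+ 2 + p2 ^+ 2 + p3 ^+ 2 = 1 ->
  exists a b c d, hopf a b c d p1 p2 p3.
Proof.
move=> p_1; have [p30|p30] := ltP (-1) p3.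
  have p12 : p1 ^+ 2 = 1 - p2 ^+ 2 - p3 ^+ 2 by rewrite -p_1; ring.
  (* The multiple by 2 of the projection of the vector [(1, 0)] of C^2 onto the line. It is nonzero
     away from the pole [(0, 0, -1)], which is the line of [(0, 1)]. *)
  exists (1 + p3), 0, p1, p2; split; try by ring: p12.
  have -> : (1 + p3) ^+ 2 + 0 ^+ 2 + p1 ^+ 2 + p2 ^+ 2 = 2 * (1 + p3) by ring: p12.
  lra.
have := sqr_ge0 p1; have := sqr_ge0 p2 => p20 p10.
have p3E : p3 = -1 by nra.
have p1E : p1 = 0 by apply/eqP; rewrite -sqrf_eq0 eq_le p10 andbT; nra.
have p2E : p2 = 0 by apply/eqP; rewrite -sqrf_eq0 eq_le p20 andbT; nra.
exists 0, 0, 1, 0; rewrite p1E p2E p3E; split; lra.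
Qed.

Section HopfLift.
Variables (U : topologicalType) (K : set U).

Definition hopf_lift (p1 p2 p3 : U -> R) :=
  exists a b c d : U -> R,
  [/\ {within K, continuous a}, {within K, continuous b}, {within K, continuous c},
      {within K, continuous d} &
      forall x, K x -> hopf (a x) (b x) (c x) (d x) (p1 x) (p2 x) (p3 x)].

Lemma hopf_lift_step (p1 p2 p3 q1 q2 q3 : U -> R) : hopf_lift p1 p2 p3 ->
  {within K, continuous q1} -> {within K, continuous q2} -> {within K, continuous q3} ->
  (forall x, K x -> q1 x ^+ 2 + q2 x ^+ 2 + q3 x ^+ 2 = 1) ->
  (forall x, K x -> 0 < 1 + (p1 x * q1 x + p2 x * q2 x + p3 x * q3 x)) ->
  hopf_lift q1 q2 q3.
Proof.
move=> [a [b [c [d [ca cb cc cd v]]]]] cq1 cq2 cq3 q_1 pq.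
have c3D : {within K, continuous (fun x => 1 + q3 x)} by apply: withinD => //; exact: within_cst.
have c3B : {within K, continuous (fun x => 1 - q3 x)} by apply: withinB => //; exact: within_cst.
exists (fun x => (1 + q3 x) * a x + q1 x * c x + q2 x * d x),
  (fun x => (1 + q3 x) * b x + q1 x * d x - q2 x * c x),
  (fun x => q1 x * a x - q2 x * b x + (1 - q3 x) * c x),
  (fun x => q1 x * b x + q2 x * a x + (1 - q3 x) * d x).
split.
- by apply: withinD; [apply: withinD|]; exact: withinM.
- by apply: withinB; [apply: withinD|]; exact: withinM.
- by apply: withinD; [apply: withinB|]; exact: withinM.
- by apply: withinD; [apply: withinD|]; exact: withinM.
- by move=> x Kx; apply: hopf_proj (v x Kx) _ _; [exact: q_1|exact: pq].
Qed.

End HopfLift.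

(** At time 1 the map is constant, so it has a constant lift. Slices at nearby times are nowhere
    antipodal, which is the positivity of 1 plus the scalar product, and then the orthogonal
    projection carries a lift of one slice to a lift of the other. *)
Lemma hopf_homotopy_lift (U T : topologicalType) (K : set U) (Y : set T) (h : U * R -> T)
  (x0 : T) (p1 p2 p3 : T -> R) :
  compact K -> {within K `*` `[(0 : R), 1]%classic, continuous h} ->
  (forall x t, K x -> 0 <= t <= 1 -> Y (h (x, t))) ->
  {within Y, continuous p1} -> {within Y, continuous p2} -> {within Y, continuous p3} ->
  (forall y, Y y -> p1 y ^+ 2 + p2 y ^+ 2 + p3 y ^+ 2 = 1) ->
  Y x0 -> (forall x, K x -> h (x, 1) = x0) ->
  hopf_lift K (fun x => p1 (h (x, 0))) (fun x => p2 (h (x, 0))) (fun x => p3 (h (x, 0))).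
Proof.
move=> cK ch hY c1 c2 c3 p_1 Yx0 h1.
pose P t := hopf_lift K (fun x => p1 (h (x, t))) (fun x => p2 (h (x, t))) (fun x => p3 (h (x, t))).
have hc (p : T -> R) : {within Y, continuous p} ->
    {within K `*` `[(0 : R), 1]%classic, continuous (p \o h)}.
  by move=> cp; apply: within_comp ch cp _ => -[x t] /= [Kx t01]; exact: hY.
have H1 := hc _ c1; have H2 := hc _ c2; have H3 := hc _ c3.
apply: (@homotopy_transport R U K P (fun t z => 1 + (p1 (h z) * p1 (h (z.1, t)) +
   p2 (h z) * p2 (h (z.1, t)) + p3 (h z) * p3 (h (z.1, t))))) => //.
- move=> t t01; apply: withinD; first exact: within_cst.
  have G1 := within_slice2 t01 H1; have G2 := within_slice2 t01 H2.
  have G3 := within_slice2 t01 H3.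
  by apply: withinD; [apply: withinD|]; exact: withinM.
- move=> t x t01 Kx /=; rewrite -!expr2 p_1; last exact: hY.
  by lra.
- move=> s t s01 t01 st; split => L; apply: (hopf_lift_step L).
  + exact: (within_slice t01 H1).
  + exact: (within_slice t01 H2).
  + exact: (within_slice t01 H3).
  + by move=> x Kx; apply: p_1; exact: hY.
  + by move=> x Kx; exact: st.
  + exact: (within_slice s01 H1).
  + exact: (within_slice s01 H2).
  + exact: (within_slice s01 H3).
  + by move=> x Kx; apply: p_1; exact: hY.
  + move=> x Kx; have := st x Kx; rewrite /= [p1 _ * _]mulrC [p2 _ * _]mulrC [p3 _ * _]mulrC.
    by [].
- have [a [b [c [d v]]]] := hopf_surj (p_1 x0 Yx0).
  exists (cst a), (cst b), (cst c), (cst d); split; try exact: within_cst.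
  by move=> x Kx; rewrite h1.
Qed.

(** An argument of [x + iy] in full turns, chosen without any regard to continuity; only its class
    modulo 1 varies continuously. At the origin it takes the default value 0. *)
Definition ang (x y : R) : R := let r := Num.sqrt (x ^+ 2 + y ^+ 2) in
  xget 0 [set t | cs t = x / r /\ sn t = y / r].

Lemma angP x y : 0 < x ^+ 2 + y ^+ 2 ->
  cs (ang x y) = x / Num.sqrt (x ^+ 2 + y ^+ 2) /\ sn (ang x y) = y / Num.sqrt (x ^+ 2 + y ^+ 2).
Proof.
move=> r0; rewrite /ang; set r := Num.sqrt _.
have r2 : r ^+ 2 = x ^+ 2 + y ^+ 2 by rewrite sqr_sqrtr// ltW.
have [|t _ tP] := @cs_sn_surj R (x / r) (y / r).
  by rewrite !expr_div_n -mulrDl -r2 divff// r2 gt_eqF.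
by case: xgetP => [_ _ []//|/(_ t)].
Qed.

Lemma ang_continuous (U : topologicalType) (K : set U) (x y : U -> R) :
  {within K, continuous x} -> {within K, continuous y} ->
  (forall u, K u -> 0 < x u ^+ 2 + y u ^+ 2) ->
  circ_continuous K (fun u => ang (x u) (y u)).
Proof.
move=> cx cy r0.
have cr : {within K, continuous (fun u => (Num.sqrt (x u ^+ 2 + y u ^+ 2))^-1)}.
  apply: withinV; first by move=> u Ku; rewrite sqrtr_eq0 -ltNge r0.
  apply: (@within_global U R R K (fun u => x u ^+ 2 + y u ^+ 2) Num.sqrt); last exact: sqrt_continuous.
  apply: withinD; first by apply: within_congr (withinM cx cx) => u _; rewrite expr2.
  by apply: within_congr (withinM cy cy) => u _; rewrite expr2.
split.
- by apply: (within_congr _ (withinM cx cr)) => u Ku /=; have [-> _] := angP (r0 u Ku).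
- by apply: (within_congr _ (withinM cy cr)) => u Ku /=; have [_ ->] := angP (r0 u Ku).
Qed.

Lemma ang_rot (x y x' y' t : R) : 0 < x' ^+ 2 + y' ^+ 2 ->
  x = x' * cs t - y' * sn t -> y = y' * cs t + x' * sn t ->
  ang x y - (ang x' y' + t) \is a Num.int.
Proof.
move=> r0' xE yE; have ct := cs2Dsn2 t.
have rE : x ^+ 2 + y ^+ 2 = x' ^+ 2 + y' ^+ 2.
  have s2 : sn t ^+ 2 = 1 - cs t ^+ 2 by rewrite -ct; ring.
  by rewrite xE yE; ring: s2.
have r0 : 0 < x ^+ 2 + y ^+ 2 by rewrite rE.
have [c s] := angP r0; have [c' s'] := angP r0'.
apply: cs_sn_int.
  by rewrite csD c c' s' rE xE; ring.
by rewrite snD s c' s' rE yE; ring.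
Qed.

End Hopf.

(** * Functions on the cells *)

Section Coordinates.
Variable R : realType.

(* The [k]-th coordinate, with [k] a natural number: the dimension of a cell is
   only propositionally equal to a numeral. *)
Definition crd n (u : 'rV[R]_n) (k : nat) : R := if insub k is Some i then u 0 i else 0.

Definition row_cst n (t : R) : 'rV[R]_n := \row_i t.

Lemma crd_ord n (u : 'rV[R]_n) (i : 'I_n) : crd u i = u 0 i.
Proof. by rewrite /crd valK. Qed.

Lemma crd_out n (u : 'rV[R]_n) k : (n <= k)%N -> crd u k = 0.
Proof. by move=> nk; rewrite /crd insubN// -leqNgt. Qed.

Lemma crd_cont n (K : set 'rV[R]_n) k : {within K, continuous (fun u => crd u k)}.
Proof.
have [kn|nk] := ltnP k n.
  apply: (@within_congr 'rV[R]_n R K (fun u => u 0 (Ordinal kn))); first by move=> u _; rewrite -crd_ord.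
  by apply: continuous_subspaceT => u; exact: coord_continuous.
apply: (@within_congr 'rV[R]_n R K (fun=> 0)); first by move=> u _; rewrite crd_out.
exact: within_cst.
Qed.

Lemma row_cst_cont n (K : set R) : {within K, continuous (row_cst n)}.
Proof.
apply: within_rV => i; apply: (@within_congr R R K id); last exact: within_id.
by move=> x _; rewrite mxE.
Qed.

Lemma crd_row n t k : (k < n)%N -> crd (row_cst n t) k = t.
Proof. by move=> kn; rewrite -[k]/(val (Ordinal kn)) crd_ord mxE. Qed.

Lemma crd_circ0 n t : n = 2%N -> crd (circ n t : 'rV[R]_n) 0 = cs t.
Proof. by move=> ->; rewrite -[0%N]/(val (@ord0 1)) crd_ord mxE. Qed.
Lemma crd_circ1 n t : n = 2%N -> crd (circ n t : 'rV[R]_n) 1 = sn t.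
Proof. by move=> ->; rewrite -[1%N]/(val (@ord_max 1)) crd_ord mxE. Qed.

Lemma row_cst_crd n (u : 'rV[R]_n) : n = 1%N -> row_cst n (crd u 0) = u.
Proof.
by move=> n1; move: u; rewrite n1 => u; apply/rowP => i; rewrite mxE -crd_ord (ord1 i).
Qed.

Lemma sqnorm1 n (u : 'rV[R]_n) : n = 1%N -> \sum_i u 0 i ^+ 2 = crd u 0 ^+ 2.
Proof. by move=> n1; move: u; rewrite n1 => u; rewrite big_ord1 -crd_ord. Qed.

Lemma sqnorm2 n (u : 'rV[R]_n) : n = 2%N -> \sum_i u 0 i ^+ 2 = crd u 0 ^+ 2 + crd u 1 ^+ 2.
Proof.
by move=> n2; move: u; rewrite n2 => u; rewrite big_ord_recl big_ord1 -!crd_ord.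
Qed.

Lemma oball_cball n : oball R n `<=` cball R n.
Proof. by move=> u; exact: ltW. Qed.
Lemma sphere_cball n : sphere R n `<=` cball R n.
Proof. by move=> u; rewrite /sphere /cball /= => ->. Qed.
Lemma cball_split n u : cball R n u -> oball R n u \/ sphere R n u.
Proof. by rewrite /cball /= le_eqVlt => /orP[/eqP|]; [right|left]. Qed.

Lemma cball0 n (u v : 'rV[R]_n) : n = 0%N -> u = v.
Proof. by move=> n0; move: u v; rewrite n0 => u v; apply/rowP => -[]. Qed.
Lemma oball_dim0 n (u : 'rV[R]_n) : n = 0%N -> oball R n u.
Proof. by move=> n0; move: u; rewrite n0 => u; rewrite /oball /= big_ord0. Qed.

Lemma within_dim0 n (V : topologicalType) (f : 'rV[R]_n -> V) K : n = 0%N -> {within K, continuous f}.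
Proof.
move=> n0; apply: (@within_congr 'rV[R]_n V K (fun=> f 0)); first by move=> u _; rewrite (cball0 u 0 n0).
by move=> x; exact: cvg_cst.
Qed.

Lemma row_cst_cball n t : n = 1%N -> -1 <= t <= 1 -> cball R n (row_cst n t).
Proof.
move=> n1 /andP[t0 t1]; rewrite /cball /= (sqnorm1 _ n1) crd_row ?n1//; nra.
Qed.

Lemma row_cst_oball n t : n = 1%N -> -1 < t < 1 -> oball R n (row_cst n t).
Proof.
move=> n1 /andP[t0 t1]; rewrite /oball /= (sqnorm1 _ n1) crd_row ?n1//; nra.
Qed.

Lemma sphere1 n u : n = 1%N -> sphere R n u -> u = row_cst n 1 \/ u = row_cst n (-1).
Proof.
move=> n1; rewrite /sphere /= (sqnorm1 _ n1) => /eqP; rewrite sqrf_eq1 => /orP[] /eqP ue.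
  by left; rewrite -ue row_cst_crd.
by right; rewrite -ue row_cst_crd.
Qed.

Lemma row_cst_sphere n (b : bool) : n = 1%N -> sphere R n (row_cst n (if b then 1 else -1)).
Proof.
move=> n1; rewrite /sphere /= (sqnorm1 _ n1) crd_row ?n1//.
by case: b; rewrite ?sqrrN expr1n.
Qed.

End Coordinates.

Section CW.
Variables (R : realType) (T : topologicalType) (X : cw_complex R T).
Local Notation chi := (char_map X).
Local Notation ball_of c := (cball R (dim (c : cell X))).
Local Notation I01 := (`[(0 : R), 1]%classic).
Implicit Types c d e v : cell X.

Lemma closed_cell_compact c : compact (closed_cell (c : cell X)).
Proof. by apply: continuous_compact; [exact: cw_continuous|exact: cball_compact]. Qed.

Lemma closed_cell_closed c : closed (closed_cell (c : cell X)).
Proof. by apply: compact_closed; [exact: (cw_hausdorff X)|exact: closed_cell_compact]. Qed.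

Lemma open_closed_cell c : open_cell X c `<=` closed_cell c.
Proof. by move=> _ [u uB <-]; exists u => //; exact: oball_cball. Qed.

Lemma in_open_cell (x : T) : exists c, open_cell X c x.
Proof. by have : setT x by []; rewrite -(cw_cover X) => -[c _]; exists c. Qed.

Lemma open_cell_eq c d x : open_cell X c x -> open_cell X d x -> c = d.
Proof. by move=> cx dx; apply: cw_disjoint; exists x. Qed.

Lemma boundary_dim c u d : sphere R (dim c) u -> open_cell X d (chi c u) -> (dim d < dim c)%N.
Proof.
move=> us du; have [F _ FP] := cw_closure_finite c.
have [e [_ ec] eu] := FP _ (ex_intro2 _ _ u us erefl).
by rewrite (open_cell_eq du eu).
Qed.

Lemma closed_cellP c x d : closed_cell c x -> open_cell X d x -> d = c \/ (dim d < dim c)%N.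
Proof.
move=> [u uB <-] du; have [uo|us] := cball_split uB; last by right; exact: boundary_dim us du.
by left; apply: open_cell_eq du _; exists u.
Qed.

(** The open cells partition the space and the characteristic maps are injective on open balls, so
    arbitrary functions on the balls define one on [T]. Its continuity is checked afterwards on
    finite unions of closed cells, by compatibility with the boundaries. *)
Definition glue (G : forall c : cell X, 'rV[R]_(dim c) -> R) (x : T) : R :=
  xget 0 [set y | exists c (u : 'rV[R]_(dim c)), [/\ oball R (dim c) u, chi c u = x & y = G c u]].

Lemma glueE G c u : oball R (dim c) u -> glue G (chi c u) = G c u.
Proof.
move=> uo; rewrite /glue; case: xgetP => [y _ [d [v [vo vu ->]]]|/(_ (G c u))].
  have dc : d = c by apply: (@open_cell_eq d c (chi c u)); [exists v|exists u].
  by subst d; congr G; apply: (@cw_injective _ _ X c); rewrite ?inE.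
by case; exists c, u.
Qed.

Lemma cells_glue (V : topologicalType) (F : set (cell X)) (g : T -> V) : finite_set F ->
  (forall c, F c -> {within ball_of c, continuous (g \o chi c)}) ->
  {within \bigcup_(c in F) closed_cell c, continuous g}.
Proof.
move=> fF cg; apply: (@continuous_glue T V (cell X) F (fun c => 'rV[R]_(dim c)) (fun c => ball_of c) chi) => //.
- exact: (cw_hausdorff X).
- by move=> c _; exact: cball_compact.
- by move=> c _; exact: cw_continuous.
Qed.

Lemma cells_circ (F : set (cell X)) (alpha : T -> R) : finite_set F ->
  (forall c, F c -> circ_continuous (ball_of c) (alpha \o chi c)) ->
  circ_continuous (\bigcup_(c in F) closed_cell c) alpha.
Proof. by move=> fF ca; split; apply: cells_glue => // c /ca[]. Qed.

Lemma compact_finite_cells (K : set T) : cw_locally_finite X -> compact K ->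
  exists2 F : set (cell X), finite_set F & K `<=` \bigcup_(c in F) open_cell X c.
Proof.
move=> lf /compact_near_coveringP cK.
(* The filter generated by the supersets of finite sets: compactness along it merges the locally
   finite sets of cells into one finite set. *)
pose FF : set_system (set (cell X)) :=
  filter_from [set A | finite_set A] (fun A => [set B | A `<=` B]).
have FFF : Filter FF.
  apply: filter_from_filter; first by exists set0; exact: finite_set0.
  move=> A B fA fB; exists (A `|` B); first by rewrite /= finite_setU.
  by move=> C ABC; split=> c Hc; apply: ABC; [left|right].
have [|A fA AP] := cK (set (cell X)) FF (fun B x => forall c, open_cell X c x -> B c) FFF.
  move=> x Kx; have [U nU fU] := lf x.
  exists (U, [set B | [set c | closed_cell c `&` U !=set0] `<=` B]).
    by split=> //; exists [set c | closed_cell c `&` U !=set0].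
  move=> [y B] /= [Uy UB] c cy; apply: UB; exists y; split=> //; exact: open_closed_cell.
exists A => // x Kx; have [c cx] := in_open_cell x; exists c => //.
exact: (AP A (@subset_refl _ A) x Kx).
Qed.

Definition edge_pt (e : cell X) (t : R) : T := chi e (row_cst (dim e) t).

Lemma edge_pt_cont e : dim e = 1%N -> {within `[(-1 : R), 1]%classic, continuous (edge_pt e)}.
Proof.
move=> e1; apply: (@within_comp R 'rV[R]_(dim e) T _ (ball_of e) (@row_cst R (dim e)) (chi e)).
- exact: row_cst_cont.
- exact: cw_continuous.
- by move=> t; rewrite /= in_itv/=; exact: row_cst_cball.
Qed.

Lemma edge_pt_vertex e (b : bool) : dim e = 1%N ->
  exists2 v : cell X, dim v = 0%N & chi v 0 = edge_pt e (if b then 1 else -1).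
Proof.
move=> e1; have [v [w wo wE]] := in_open_cell (edge_pt e (if b then 1 else -1)).
have : (dim v < 1)%N.
  by rewrite -e1; apply: (@boundary_dim e (row_cst (dim e) (if b then 1 else -1))); [exact: row_cst_sphere|exists w].
rewrite ltnS leqn0 => /eqP v0; exists v => //.
by rewrite -wE; congr chi; exact: cball0.
Qed.

(* Circle-valued: [0] at the vertices, it winds [phi e] times along the edge [e]. *)
Definition edge_angle (phi : cell X -> int) : T -> R :=
  glue (fun c u => if dim c == 1%N then (phi c)%:~R * ((crd u 0 + 1) / 2) else 0).

Lemma edge_angle_vertex phi v : dim v = 0%N -> edge_angle phi (chi v 0) = 0.
Proof. by move=> v0; rewrite /edge_angle glueE ?v0//; exact: oball_dim0. Qed.

Lemma edge_angle_edge phi e u : dim e = 1%N -> ball_of e u ->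
  edge_angle phi (chi e u) - (phi e)%:~R * ((crd u 0 + 1) / 2) \is a Num.int.
Proof.
move=> e1 /cball_split[uo|/(sphere1 e1) us].
  by rewrite /edge_angle glueE// ifT ?e1// subrr rpred0.
have [b uE] : exists b : bool, u = row_cst (dim e) (if b then 1 else -1).
  by case: us => ->; [exists true|exists false].
have [v v0 vE] := edge_pt_vertex b e1.
rewrite uE -[chi e _]vE edge_angle_vertex// crd_row ?e1// sub0r rpredN.
case: b {uE vE}; last by rewrite addNr mul0r mulr0 rpred0.
by rewrite divff ?mulr1 ?intr_int// -[1 + 1]/(2%:R) pnatr_eq0.
Qed.

Lemma edge_angle_circ_cell phi c : (dim c <= 1)%N -> circ_continuous (ball_of c) (edge_angle phi \o chi c).
Proof.
rewrite leq_eqVlt ltnS leqn0 => /orP[/eqP c1|/eqP c0]; last by split; exact: within_dim0.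
apply: (@circ_continuous_lift R _ _ _ (fun u => (phi c)%:~R * ((crd u 0 + 1) / 2))); split.
  apply: withinM; first exact: within_cst.
  apply: withinM; last exact: within_cst.
  by apply: withinD; [exact: crd_cont|exact: within_cst].
by move=> u uB; exact: edge_angle_edge.
Qed.

Lemma edge_angle_circ phi (F : set (cell X)) : finite_set F -> (forall c, F c -> (dim c <= 1)%N) ->
  circ_continuous (\bigcup_(c in F) closed_cell c) (edge_angle phi).
Proof. by move=> fF F1; apply: cells_circ => // c /F1; exact: edge_angle_circ_cell. Qed.

(** With [psi] a real-valued lift of [alpha] at the vertices, [phi d] is the number of turns of
    [alpha] along the edge [d] in excess of the change of [psi] between its ends. *)
Definition graph_lift (alpha psi : T -> R) (Lam : forall c : cell X, 'rV[R]_(dim c) -> R)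
    (phi : cell X -> int) (d : cell X) :=
  is_lift (ball_of d) (alpha \o chi d) (Lam d) /\
  (phi d)%:~R = Lam d (row_cst (dim d) 1) - Lam d (row_cst (dim d) (-1)) -
     (psi (edge_pt d 1) - psi (edge_pt d (-1))).

(** On the graph, [alpha] and the angle of its edge cochain [phi] differ by a function with the
    continuous real lift [Psi], and such a function has winding zero along every closed loop. So
    windings only depend on the cochain. *)
Lemma graph_winding (F : set (cell X)) alpha psi Lam phi (l : R -> T) : finite_set F ->
  (forall d, F d -> (dim d <= 1)%N) ->
  (forall d, F d -> dim d = 1%N -> graph_lift alpha psi Lam phi d) ->
  (forall v, dim v = 0%N -> alpha (chi v 0) - psi (chi v 0) \is a Num.int) ->
  {within I01, continuous l} -> l 0 = l 1 ->
  (forall t, 0 <= t <= 1 -> (\bigcup_(c in F) closed_cell c) (l t)) ->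
  winding (alpha \o l) = winding (edge_angle phi \o l).
Proof.
move=> fF F1 FL psia cl l01 lF; set S := \bigcup_(c in F) closed_cell c in lF.
pose Psi := glue (fun c u => if dim c == 1%N then
   Lam c u - (phi c)%:~R * ((crd u 0 + 1) / 2) + (psi (edge_pt c (-1)) - Lam c (row_cst (dim c) (-1)))
   else psi (chi c 0)).
have PsiV v : dim v = 0%N -> Psi (chi v 0) = psi (chi v 0).
  by move=> v0; rewrite /Psi glueE; [rewrite ifN ?v0|exact: oball_dim0].
have PsiE d u : F d -> dim d = 1%N -> ball_of d u -> Psi (chi d u) =
    Lam d u - (phi d)%:~R * ((crd u 0 + 1) / 2) + (psi (edge_pt d (-1)) - Lam d (row_cst (dim d) (-1))).
  move=> Fd d1 /cball_split[uo|/(sphere1 d1) us]; first by rewrite /Psi glueE// ifT ?d1//.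
  have [_ pE] := FL d Fd d1.
  case: us => ->; rewrite crd_row ?d1//.
    have [v v0 vE] := edge_pt_vertex true d1.
    by rewrite -[chi d _]vE PsiV// vE pE; lra.
  have [v v0 vE] := edge_pt_vertex false d1.
  by rewrite -[chi d _]vE PsiV// vE; ring.
have cPsi : {within S, continuous Psi}.
  apply: cells_glue => // d Fd; have := F1 d Fd.
  rewrite leq_eqVlt ltnS leqn0 => /orP[/eqP d1|/eqP d0]; last exact: within_dim0.
  apply: (within_congr (fun u uB => esym (PsiE d u Fd d1 uB))).
  apply: withinD; last exact: within_cst.
  apply: withinB; first by case: (FL d Fd d1) => -[].
  apply: withinM; first exact: within_cst.
  apply: withinM; last exact: within_cst.
  by apply: withinD; [exact: crd_cont|exact: within_cst].
have key x : S x -> alpha x - edge_angle phi x - Psi x \is a Num.int.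
  move=> [d Fd [u uB <-]]; have := F1 d Fd.
  rewrite leq_eqVlt ltnS leqn0 => /orP[/eqP d1|/eqP d0]; last first.
    by rewrite (cball0 u 0 d0) PsiV// edge_angle_vertex// subr0; exact: psia.
  have [[_ La] pE] := FL d Fd d1.
  have h1 := La u uB; have h2 := edge_angle_edge phi d1 uB.
  have rm : row_cst (dim d) (-1) \in ball_of d.
    by rewrite inE; apply: row_cst_cball; rewrite // lexx; lra.
  have h3 := La _ (set_mem rm).
  have [v v0 vE] := edge_pt_vertex false d1.
  have h4 := psia v v0; rewrite vE in h4.
  rewrite PsiE//.
  have -> : alpha (chi d u) - edge_angle phi (chi d u) -
    (Lam d u - (phi d)%:~R * ((crd u 0 + 1) / 2) + (psi (edge_pt d (-1)) - Lam d (row_cst (dim d) (-1)))) =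
    ((alpha \o chi d) u - Lam d u) - (edge_angle phi (chi d u) - (phi d)%:~R * ((crd u 0 + 1) / 2))
    + (alpha (edge_pt d (-1)) - psi (edge_pt d (-1))) -
    ((alpha \o chi d) (row_cst (dim d) (-1)) - Lam d (row_cst (dim d) (-1))).
    by rewrite /edge_pt /=; ring.
  by rewrite rpredB// rpredD// rpredB.
have cS : circ_continuous S (edge_angle phi) by exact: edge_angle_circ.
have LPsi : is_lift I01 (fun t => alpha (l t) - edge_angle phi (l t)) (Psi \o l).
  split; first by apply: within_comp cl cPsi _ => t; rewrite /= in_itv/=; exact: lF.
  by move=> t; rewrite /= in_itv/= => t01; exact/key/lF.
have c2 : circ_continuous I01 (edge_angle phi \o l).
  by apply: circ_continuous_comp cl _ cS => t; rewrite /= in_itv/=; exact: lF.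
have := windingD (circ_continuous_lift LPsi) c2.
rewrite (windingE LPsi) /= l01 subrr add0r => <-.
by congr winding; apply/funext => t /=; rewrite subrK.
Qed.

End CW.

(** * Integral functionals that separate a vector from finitely many others *)

Section Separation.
Import multinomials.freeg.
Variable A : choiceType.

Definition pairing (phi : A -> rat) := basis_ext (phi : A -> rat^o).
HB.instance Definition _ phi := GRing.Linear.on (pairing phi).

Lemma pairingE phi a : pairing phi << a >> = phi a.
Proof. exact: basis_extE. Qed.

Lemma pairing_sum phi x : pairing phi x = \sum_(a <- dom x) coeff a x * phi a.
Proof. by []. Qed.

Lemma pairingZl k phi x : pairing (fun a => k * phi a) x = k * pairing phi x.
Proof. by rewrite !pairing_sum mulr_sumr; apply: eq_bigr => a _; rewrite mulrCA. Qed.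

Lemma pairing_coeff a x : pairing (fun b => (b == a)%:R) x = coeff a x.
Proof.
rewrite pairing_sum; have [ax|ax] := boolP (a \in dom x).
  rewrite (bigD1_seq a)//= ?uniq_dom// eqxx mulr1 big1 ?addr0// => b /negPf ->.
  by rewrite mulr0.
rewrite (coeff_outdom ax) big_seq big1// => b bx; case: eqP => [ba|]; last by rewrite mulr0.
by rewrite -ba bx in ax.
Qed.

Lemma pairing_symm (f x : {freeg A / rat}) :
  pairing (fun a => coeff a f) x = pairing (fun a => coeff a x) f.
Proof.
rewrite !pairing_sum; set s := undup (dom x ++ dom f).
have us : uniq s by exact: undup_uniq.
have H (y : {freeg A / rat}) (b : A -> rat) : {subset dom y <= s} ->
    \sum_(a <- dom y) coeff a y * b a = \sum_(a <- s) coeff a y * b a.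
  by move=> ys; exact: (@basis_ext_big A rat^o b s y us ys).
rewrite !H; first by apply: eq_bigr => a _; rewrite mulrC.
  by move=> a; rewrite mem_undup mem_cat => ->; rewrite orbT.
by move=> a; rewrite mem_undup mem_cat => ->.
Qed.

(** Gaussian elimination: a basis element [a] in the support of [w] is used as pivot to clear the
    coordinate [a] of the remaining vectors, and the functional found for these is corrected at [a]
    so that it kills [w]. The subspace [P] serves to say that [z] is not in the span of [ws]; the
    functional kills [ws], not necessarily [P]. *)
Lemma separation (P : set {freeg A / rat}) (ws : seq {freeg A / rat}) (z : {freeg A / rat}) :
  P 0 -> (forall k x y, P x -> P y -> P (k *: x + y)) -> (forall w, w \in ws -> P w) -> ~ P z ->
  exists f : {freeg A / rat}, [/\ integral_chain f,
    forall w, w \in ws -> pairing (fun a => coeff a f) w = 0 &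
    pairing (fun a => coeff a f) z != 0].
Proof.
move=> P0 PD Pw Pz.
suff [f fw fz] : exists2 f : {freeg A / rat},
    forall w, w \in ws -> pairing (fun a => coeff a f) w = 0 &
    pairing (fun a => coeff a f) z != 0.
  have [m m0 mf] := common_denominator f.
  have E x : pairing (fun a => coeff a (m%:R *: f)) x = m%:R * pairing (fun a => coeff a f) x.
    by rewrite -pairingZl; congr pairing; apply/funext => a; rewrite coeffZ.
  exists (m%:R *: f); split=> //; first by move=> w /fw; rewrite E => ->; rewrite mulr0.
  by rewrite E mulf_neq0// pnatr_eq0 -lt0n.
have [n] := ubnP (size ws); elim: n ws z Pw Pz => // n IH [|w ws] z Pw Pz /=.
  move=> _; have z0 : z != 0 by apply/eqP => z0; apply: Pz; rewrite z0.
  have : dom z != [::] by rewrite dom_eq0.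
  case E : (dom z) => [//|a s] _; exists << a >> => //.
  rewrite pairing_symm pairingE -mem_dom E inE eqxx//.
rewrite ltnS => wsn; have [w0|w0] := eqVneq w 0.
  have [|f fw fz] := IH ws z _ Pz wsn.
    by move=> v vw; apply: Pw; rewrite inE vw orbT.
  exists f => // v; rewrite inE => /orP[/eqP ->|/fw//].
  by rewrite w0 linear0.
have : dom w != [::] by rewrite dom_eq0.
case E : (dom w) => [//|a s] _.
have wa : coeff a w != 0 by rewrite -mem_dom E inE eqxx.
pose red x := x - (coeff a x / coeff a w) *: w.
have Pww : P w by apply: Pw; rewrite inE eqxx.
have reda x : coeff a (red x) = 0 by rewrite coeffB coeffZ divfK// subrr.
have [|||f fw fz] := IH [seq red v | v <- ws] (red z) _ _ _; last 1 first.
- pose c := pairing (fun b => coeff b f) w / coeff a w.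
  pose g := f - c *: << a >>.
  have gE x : pairing (fun b => coeff b g) x = pairing (fun b => coeff b f) x - c * coeff a x.
    rewrite pairing_symm linearB linearZ /= pairingE -pairing_symm //.
  have gw : pairing (fun b => coeff b g) w = 0 by rewrite gE /c divfK// subrr.
  have gred x : pairing (fun b => coeff b g) x = pairing (fun b => coeff b f) (red x).
    have : pairing (fun b => coeff b g) (red x) = pairing (fun b => coeff b g) x.
      by rewrite linearB linearZ /= gw [_ *: _]mulr0 subr0.
    by move=> <-; rewrite gE reda mulr0 subr0.
  exists g; last by rewrite gred.
  move=> v; rewrite inE => /orP[/eqP ->//|vs]; rewrite gred fw//.
  by apply: map_f.
- move=> _ /mapP[v vs ->]; rewrite /red addrC -scaleNr; apply: PD => //.
  by apply: Pw; rewrite inE vs orbT.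
- move=> Prz; apply: Pz; have -> : z = (coeff a z / coeff a w) *: w + red z by rewrite addrC subrK.
  exact: PD.
- by rewrite size_map.
Qed.

End Separation.

(** * Cellular chains *)

Section WindingSum.
Variable R : realType.
Local Notation I01 := (`[(0 : R), 1]%classic).

Lemma winding_cst (a : R) : winding (fun=> a) = 0.
Proof.
rewrite (@windingE R _ (fun=> a)) ?subrr//; split; first exact: within_cst.
by move=> t _; rewrite subrr rpred0.
Qed.

Lemma winding_sum (I : eqType) (s : seq I) (k : I -> int) (alpha : I -> R -> R) :
  (forall i, circ_continuous I01 (alpha i)) ->
  winding (fun t => \sum_(i <- s) (k i)%:~R * alpha i t) = \sum_(i <- s) (k i)%:~R * winding (alpha i).
Proof.
move=> ca; have [lam lamP] := choice (fun i => segment_lift ler01 (ca i)).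
rewrite (@windingE R _ (fun t => \sum_(i <- s) (k i)%:~R * lam i t)).
  rewrite -sumrB; apply: eq_bigr => i _.
  by rewrite (windingE (lamP i)) mulrBr.
elim: s => [|i s [cs sP]].
  split; first by apply: (@within_congr R R I01 (fun=> 0)); [move=> t _; rewrite big_nil|exact: within_cst].
  by move=> t _; rewrite !big_nil subrr rpred0.
split.
  apply: (@within_congr R R _ (fun t => (k i)%:~R * lam i t + \sum_(i <- s) (k i)%:~R * lam i t)).
    by move=> t _; rewrite big_cons.
  by apply: withinD => //; apply: withinM; [exact: within_cst|case: (lamP i)].
move=> t t01; have ki : ((k i)%:~R : R) \is a Num.int by rewrite intr_int.
have := rpredD (rpredM ki ((lamP i).2 t t01)) (sP t t01).
by rewrite !big_cons mulrBr addrACA -opprD.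
Qed.

Lemma ratr_inj_eq (x y : rat) : ratr x = ratr y :> R -> x = y.
Proof. exact: fmorph_inj. Qed.

End WindingSum.

Section Chains.
Import multinomials.freeg.
Variables (R : realType) (T : topologicalType) (X : cw_complex R T).
Local Notation chi := (char_map X).
Local Notation ball_of c := (cball R (dim (c : cell X))).
Local Notation I01 := (`[(0 : R), 1]%classic).
Implicit Types c d : cell X.

Definition kcell (k : nat) := {c : {classic cell X} | dim (c : cell X) == k}.
Definition kval k (c : kcell k) : cell X := val c.

Lemma dim_kval k (c : kcell k) : dim (kval c) = k.
Proof. exact/eqP/(valP c). Qed.

Lemma kval_inj k : injective (@kval k).
Proof. exact: val_inj. Qed.

Lemma kval_ex k c : dim c = k -> exists d : kcell k, kval d = c.
Proof. by move=> /eqP ck; exists (exist _ (c : {classic cell X}) ck). Qed.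

Definition vpt (v : kcell 0) : T := chi (kval v) 0.

Lemma vpt_inj : injective vpt.
Proof.
move=> v w e; apply/kval_inj/(@open_cell_eq _ _ X _ _ (vpt v)).
  by exists 0 => //; apply: oball_dim0; exact: dim_kval.
by rewrite e; exists 0 => //; apply: oball_dim0; exact: dim_kval.
Qed.

Definition side (b : bool) : R := if b then 1 else -1.

Lemma endpt_ex (e : kcell 1) b : exists v, vpt v = edge_pt (kval e) (side b).
Proof.
have [v v0 vE] := edge_pt_vertex b (dim_kval e); have [w we] := kval_ex v0.
by exists w; rewrite /vpt we.
Qed.

Definition endpt (e : kcell 1) b : kcell 0 := projT1 (cid (endpt_ex e b)).

Lemma endptE e b : vpt (endpt e b) = edge_pt (kval e) (side b).
Proof. exact: (projT2 (cid (endpt_ex e b))). Qed.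

Definition loop c (t : R) : T := chi c (circ (dim c) t).

Lemma loop_cont c (K : set R) : dim c = 2%N -> {within K, continuous (loop c)}.
Proof.
move=> c2; apply: (@within_comp R 'rV[R]_(dim c) T _ (ball_of c) (@circ R (dim c)) (chi c)).
- exact: circ_cont.
- exact: cw_continuous.
- by move=> t _; apply/sphere_cball/circ_sphere.
Qed.

Lemma loop_closed c : loop c 0 = loop c 1.
Proof. by rewrite /loop; congr chi; apply: circ_periodic; rewrite sub0r rpredN rpred1. Qed.

Lemma loop_cells c : dim c = 2%N -> exists F : set (cell X), [/\ finite_set F,
  forall d, F d -> (dim d <= 1)%N & forall t, (\bigcup_(d in F) open_cell X d) (loop c t)].
Proof.
move=> c2; have [F fF FP] := cw_closure_finite c.
exists (F `&` [set d | (dim d < dim c)%N]); split.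
- by apply: sub_finite_set fF => d [].
- by move=> d [_]; rewrite /= c2 ltnS.
- move=> t; have [|d [Fd dc] dt] := FP (loop c t); last by exists d.
  by exists (circ (dim c) t) => //; exact: circ_sphere.
Qed.

Lemma loop_closed_cells c : dim c = 2%N -> exists F : set (cell X), [/\ finite_set F,
  forall d, F d -> (dim d <= 1)%N & forall t, (\bigcup_(d in F) closed_cell d) (loop c t)].
Proof.
move=> /loop_cells[F [fF F1 FP]]; exists F; split=> // t.
by have [d Fd dt] := FP t; exists d => //; exact: open_closed_cell.
Qed.

Lemma edge_angle_loop (phi : cell X -> int) c : dim c = 2%N -> circ_continuous I01 (edge_angle phi \o loop c).
Proof.
move=> c2; have [F [fF F1 FP]] := loop_closed_cells c2.
by apply: circ_continuous_comp (edge_angle_circ phi fF F1); [exact: loop_cont|].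
Qed.

Definition edge_ind (e d : cell X) : int := (`[< d = e >] : nat)%:Z.

(** The degree of the attaching map of [c] over the edge [e]: the winding number of the attaching
    loop once the graph is collapsed onto the circle of [e]. The floor only turns an integral real
    into an integer. *)
Definition incidence (c e : cell X) : int := Num.floor (winding (edge_angle (edge_ind e) \o loop c)).

Lemma incidenceE c (e : cell X) : dim c = 2%N ->
  (incidence c e)%:~R = winding (edge_angle (edge_ind e) \o loop c).
Proof.
move=> c2; apply: floorK; apply: winding_int; first exact: edge_angle_loop.
by rewrite /= loop_closed subrr rpred0.
Qed.

Lemma boundary_edges_ex c : exists s : seq (kcell 1), dim c = 2%N -> uniq s /\
  forall t e, open_cell X (kval e) (loop c t) -> e \in s.
Proof.
have [c2|c2] := pselect (dim c = 2%N); last by exists [::] => /c2.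
have [F [fF F1 FP]] := loop_cells c2.
have fG : finite_set [set e : kcell 1 | F (kval e)].
  apply: (@finite_preimage _ _ F (@kval 1)) => //.
  by move=> e e' _ _; exact: kval_inj.
have [s sE] := (finite_seqP _).1 fG.
exists (undup s) => _; split; first exact: undup_uniq.
move=> t e et; have [d Fd dt] := FP t; rewrite mem_undup.
have : [set` s] e by rewrite -sE /= (open_cell_eq et dt).
by [].
Qed.

Definition boundary_edges c : seq (kcell 1) := projT1 (cid (boundary_edges_ex c)).

Lemma boundary_edges_uniq c : dim c = 2%N -> uniq (boundary_edges c).
Proof. by move=> c2; have [] := projT2 (cid (boundary_edges_ex c)) c2. Qed.

Lemma mem_boundary_edges c t e : dim c = 2%N -> open_cell X (kval e) (loop c t) ->
  e \in boundary_edges c.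
Proof. by move=> c2; have [_] := projT2 (cid (boundary_edges_ex c)) c2; exact. Qed.

Definition D1 := basis_ext (fun e : kcell 1 =>
  << endpt e true >> - << endpt e false >> : {freeg (kcell 0) / rat}).
Definition D2 := basis_ext (fun c : kcell 2 =>
  \sum_(e <- boundary_edges (kval c)) (incidence (kval c) (kval e))%:~R *: << e >>
  : {freeg (kcell 1) / rat}).
HB.instance Definition _ := GRing.Linear.on D1.
HB.instance Definition _ := GRing.Linear.on D2.

Lemma D1E e : D1 << e >> = << endpt e true >> - << endpt e false >>.
Proof. exact: basis_extE. Qed.

Definition pair1 (phi : cell X -> int) := pairing (fun e : kcell 1 => (phi (kval e))%:~R).
Definition pair0 (psi : T -> int) := pairing (fun v : kcell 0 => (psi (vpt v))%:~R).
HB.instance Definition _ phi := GRing.Linear.on (pair1 phi).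
HB.instance Definition _ psi := GRing.Linear.on (pair0 psi).

Definition coboundary (psi : T -> int) (e : cell X) : int := psi (edge_pt e 1) - psi (edge_pt e (-1)).

Lemma pair_coboundary psi z : pair1 (coboundary psi) z = pair0 psi (D1 z).
Proof.
move: z; apply: (@linear_eq_basis _ rat^o (pair1 (coboundary psi)) (pair0 psi \o D1)) => e /=.
rewrite D1E linearB /= /pair1 /pair0 !pairingE /coboundary !endptE /side.
by rewrite rmorphB.
Qed.

Lemma edge_angle_sum (phi : cell X -> int) c t : dim c = 2%N -> edge_angle phi (loop c t) =
  \sum_(e <- boundary_edges c) (phi (kval e))%:~R * edge_angle (edge_ind (kval e)) (loop c t).
Proof.
move=> c2; have [d [u uo du]] := in_open_cell X (loop c t).
have dd : (dim d < 2)%N.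
  rewrite -c2; apply: (@boundary_dim _ _ X c (circ (dim c) t)); first exact: circ_sphere.
  by exists u.
rewrite -du /edge_angle.
have [d1|d1] := eqVneq (dim d) 1%N; last first.
  rewrite glueE// ifN// big1// => e _; rewrite glueE// ifN// mulr0//.
have [e ed] := kval_ex d1.
have es : e \in boundary_edges c by apply: (@mem_boundary_edges c t) => //; rewrite ed; exists u.
rewrite (bigD1_seq e)//= ?boundary_edges_uniq//.
rewrite big1 ?addr0 => [|e' e'e].
  by rewrite !glueE// !ifT ?d1// /edge_ind asboolT// ed mul1r.
rewrite glueE// ifT ?d1// /edge_ind asboolF ?mul0r ?mulr0// => de.
by case/eqP: e'e; apply: kval_inj; rewrite ed.
Qed.

(** Along the loop the angle of [phi] is a finite combination of the angles of single edges, whose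
    windings are the incidence numbers. All statements on [D2] are reached through this duality
    between cochains and windings. *)
Lemma winding_boundary (phi : cell X -> int) (c : kcell 2) :
  winding (edge_angle phi \o loop (kval c)) = ratr (pair1 phi (D2 << c >>)).
Proof.
have c2 := dim_kval c.
transitivity (winding (fun t => \sum_(e <- boundary_edges (kval c)) (phi (kval e))%:~R *
    (edge_angle (edge_ind (kval e)) \o loop (kval c)) t)).
  by congr winding; apply/funext => t; exact: edge_angle_sum.
rewrite (@winding_sum R (kcell 1) _ (fun e => phi (kval e))); last first.
  by move=> e; exact: edge_angle_loop.
rewrite /D2 basis_extE linear_sum rmorph_sum; apply: eq_bigr => e _ /=.
rewrite linearZ /= /pair1 pairingE -incidenceE//.
by rewrite [_ *: _]mulrC rmorphM /= !ratr_int.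
Qed.

Lemma pair0_eq0 y : (forall psi, pair0 psi y = 0) -> y = 0.
Proof.
move=> h; apply/eqP/freeg_eqP => v; rewrite coeff0 -pairing_coeff.
rewrite -[RHS](h (fun x => (`[< x = vpt v >] : nat)%:Z)) /pair0; congr pairing.
apply/funext => w; case: eqP => [->|wv]; first by rewrite asboolT.
by rewrite asboolF// => /vpt_inj.
Qed.

Lemma D1_D2 y : D1 (D2 y) = 0.
Proof.
rewrite -[LHS]/((D1 \o D2) y) linear_basisE big1// => c _ /=.
suff -> : D1 (D2 << c >>) = 0 by rewrite scaler0.
apply: pair0_eq0 => psi; rewrite -pair_coboundary; apply: (@ratr_inj_eq R).
rewrite -winding_boundary rmorph0; have c2 := dim_kval c.
have [F [fF F1 FP]] := loop_closed_cells c2.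
(* The zero function, lifted at the vertices by the integers [- psi], has [coboundary psi] as its
   edge cochain; so the latter has winding zero along the loop. *)
rewrite -(@graph_winding _ _ X F (fun=> 0) (fun x => - (psi x)%:~R) (fun _ _ => 0) (coboundary psi) (loop (kval c)) fF F1).
- exact: winding_cst.
- move=> d Fd d1; split; first by split=> [|u _]; [exact: within_cst|rewrite subrr rpred0].
  by rewrite /coboundary rmorphB /=; ring.
- by move=> v v0; rewrite opprK add0r intr_int.
- exact: loop_cont.
- exact: loop_closed.
- by move=> t _; exact: FP.
Qed.

End Chains.

(** * Exactness *)

Section Exactness.
Import multinomials.freeg.
Variables (R : realType) (T : topologicalType) (X : cw_complex R T).
Local Notation chi := (char_map X).
Local Notation ball_of c := (cball R (dim (c : cell X))).
Local Notation I01 := (`[(0 : R), 1]%classic).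
Implicit Types c d : cell X.
Hypotheses (lfX : cw_locally_finite X) (dim2 : forall c, (dim c <= 2)%N).
Variables (H : T * R -> T) (x0 : T).
Hypotheses (Hc : {within [set: T] `*` I01, continuous H})
  (H0 : forall x, H (x, 0) = x) (H1 : forall x, H (x, 1) = x0).

(** The track of [K] under the contraction is compact, hence lies in finitely many cells; on these
    the continuity of glued functions can be controlled. *)
Lemma track_cells (K : set T) : compact K -> exists F : set (cell X), [/\ finite_set F,
  {within K `*` I01, continuous H},
  (forall x t, K x -> 0 <= t <= 1 -> (\bigcup_(c in F) open_cell X c) (H (x, t))) &
  (\bigcup_(c in F) open_cell X c) x0].
Proof.
move=> cK; have cKH : {within K `*` I01, continuous H}.
  by apply: continuous_subspaceW Hc => -[x t] [].
have cI : compact (H @` (K `*` I01)).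
  by apply: continuous_compact => //; apply: compact_setX => //; exact: segment_compact.
have [F fF FP] := compact_finite_cells lfX cI.
have [c cx0] := in_open_cell X x0.
exists (F `|` [set c]); split=> //; first by rewrite finite_setU; split=> //; exact: finite_set1.
  move=> x t Kx t01; have [|d Fd dx] := FP (H (x, t)); last by exists d => //; left.
  by exists (x, t).
by exists c => //; right.
Qed.

Lemma closed_bigcup_cells (F : set (cell X)) :
  \bigcup_(c in F) open_cell X c `<=` \bigcup_(c in F) closed_cell c.
Proof. by move=> x [c Fc cx]; exists c => //; exact: open_closed_cell. Qed.

Lemma finite_cells_compact (F : set (cell X)) : finite_set F ->
  compact (\bigcup_(c in F) closed_cell c).
Proof.
move=> /(@finite_seqP {classic cell X})[s ->]; elim: s => [|c s IH].
  by rewrite (_ : \bigcup_(c in _) _ = set0); [exact: compact0|apply/seteqP; split=> x // []].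
rewrite (_ : \bigcup_(c in _) _ = closed_cell c `|` \bigcup_(c in [set` s]) closed_cell c).
  by apply: compactU => //; exact: closed_cell_compact.
apply/seteqP; split=> x.
  move=> [d]; rewrite /= inE => /orP[/eqP ->|ds dx]; first by left.
  by right; exists d.
by move=> [cx|[d ds dx]]; [exists c|exists d] => //=; rewrite inE ?eqxx//; apply/orP; right.
Qed.

(** The contraction joins every point to [x0] by a path through finitely many cells, along which [g]
    is continuous and integer valued. *)
Lemma constant_on_cells (g : T -> R) : (forall x, g x \is a Num.int) ->
  (forall c u v, ball_of c u -> ball_of c v -> g (chi c u) = g (chi c v)) ->
  forall x y, g x = g y.
Proof.
move=> gi gc; suff gx0 x : g x = g x0 by move=> x y; rewrite !gx0.
have [F [fF cH FP _]] := track_cells (@compact_set1 _ x).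
have cg : {within \bigcup_(c in F) closed_cell c, continuous g}.
  apply: cells_glue => // c _; apply: (@within_congr _ R _ (fun=> g (chi c 0))); last exact: within_cst.
  by move=> u uB /=; apply: gc => //; rewrite /cball /= big1 ?ler01// => i _; rewrite mxE expr0n.
rewrite -{1}(H0 x) -(H1 x).
apply: (@integer_valued_constant R 0 1 (fun t => g (H (x, t)))) => //.
apply: (@within_comp R T R _ (\bigcup_(c in F) closed_cell c) (fun t => H (x, t)) g) => //.
  apply: (@within_comp R (T * R)%type T _ ([set x] `*` I01) (fun t => (x, t)) H) => //.
  apply: continuous_subspaceT => t.
  exact: (cvg_pair (@cvg_cst _ x _ (nbhs t) _) (@cvg_id _ (nbhs t))).
move=> t; rewrite /= in_itv/= => t01; apply: closed_bigcup_cells; exact: FP.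
Qed.

Local Notation e0 := (basis_ext (fun _ : kcell X 0 => 1 : rat^o)).

Lemma e0_D1 z : e0 (D1 z) = 0.
Proof.
rewrite -[LHS]/((e0 \o @D1 R T X) z) linear_basisE big1// => e _ /=.
by rewrite D1E linearB /= !basis_extE subrr scaler0.
Qed.

(** The indicator of the vertices homologous to [w] takes the same value at both ends of an edge. It
    extends over the edges as [N1], and over each 2-cell as [N] by its value at one point of the
    attaching loop, along which [N1] is constant. The result is constant on closed cells, hence
    constant. *)
Lemma vertex_boundary (v w : kcell X 0) : exists z, D1 z = << v >> - << w >>.
Proof.
pose ind (x : T) : R := (`[< exists u : kcell X 0, vpt u = x /\ exists z, D1 z = << u >> - << w >> >])%:R.
have indV (u : kcell X 0) : ind (vpt u) = (`[< exists z, D1 z = << u >> - << w >> >])%:R.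
  rewrite /ind; congr ((nat_of_bool _)%:R); apply/asboolP/asboolP => [[u' [/vpt_inj ->]]|]//.
  by exists u.
have ind_edge (e : kcell X 1) : ind (edge_pt (kval e) 1) = ind (edge_pt (kval e) (-1)).
  rewrite -[1]/(side R true) -[-1]/(side R false) -!endptE !indV.
  have De := D1E e; congr ((nat_of_bool _)%:R); apply/asboolP/asboolP => -[z zE].
    by exists (z - << e >>); rewrite linearB /= zE De opprB addrC subrKA.
  by exists (z + << e >>); rewrite linearD /= zE De addrC subrKA.
have ind_int x : ind x \is a Num.int by rewrite natr_int.
pose N1 := glue (fun c u => if dim c == 1%N then ind (edge_pt c 1) else ind (chi c 0)).
have N1V c u : dim c = 0%N -> N1 (chi c u) = ind (chi c u).
  move=> c0; rewrite /N1 (cball0 u 0 c0) glueE; last exact: oball_dim0.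
  by rewrite ifN// c0.
have N1E c u : dim c = 1%N -> ball_of c u -> N1 (chi c u) = ind (edge_pt c 1).
  move=> c1; have [e ec] := kval_ex c1; move=> /cball_split[uo|/(sphere1 c1)].
    by rewrite /N1 glueE// ifT// c1.
  have [v1 v10 v1E] := edge_pt_vertex true c1; have [v2 v20 v2E] := edge_pt_vertex false c1.
  case=> ->; first by rewrite -[chi c _]v1E N1V// v1E.
  by rewrite -[chi c _]v2E N1V// v2E -ec ind_edge.
have N1_int x : N1 x \is a Num.int.
  have [c [u uo <-]] := in_open_cell X x; rewrite /N1 glueE//.
  by case: ifP.
pose N := glue (fun c u => if dim c == 2%N then N1 (loop c 0) else N1 (chi c u)).
have N_N1 c u : (dim c <= 1)%N -> ball_of c u -> N (chi c u) = N1 (chi c u).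
  move=> c1 uB; have [d [p po dp]] := in_open_cell X (chi c u).
  have [dc|dc] := closed_cellP (ex_intro2 _ _ u uB erefl) (ex_intro2 _ _ p po dp).
    by rewrite -dp /N glueE// ifN// dc; case: (dim c) c1 => // -[].
  by rewrite -dp /N glueE// ifN//; move: dc c1; case: (dim c) => // -[]// ; case: (dim d).
have N2 c u : dim c = 2%N -> ball_of c u -> N (chi c u) = N1 (loop c 0).
  move=> c2 /cball_split[uo|us]; first by rewrite /N glueE// ifT// c2.
  have [t t01 tu] := circ_surj c2 us; rewrite -tu -[chi c _]/(loop c t).
  have [F [fF F1 FP]] := loop_closed_cells c2.
  have cN1 : {within \bigcup_(d in F) closed_cell d, continuous N1}.
    apply: cells_glue => // d /F1; rewrite leq_eqVlt ltnS leqn0 => /orP[/eqP d1|/eqP d0].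
      apply: (@within_congr _ R _ (fun=> ind (edge_pt d 1))); last exact: within_cst.
      by move=> w' wB; rewrite /= N1E.
    exact: within_dim0.
  have -> : N (loop c t) = N1 (loop c t).
    have [d Fd [w' wB we]] := FP t; rewrite -we; apply: N_N1 => //; exact: F1.
  move/andP: t01 => [t0 t1]; apply/esym.
  apply: (@integer_valued_constant R 0 t (fun s => N1 (loop c s))) => //.
  apply: (@within_comp R T R _ (\bigcup_(d in F) closed_cell d) (loop c) N1) => //.
  exact: loop_cont.
have NE : N (vpt v) = N (vpt w).
  apply: constant_on_cells.
    move=> x; have [c [u uo <-]] := in_open_cell X x; rewrite /N glueE//.
    by case: ifP.
  move=> c u u' uB uB'; have := dim2 c; rewrite leq_eqVlt ltnS => /orP[/eqP c2|c1].
    by rewrite !N2.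
  rewrite !N_N1//; move: c1; rewrite leq_eqVlt ltnS leqn0 => /orP[/eqP d1|/eqP d0].
    by rewrite !N1E.
  by rewrite (cball0 u u' d0).
have NV (u : kcell X 0) : N (vpt u) = ind (vpt u).
  have u0 := dim_kval u; have uB : ball_of (kval u) 0 by exact/oball_cball/oball_dim0.
  by rewrite /vpt (N_N1 _ _ _ uB) ?N1V// u0.
move: NE; rewrite !NV !indV.
have -> : `[< exists z, D1 z = << w >> - << w >> :> {freeg (kcell X 0) / rat} >] = true.
  by apply/asboolP; exists 0; rewrite linear0 subrr.
by case: asboolP => // _ /eqP; rewrite eq_sym oner_eq0.
Qed.

Lemma exact_D1 (w : kcell X 0) y : e0 y = 0 -> exists z, D1 z = y.
Proof.
move=> y0; have [z zE] := choice (fun v => vertex_boundary v w).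
exists (basis_ext z y); rewrite -[LHS]/((@D1 R T X \o basis_ext z) y) linear_basisE.
transitivity (\sum_(v <- dom y) coeff v y *: (<< v >> - << w >> : {freeg (kcell X 0) / rat})).
  by apply: eq_bigr => v _ /=; rewrite basis_extE zE.
under eq_bigr do rewrite scalerBr.
rewrite sumrB -freeg_basisE -scaler_suml; have -> : \sum_(v <- dom y) coeff v y = 0.
  by rewrite -[RHS]y0 /basis_ext; apply: eq_bigr => v _; rewrite [_ *: _]mulr1.
by rewrite scale0r subr0.
Qed.

End Exactness.

Section Exactness.
Import multinomials.freeg.
Variables (R : realType) (T : topologicalType) (X : cw_complex R T).
Local Notation chi := (char_map X).
Local Notation ball_of c := (cball R (dim (c : cell X))).
Local Notation I01 := (`[(0 : R), 1]%classic).
Implicit Types c d : cell X.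
Hypotheses (lfX : cw_locally_finite X) (dim2 : forall c, (dim c <= 2)%N).
Variables (H : T * R -> T) (x0 : T).
Hypotheses (Hc : {within [set: T] `*` I01, continuous H})
  (H0 : forall x, H (x, 0) = x) (H1 : forall x, H (x, 1) = x0).

Lemma finite_kcells k (F : set (cell X)) : finite_set F ->
  exists s : seq (kcell X k), forall e, (e \in s) <-> F (kval e).
Proof.
move=> fF; have fG : finite_set [set e : kcell X k | F (kval e)].
  apply: (@finite_preimage _ _ F (@kval _ _ X k)) => //.
  by move=> e e' _ _; exact: kval_inj.
have [s sE] := (finite_seqP _).1 fG; exists s => e.
by rewrite -[F _]/([set e : kcell X k | F (kval e)] e) sE.
Qed.

Lemma kval_cochain (f : {freeg (kcell X 1) / rat}) : integral_chain f ->
  exists phi : cell X -> int, forall e, (phi (kval e))%:~R = coeff e f.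
Proof.
move=> fi; exists (fun d => xget 0 [set k : int | exists e, kval e = d /\ k%:~R = coeff e f]).
move=> e; case: xgetP => [k _ [e' [/kval_inj -> //]]|].
have /intrP[k kE] := fi e; move=> /(_ k); case; by exists e.
Qed.

(* If a cochain [phi] vanishes on the boundaries of the 2-cells of a finite subcomplex, then
   [edge_angle phi] extends over these cells as a circle-valued function, which the
   contraction lifts to [R]; so [phi] is a coboundary and vanishes on the cycle [z]. *)
Lemma exact_D2 (z : {freeg (kcell X 1) / rat}) : D1 z = 0 -> exists w, D2 w = z.
Proof.
move=> z0; apply: contrapT => nz.
pose KF := [set kval e | e in [set` dom z]].
have fKF : finite_set KF by apply: finite_image; exact: finite_seq.
set K := \bigcup_(c in KF) closed_cell c.
have cK : compact K by exact: finite_cells_compact.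
have [F [fF cH FP Fx0]] := track_cells lfX x0 Hc cK.
have [s sE] := finite_kcells 2 fF.
(* The cochain is only required to vanish on the boundaries of the finitely many 2-cells that the
   track of the contraction meets. *)
have [||_ /mapP[b _ ->]||f [fi fw fz]] := @separation _ (range (@D2 R T X)) [seq D2 << b >> | b <- s] z.
- by exists 0 => //; rewrite linear0.
- by move=> k _ _ [x _ <-] [y _ <-]; exists (k *: x + y) => //; rewrite linearP.
- by exists << b >>.
- by move=> [w _ wz]; apply: nz; exists w.
have [phi phiE] := kval_cochain fi.
have phi_pair x : pair1 phi x = pairing (fun e => coeff e f) x.
  by rewrite /pair1; congr pairing; apply/funext.
have LamEx c : exists Lam : 'rV[R]_(dim c) -> R, dim c = 2%N -> F c ->
    continuous Lam /\ forall u, sphere R (dim c) u -> edge_angle phi (chi c u) - Lam u \is a Num.int.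
  have [[c2 Fc]|nc] := pselect (dim c = 2%N /\ F c); last by exists (fun=> 0) => c2 Fc; case: nc.
  have [|Lam cL LE] := @disc_extension R (dim c) (edge_angle phi \o chi c) c2 (edge_angle_loop phi c2).
    have [e ec] := kval_ex c2; rewrite -[LHS]/(winding (edge_angle phi \o loop c)) -ec winding_boundary.
    rewrite phi_pair fw ?rmorph0//; apply/mapP; exists e => //; apply/sE.
    by rewrite ec.
  by exists Lam.
pose Lam c := projT1 (cid (LamEx c)).
have LamP c : dim c = 2%N -> F c -> continuous (Lam c) /\
    forall u, sphere R (dim c) u -> edge_angle phi (chi c u) - Lam c u \is a Num.int.
  exact: (projT2 (cid (LamEx c))).
pose alpha := glue (fun c u => if `[< dim c = 2%N /\ F c >] then Lam c u else
  if dim c == 1%N then (phi c)%:~R * ((crd u 0 + 1) / 2) else 0).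
have low x d : open_cell X d x -> (dim d <= 1)%N -> alpha x = edge_angle phi x.
  move=> [u uo <-] d1; rewrite /alpha /edge_angle !glueE// asboolF// => -[d2].
  by rewrite d2 in d1.
have low_ball c u : (dim c <= 1)%N -> ball_of c u -> alpha (chi c u) = edge_angle phi (chi c u).
  move=> c1 uB; have [d du] := in_open_cell X (chi c u).
  apply: (low _ d) => //; have [->//|dc] := closed_cellP (ex_intro2 _ _ u uB erefl) du.
  by apply: leq_trans c1; exact: ltnW.
have ca : circ_continuous (\bigcup_(c in F) closed_cell c) alpha.
  apply: cells_circ => // c Fc; have := dim2 c; rewrite leq_eqVlt ltnS => /orP[/eqP c2|c1].
    have [cL LE] := LamP c c2 Fc; apply: (@circ_continuous_lift R _ _ _ (Lam c)); split.
      exact: continuous_subspaceT.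
    move=> u /cball_split[uo|us] /=.
      by rewrite /alpha glueE// asboolT// subrr rpred0.
    have [d du] := in_open_cell X (chi c u); have := boundary_dim us du.
    by rewrite c2 ltnS => /(low _ _ du) ->; exact: LE.
  apply: circ_continuous_congr (edge_angle_circ_cell phi c1) => u uB /=.
  by rewrite low_ball// subrr rpred0.
have [||lam [cl lamE]] := @homotopy_lift R T T K (\bigcup_(c in F) closed_cell c) H alpha cK cH _ ca.
- by move=> x t Kx t01; apply: closed_bigcup_cells; exact: FP.
- exists (fun=> alpha x0); split; first exact: within_cst.
  by move=> x Kx; rewrite H1 subrr rpred0.
have Kedge e t : e \in dom z -> -1 <= t <= 1 -> K (edge_pt (kval e) t).
  move=> ez t1; exists (kval e); first by exists e.
  by exists (row_cst _ t) => //; apply: row_cst_cball; rewrite ?dim_kval.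
have phi_lam e : e \in dom z ->
    (phi (kval e))%:~R = lam (edge_pt (kval e) 1) - lam (edge_pt (kval e) (-1)).
  move=> ez; have e1 := dim_kval e.
  have : lam (edge_pt (kval e) (-1)) - (phi (kval e))%:~R * ((-1 + 1) / 2) =
     lam (edge_pt (kval e) 1) - (phi (kval e))%:~R * ((1 + 1) / 2).
    apply: (@integer_valued_constant R (-1) 1 (fun t => lam (edge_pt (kval e) t) - (phi (kval e))%:~R * ((t + 1) / 2))).
    - by lra.
    - apply: withinB.
        apply: (@within_comp R T R _ K (edge_pt (kval e)) lam) => //; first exact: edge_pt_cont.
        by move=> t; rewrite /= in_itv/=; exact: Kedge.
      apply: withinM; first exact: within_cst.
      apply: withinM; last exact: within_cst.
      by apply: withinD; [exact: within_id|exact: within_cst].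
    - move=> t t1; have rB := row_cst_cball e1 t1.
      have := rpredB (edge_angle_edge phi e1 rB) (lamE _ (Kedge e t ez t1)).
      rewrite H0 crd_row ?e1// -[chi _ _]/(edge_pt (kval e) t) low_ball// ?e1//.
      set a := edge_angle _ _; set b := lam _; set k := _ * _.
      by have -> : a - k - (a - b) = b - k by ring.
  by move=> h; lra.
have lam_int e b : e \in dom z -> lam (edge_pt (kval e) (side R b)) \is a Num.int.
  move=> ez; have := lamE (edge_pt (kval e) (side R b)) _; rewrite H0.
  rewrite low_ball ?dim_kval//; last by apply: sphere_cball; exact: (@row_cst_sphere R 1 b erefl).
  have [v v0 vE] := edge_pt_vertex b (dim_kval e).
  rewrite -[chi _ _]/(edge_pt (kval e) (side R b)) -[X in edge_angle phi X]vE edge_angle_vertex//.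
  rewrite sub0r rpredN; apply; apply: Kedge => //.
  by rewrite /side; case: b {v0 vE}; lra.
case/eqP: fz; rewrite -phi_pair.
(* At the ends of the edges of [z] the lift [lam] is already integral, so its floor changes nothing
   there. *)
transitivity (pair1 (@coboundary R T X (fun x => Num.floor (lam x))) z); last first.
  by rewrite pair_coboundary z0 linear0.
rewrite /pair1 !pairing_sum big_seq [RHS]big_seq; apply: eq_bigr => e ez; congr (_ * _%:~R).
apply/eqP; rewrite -(eqr_int R) phi_lam// /coboundary rmorphB /=.
by rewrite (floorK (lam_int e true ez)) (floorK (lam_int e false ez)).
Qed.

End Exactness.

Section HopfDisc.
Variable R : realType.

Lemma hopf_unit (a b c d p1 p2 p3 : R) : hopf a b c d p1 p2 p3 ->
  p1 ^+ 2 + p2 ^+ 2 + p3 ^+ 2 = 1.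
Proof.
rewrite /hopf; set N := _ + _ + _ + _ => -[N0 S1 S2 S3].
have N20 : N ^+ 2 != 0 by rewrite sqrf_eq0 gt_eqF.
apply: (mulfI N20); rewrite mulr1 !mulrDr -!exprMn -S1 -S2 -S3 /N; ring.
Qed.

(** The expression is the squared modulus of the hermitian product of two vectors of C^2. Twice it
    equals the product of the squared norms times 1 plus the scalar product of the two points of the
    sphere, and here these points coincide. *)
Lemma hopf_inner (a b c d a' b' c' d' p1 p2 p3 : R) : hopf a b c d p1 p2 p3 ->
  hopf a' b' c' d' p1 p2 p3 ->
  0 < (a * a' + b * b' + c * c' + d * d') ^+ 2 + (a * b' - b * a' + c * d' - d * c') ^+ 2.
Proof.
move=> h; have p_1 := hopf_unit h; move: h; rewrite /hopf.
set N := a ^+ 2 + b ^+ 2 + c ^+ 2 + d ^+ 2 => -[N0 S1 S2 S3].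
set N' := a' ^+ 2 + b' ^+ 2 + c' ^+ 2 + d' ^+ 2 => -[N0' S1' S2' S3'].
set L := _ + _ ^+ 2.
have -> : L = N * N'; last exact: mulr_gt0.
have E : 2 * L = N * N' + (2 * (a * c + b * d)) * (2 * (a' * c' + b' * d')) +
    (2 * (a * d - b * c)) * (2 * (a' * d' - b' * c')) +
    (a ^+ 2 + b ^+ 2 - c ^+ 2 - d ^+ 2) * (a' ^+ 2 + b' ^+ 2 - c' ^+ 2 - d' ^+ 2).
  by rewrite /L /N /N'; ring.
have {}E : 2 * L = N * N' * (1 + (p1 ^+ 2 + p2 ^+ 2 + p3 ^+ 2)).
  by rewrite E S1 S2 S3 S1' S2' S3'; ring.
rewrite p_1 in E; lra.
Qed.

Lemma hopf_pole (a b c d : R) : hopf a b c d 0 0 1 -> [/\ c = 0, d = 0 & 0 < a ^+ 2 + b ^+ 2].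
Proof.
move=> [N0 _ _ S3]; have c0 := sqr_ge0 c; have d0 := sqr_ge0 d.
have c2 : c ^+ 2 = 0 by lra.
have d2 : d ^+ 2 = 0 by lra.
split; [by apply/eqP; rewrite -sqrf_eq0 c2|by apply/eqP; rewrite -sqrf_eq0 d2|lra].
Qed.

(* The disc collapsed onto the sphere: its point [(x, y)] goes to the line spanned by
   [(x + iy, 1 - x^2 - y^2)], so that the boundary circle goes to the pole [(0, 0, 1)]. *)
Definition disc_s (x y : R) : R := 1 - x ^+ 2 - y ^+ 2.
Definition disc_N (x y : R) : R := x ^+ 2 + y ^+ 2 + disc_s x y ^+ 2.
Definition disc_p1 x y : R := 2 * (x * disc_s x y) / disc_N x y.
Definition disc_p2 x y : R := - (2 * (y * disc_s x y)) / disc_N x y.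
Definition disc_p3 x y : R := (x ^+ 2 + y ^+ 2 - disc_s x y ^+ 2) / disc_N x y.

Lemma disc_N_gt0 x y : 0 < disc_N x y.
Proof.
rewrite /disc_N; have := sqr_ge0 (disc_s x y); have := sqr_ge0 x; have := sqr_ge0 y.
move=> y0 x0' s0; rewrite lt_def; apply/andP; split; last by lra.
apply/eqP => e; have s2 : disc_s x y ^+ 2 = 0 by lra.
have : disc_s x y = 0 by apply/eqP; rewrite -sqrf_eq0 s2.
by rewrite /disc_s; lra.
Qed.

Lemma hopf_disc x y : hopf x y (disc_s x y) 0 (disc_p1 x y) (disc_p2 x y) (disc_p3 x y).
Proof.
have N0 := disc_N_gt0 x y; have N1 : disc_N x y != 0 by rewrite gt_eqF.
have NE : x ^+ 2 + y ^+ 2 + disc_s x y ^+ 2 + 0 ^+ 2 = disc_N x y.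
  by rewrite /disc_N expr0n addr0.
rewrite /hopf NE /disc_p1 /disc_p2 /disc_p3; split=> //.
- by rewrite [RHS]mulrC divfK// mulr0 addr0.
- by rewrite [RHS]mulrC divfK// mulr0 sub0r mulrN.
- by rewrite [RHS]mulrC divfK// expr0n subr0.
Qed.

Lemma disc_boundary x y : x ^+ 2 + y ^+ 2 = 1 ->
  [/\ disc_s x y = 0, disc_p1 x y = 0, disc_p2 x y = 0 & disc_p3 x y = 1].
Proof.
move=> e; have s0 : disc_s x y = 0 by rewrite /disc_s; lra.
by rewrite /disc_p1 /disc_p2 /disc_p3 /disc_N s0 !mulr0 oppr0 !mul0r e expr0n /= subr0 addr0 divr1.
Qed.

Section Cont.
Variables (U : topologicalType) (K : set U) (x y : U -> R).
Hypotheses (cx : {within K, continuous x}) (cy : {within K, continuous y}).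

Lemma disc_s_cont : {within K, continuous (fun u => disc_s (x u) (y u))}.
Proof.
apply: (@within_congr _ _ _ (fun u => 1 - x u * x u - y u * y u)); first by move=> u _; rewrite /disc_s !expr2.
by apply: withinB; [apply: withinB; [exact: within_cst|]|]; exact: withinM.
Qed.

Lemma disc_NV_cont : {within K, continuous (fun u => (disc_N (x u) (y u))^-1)}.
Proof.
apply: withinV; first by move=> u _; rewrite gt_eqF// disc_N_gt0.
apply: (@within_congr _ _ _ (fun u => x u * x u + y u * y u + disc_s (x u) (y u) * disc_s (x u) (y u))).
  by move=> u _; rewrite /disc_N !expr2.
have cs := disc_s_cont.
by apply: withinD; [apply: withinD|]; exact: withinM.
Qed.

Lemma disc_p_cont : [/\ {within K, continuous (fun u => disc_p1 (x u) (y u))},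
  {within K, continuous (fun u => disc_p2 (x u) (y u))} &
  {within K, continuous (fun u => disc_p3 (x u) (y u))}].
Proof.
have cs := disc_s_cont; have cN := disc_NV_cont; split.
- by apply: withinM => //; apply: withinM; [exact: within_cst|exact: withinM].
- apply: withinM => //; apply: withinN; apply: withinM; [exact: within_cst|exact: withinM].
- apply: withinM => //.
  apply: (@within_congr _ _ _ (fun u => x u * x u + y u * y u - disc_s (x u) (y u) * disc_s (x u) (y u))).
    by move=> u _; rewrite !expr2.
  by apply: withinB; [apply: withinD|]; exact: withinM.
Qed.

End Cont.
End HopfDisc.

Section Injectivity.
Import multinomials.freeg.
Variables (R : realType) (T : topologicalType) (X : cw_complex R T).
Local Notation chi := (char_map X).
Local Notation ball_of c := (cball R (dim (c : cell X))).
Local Notation I01 := (`[(0 : R), 1]%classic).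
Implicit Types d : cell X.
Hypotheses (lfX : cw_locally_finite X) (dim2 : forall d, (dim d <= 2)%N).
Variables (H : T * R -> T) (x0 : T).
Hypotheses (Hc : {within [set: T] `*` I01, continuous H})
  (H0 : forall x, H (x, 0) = x) (H1 : forall x, H (x, 1) = x0).

Lemma winding_lift_ball d (alpha : T -> R) (Lam : 'rV[R]_(dim d) -> R) : dim d = 2%N ->
  is_lift (ball_of d) (alpha \o chi d) Lam -> winding (alpha \o loop d) = 0.
Proof.
move=> d2 [cL LE]; rewrite (@windingE R _ (Lam \o circ (dim d))).
  rewrite /=; have -> : circ (dim d) 0 = circ (dim d) 1 :> 'rV[R]_(dim d); last by rewrite subrr.
  by apply: circ_periodic; rewrite sub0r rpredN rpred1.
split.
  apply: (@within_comp R 'rV[R]_(dim d) R _ (ball_of d) (@circ R (dim d)) Lam) => //.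
    exact: circ_cont.
  by move=> t _; apply/sphere_cball/circ_sphere.
by move=> t _; apply: LE; apply/sphere_cball/circ_sphere.
Qed.

(* Collapsing the complement of a 2-cell [c] of the cycle [y] gives a map to the sphere, which
   the contraction lifts through the Hopf fibration.  The argument of one coordinate of the
   lift has winding number one along the boundary of [c] and zero along the other 2-cells,
   so it defines a cochain that does not vanish on [D2 y]. *)
Lemma D2_inj (y : {freeg (kcell X 2) / rat}) : D2 y = 0 -> y = 0.
Proof.
move=> y0; apply/eqP/freeg_eqP => c0; rewrite coeff0; apply/eqP/negPn/negP.
rewrite -mem_dom => c0y; set c := kval c0; have c2 : dim c = 2%N := dim_kval c0.
have [Fb FbP] := choice (fun e : kcell X 2 => loop_closed_cells (dim_kval e)).
(* The cells that cover the attaching loops enter [KF] one by one, because [alpha] needs a lift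
   along each of them. *)
pose Fg := \bigcup_(e in [set` dom y]) Fb e.
have fFg : finite_set Fg.
  by apply: bigcup_finite; [exact: finite_seq|move=> e _; case: (FbP e)].
have Fg1 d : Fg d -> (dim d <= 1)%N by move=> [e _]; case: (FbP e) => _ + _; exact.
pose KF := [set kval e | e in [set` dom y]] `|` Fg.
have fKF : finite_set KF.
  by rewrite finite_setU; split=> //; apply: finite_image; exact: finite_seq.
set K := \bigcup_(d in KF) closed_cell d.
have cK : compact K by exact: finite_cells_compact.
have [F [fF cH FP Fx0]] := track_cells lfX x0 Hc cK.
(* A coordinate of the collapse: [p] inside [c] and the constant [q] elsewhere, which match when [p]
   equals [q] on the boundary circle. *)
pose pg (p : R -> R -> R) (q : R) :=
  glue (fun d u => if `[< d = c >] then p (crd u 0) (crd u 1) else q).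
have pg_out p q d u : d <> c -> ball_of d u -> pg p q (chi d u) = q.
  move=> dc uB; have [d' [v vo dv]] := in_open_cell X (chi d u).
  rewrite -dv /pg glueE// asboolF// => d'c.
  have [d'd|] := closed_cellP (ex_intro2 _ _ u uB erefl) (ex_intro2 _ _ v vo dv).
    by apply: dc; rewrite -d'd.
  by rewrite d'c c2 ltnNge dim2.
have pg_in p q u : (forall x y, x ^+ 2 + y ^+ 2 = 1 -> p x y = q) -> ball_of c u ->
    pg p q (chi c u) = p (crd u 0) (crd u 1).
  move=> pq /cball_split[uo|us]; first by rewrite /pg glueE// asboolT.
  have [d' [v vo dv]] := in_open_cell X (chi c u).
  rewrite -dv /pg glueE// asboolF; first by rewrite pq// -(sqnorm2 _ c2).
  by move=> d'c; have := boundary_dim us (ex_intro2 _ _ v vo dv); rewrite d'c ltnn.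
have pg_cont p q : (forall x y, x ^+ 2 + y ^+ 2 = 1 -> p x y = q) ->
    (forall K : set 'rV[R]_(dim c), {within K, continuous (fun u => p (crd u 0) (crd u 1))}) ->
    {within \bigcup_(d in F) closed_cell d, continuous (pg p q)}.
  move=> pq cp; apply: cells_glue => // d _; have [dc|dc] := pselect (d = c).
    rewrite dc; apply: (@within_congr _ R _ (fun u => p (crd u 0) (crd u 1))) => // u uB.
    by rewrite /= pg_in.
  apply: (@within_congr _ R _ (fun=> q)); last exact: within_cst.
  by move=> u uB; rewrite /= pg_out.
pose P1 := pg (@disc_p1 R) 0; pose P2 := pg (@disc_p2 R) 0; pose P3 := pg (@disc_p3 R) 1.
have b1 x y' : x ^+ 2 + y' ^+ 2 = 1 -> disc_p1 x y' = 0 :> R by move=> /disc_boundary[].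
have b2 x y' : x ^+ 2 + y' ^+ 2 = 1 -> disc_p2 x y' = 0 :> R by move=> /disc_boundary[].
have b3 x y' : x ^+ 2 + y' ^+ 2 = 1 -> disc_p3 x y' = 1 :> R by move=> /disc_boundary[].
have cd (L : set 'rV[R]_(dim c)) := disc_p_cont (@crd_cont R (dim c) L 0) (@crd_cont R (dim c) L 1).
have cP1 : {within \bigcup_(d in F) closed_cell d, continuous P1}.
  by apply: pg_cont => // L; case: (cd L).
have cP2 : {within \bigcup_(d in F) closed_cell d, continuous P2}.
  by apply: pg_cont => // L; case: (cd L).
have cP3 : {within \bigcup_(d in F) closed_cell d, continuous P3}.
  by apply: pg_cont => // L; case: (cd L).
have P_1 x : (\bigcup_(d in F) closed_cell d) x -> P1 x ^+ 2 + P2 x ^+ 2 + P3 x ^+ 2 = 1.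
  move=> [d _ [u uB <-]]; have [dc|dc] := pselect (d = c).
    move: u uB; rewrite dc => u uB; rewrite /P1 /P2 /P3 !pg_in//.
    exact: hopf_unit (hopf_disc _ _).
  by rewrite /P1 /P2 /P3 !pg_out// !expr0n expr1n !add0r.
have [a [b [z [w [ca cb cz cw vP]]]]] :
    hopf_lift K (fun x => P1 (H (x, 0))) (fun x => P2 (H (x, 0))) (fun x => P3 (H (x, 0))).
  apply: (@hopf_homotopy_lift R T T K (\bigcup_(d in F) closed_cell d) H x0) => //.
    by move=> x t Kx t01; apply: closed_bigcup_cells; exact: FP.
  exact: closed_bigcup_cells.
have {}vP x : K x -> hopf (a x) (b x) (z x) (w x) (P1 x) (P2 x) (P3 x).
  by move=> Kx; have := vP x Kx; rewrite H0.
have KB d u : KF d -> ball_of d u -> K (chi d u) by move=> KFd uB; exists d => //; exists u.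
have cell_cont d (f : T -> R) : KF d -> {within K, continuous f} ->
    {within ball_of d, continuous (f \o chi d)}.
  move=> KFd cf; apply: (@within_comp 'rV[R]_(dim d) T R _ K (chi d) f) => //.
    exact: cw_continuous.
  by move=> u uB; exact: KB.
(* Outside [c] the collapse is at the pole, so the second complex coordinate of the lift vanishes
   and the first does not: its argument is continuous modulo 1 there. *)
pose alpha x := ang (a x) (b x).
have pole d u : KF d -> d <> c -> ball_of d u ->
    [/\ z (chi d u) = 0, w (chi d u) = 0 & 0 < a (chi d u) ^+ 2 + b (chi d u) ^+ 2].
  move=> KFd dc uB; apply: hopf_pole; have := vP _ (KB d u KFd uB).
  by rewrite /P1 /P2 /P3 !pg_out.
have lift_ex d : exists Lam : 'rV[R]_(dim d) -> R, KF d -> d <> c -> is_lift (ball_of d) (alpha \o chi d) Lam.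
  have [[KFd dc]|n] := pselect (KF d /\ d <> c); last by exists (fun=> 0) => KFd dc; case: n.
  have [|Lam L] := @cball_lift R (dim d) (alpha \o chi d); last by exists Lam.
  apply: (@ang_continuous R _ _ (a \o chi d) (b \o chi d)); try exact: cell_cont.
  by move=> u uB; have [] := pole d u KFd dc uB.
pose Lam d := projT1 (cid (lift_ex d)).
have LamP d : KF d -> d <> c -> is_lift (ball_of d) (alpha \o chi d) (Lam d).
  exact: (projT2 (cid (lift_ex d))).
(* The edge cochain of [alpha], with [alpha] itself as its real lift at the vertices. *)
pose phi d := Num.floor (Lam d (row_cst (dim d) 1) - Lam d (row_cst (dim d) (-1)) -
     (alpha (edge_pt d 1) - alpha (edge_pt d (-1)))).
have not_c d : (dim d <= 1)%N -> d <> c by move=> + dc; rewrite dc c2.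
have wE e : e \in dom y -> winding (alpha \o loop (kval e)) = ratr (pair1 phi (D2 << e >>)).
  move=> ey; rewrite -winding_boundary; have [fFe F1e FPe] := FbP e.
  apply: (@graph_winding _ _ X (Fb e) alpha alpha Lam phi (loop (kval e))) => //.
  - move=> d Fd d1; have KFd : KF d by right; exists e.
    have Ld := LamP d KFd (not_c d (F1e d Fd)); split=> //.
    rewrite /phi floorK//.
    have r1 : ball_of d (row_cst (dim d) 1) by exact: (sphere_cball (@row_cst_sphere R _ true d1)).
    have r2 : ball_of d (row_cst (dim d) (-1)) by exact: (sphere_cball (@row_cst_sphere R _ false d1)).
    have := rpredB (Ld.2 _ r2) (Ld.2 _ r1); rewrite /= /edge_pt.
    set p := alpha _; set q := alpha _; set l := Lam _ _; set l' := Lam _ _.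
    by have -> : p - l - (q - l') = l' - l - (q - p) by ring.
  - by move=> v v0; rewrite subrr rpred0.
  - exact/loop_cont/dim_kval.
  - exact: loop_closed.
have w_out e : e \in dom y -> e != c0 -> winding (alpha \o loop (kval e)) = 0.
  move=> ey ec; apply: (@winding_lift_ball _ alpha (Lam (kval e))); first exact: dim_kval.
  by apply: LamP; [left; exists e|move=> /kval_inj e0; rewrite e0 eqxx in ec].
have KFc : KF c by left; exists c0.
have w_c : winding (alpha \o loop c) = 1.
  (* The lift is compared over the disc with the explicit vector of [hopf_disc]. Their hermitian
     product [k1 + i k2] has no zero, so its argument lifts to a real function on the whole disc. On
     the boundary circle the first coordinate of the lift is this product rotated by the parameter
     [t], and this rotation accounts for the winding number 1. *)
  pose k1 (u : 'rV[R]_(dim c)) := crd u 0 * a (chi c u) + crd u 1 * b (chi c u) +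
    disc_s (crd u 0) (crd u 1) * z (chi c u) + 0 * w (chi c u).
  pose k2 (u : 'rV[R]_(dim c)) := crd u 0 * b (chi c u) - crd u 1 * a (chi c u) +
    disc_s (crd u 0) (crd u 1) * w (chi c u) - 0 * z (chi c u).
  have k0 u : ball_of c u -> 0 < k1 u ^+ 2 + k2 u ^+ 2.
    move=> uB; apply: (hopf_inner (hopf_disc (crd u 0) (crd u 1))).
    by have := vP _ (KB c u KFc uB); rewrite /P1 /P2 /P3 !pg_in.
  have c0_ := @crd_cont R (dim c) (ball_of c) 0; have c1_ := @crd_cont R (dim c) (ball_of c) 1.
  have cs_ := disc_s_cont c0_ c1_.
  have ca_ := cell_cont c a KFc ca; have cb_ := cell_cont c b KFc cb.
  have cz_ := cell_cont c z KFc cz; have cw_ := cell_cont c w KFc cw.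
  have [|L [cL LE]] := @cball_lift R (dim c) (fun u => ang (k1 u) (k2 u)).
    apply: ang_continuous => //.
      apply: withinD; last by apply: withinM => //; exact: within_cst.
      by apply: withinD; [apply: withinD|]; exact: withinM.
    apply: withinB; last by apply: withinM => //; exact: within_cst.
    by apply: withinD; [apply: withinB|]; exact: withinM.
  rewrite (@windingE R _ (fun t => L (circ (dim c) t) + t)).
    rewrite /=; have -> : circ (dim c) 0 = circ (dim c) 1 :> 'rV[R]_(dim c); last by ring.
    by apply: circ_periodic; rewrite sub0r rpredN rpred1.
  split.
    apply: withinD; last exact: within_id.
    apply: (@within_comp R 'rV[R]_(dim c) R _ (ball_of c) (@circ R (dim c)) L) => //.
      exact: circ_cont.
    by move=> t _; apply/sphere_cball/circ_sphere.
  move=> t _; set u := circ (dim c) t.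
  have uB : ball_of c u by apply/sphere_cball/circ_sphere.
  have ct := cs2Dsn2 t.
  have [s0 p1 p2 p3] := disc_boundary ct.
  have [z0 w0 ab0] : [/\ z (chi c u) = 0, w (chi c u) = 0 & 0 < a (chi c u) ^+ 2 + b (chi c u) ^+ 2].
    apply: hopf_pole; have := vP _ (KB c u KFc uB).
    by rewrite /P1 /P2 /P3 !pg_in// crd_circ0// crd_circ1// p1 p2 p3.
  have k1E : k1 u = cs t * a (chi c u) + sn t * b (chi c u).
    by rewrite /k1 z0 w0 !mulr0 !addr0 crd_circ0// crd_circ1.
  have k2E : k2 u = cs t * b (chi c u) - sn t * a (chi c u).
    by rewrite /k2 z0 w0 !mulr0 subr0 addr0 crd_circ0// crd_circ1.
  have sn2 : sn t ^+ 2 = 1 - cs t ^+ 2 by rewrite -ct; ring.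
  have h := @ang_rot R (a (chi c u)) (b (chi c u)) (k1 u) (k2 u) t (k0 u uB).
  have {}h : ang (a (chi c u)) (b (chi c u)) - (ang (k1 u) (k2 u) + t) \is a Num.int.
    apply: h; rewrite k1E k2E; ring: sn2.
  have := rpredD h (LE u uB); rewrite -[(alpha \o loop c) t]/(ang (a (chi c u)) (b (chi c u))).
  set p := ang _ _; set q := ang _ _; set l := L _.
  by have -> : p - (q + t) + (q - l) = p - (l + t) by ring.
have : ratr (pair1 phi (D2 y)) = 0 :> R by rewrite y0 linear0 rmorph0.
rewrite -[pair1 _ _]/((pair1 phi \o @D2 R T X) y) linear_basisE rmorph_sum /=.
rewrite (bigD1_seq c0)//= ?uniq_dom// big_seq_cond big1 ?addr0.
  rewrite [_ *: _]/(_ * _) rmorphM /= -wE// w_c mulr1 => /eqP; rewrite fmorph_eq0.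
  by move/eqP => e; move: c0y; rewrite mem_dom e eqxx.
move=> e /andP[ey ec]; rewrite [_ *: _]/(_ * _) rmorphM /= -wE// w_out// mulr0.
by [].
Qed.

End Injectivity.

(** * Automorphisms *)

Section BallTopology.
Variable R : realType.

Lemma oball_scale n (u : 'rV[R]_n) t : cball R n u -> 0 <= t < 1 -> oball R n (t *: u).
Proof.
rewrite /cball /oball /= => uB /andP[t0 t1].
have -> : \sum_i (t *: u) 0 i ^+ 2 = t ^+ 2 * \sum_i u 0 i ^+ 2.
  by rewrite mulr_sumr; apply: eq_bigr => i _; rewrite mxE exprMn.
apply: le_lt_trans (_ : t ^+ 2 * 1 < 1); first by apply: ler_wpM2l => //; exact: sqr_ge0.
by rewrite mulr1 expr2; nra.
Qed.

Lemma oball0 n : oball R n 0.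
Proof. by rewrite /oball /= big1 ?ltr01// => i _; rewrite mxE expr0n. Qed.

Lemma oball_connected n : connected (oball R n).
Proof.
have -> : oball R n = \bigcup_(u in oball R n) ((fun t : R => t *: u) @` `[0, 1]%classic).
  apply/seteqP; split => [u uo|u [v vo [t t01 <-]]].
    by exists u => //; exists 1; rewrite ?scale1r//= in_itv/= lexx ler01.
  move: t01; rewrite /= in_itv/= => /andP[t0]; rewrite le_eqVlt => /orP[/eqP ->|t1].
    by rewrite scale1r.
  by apply: oball_scale; [exact: oball_cball|rewrite t0].
apply: bigcup_connected.
  by exists 0 => u uo; exists 0; rewrite ?scale0r//= in_itv/= lexx ler01.
move=> u uo; apply: connected_continuous_connected; first exact: segment_connected.
by apply: continuous_subspaceT => t; apply: cvgZl; exact: cvg_id.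
Qed.

Lemma cball_closure n : cball R n `<=` closure (oball R n).
Proof.
move=> u uB A nA.
have cs : (fun t : R => t *: u) @ (1 : R) --> u.
  by rewrite -[X in _ --> X]scale1r; apply: cvgZl; exact: cvg_id.
have := cs A nA; rewrite /= nbhs_simpl /= => /nbhs_ballP[e /= e0 eA].
pose t := Num.max 0 (1 - e / 2).
have t01 : 0 <= t < 1 by rewrite le_max lexx /= gt_max ltr01 /=; lra.
exists (t *: u); split; first exact: oball_scale.
apply: eA; rewrite /ball /= ger0_norm ?subr_ge0; last by case/andP: t01 => _ /ltW.
rewrite ltrBlDr -ltrBlDl lt_max; apply/orP; right; lra.
Qed.

(** The one-dimensional Borsuk-Ulam theorem: the difference of the values at antipodal points of the
    circle changes sign over half a turn. *)
Lemma no_embedding_disc_segment n m (b : 'rV[R]_n -> 'rV[R]_m) : n = 2%N -> m = 1%N ->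
  {within cball R n, continuous b} ->
  (forall u v, cball R n u -> cball R n v -> b u = b v -> u = v) -> False.
Proof.
move=> n2 m1 cb bI; pose h t := crd (b (circ n t)) 0.
have ch (K : set R) : {within K, continuous h}.
  apply: (@within_comp R 'rV[R]_m R K setT (b \o circ n) (fun u => crd u 0)) => //.
    apply: (@within_comp R 'rV[R]_n 'rV[R]_m K (cball R n) (@circ R n) b) => //.
      exact: circ_cont.
    by move=> t _; apply/sphere_cball/circ_sphere.
  exact: crd_cont.
pose k t := h (t + 2^-1) - h t.
have ck : {within `[(0 : R), 2^-1]%classic, continuous k}.
  apply: withinB; last exact: ch.
  apply: (@within_comp R R R _ setT (fun t => t + 2^-1) h) => //.
  by apply: withinD; [exact: within_id|exact: within_cst].
have k0 : k 2^-1 = - k 0.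
  rewrite /k opprB add0r; congr (_ - _); rewrite /h; congr (crd (b _) 0).
  by apply: circ_periodic; rewrite subr0 -div1r -mulrDl divff ?rpred1// pnatr_eq0.
have [t _ kt] : exists2 t, t \in `[(0 : R), 2^-1] & k t = 0.
  apply: IVT => //; rewrite k0 ge_min le_max oppr_le0 oppr_ge0.
  by have := le_total (k 0) 0; rewrite [X in _ && X]orbC => ->.
move/eqP: kt; rewrite subr_eq0 => /eqP e.
have cB s : cball R n (circ n s) by apply/sphere_cball/circ_sphere.
have {}e : b (circ n (t + 2^-1)) = b (circ n t).
  by rewrite -[LHS](row_cst_crd _ m1) -[RHS](row_cst_crd _ m1) -/(h _) -/(h _) e.
have := circ_eq n2 (bI _ _ (cB _) (cB _) e).
rewrite addrC addKr => /intrP[j]; have := ltr0z R j; have := ltrz1 R j.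
by move=> h1 h2 e'; move: h1 h2; rewrite -e' invf_lt1 ?ltr0n// ltr1n invr_gt0 ltr0n => /esym h1 /esym h2; move: h1 h2; case: j {e'} => // -[].
Qed.

(** Invariance of dimension in the range that a 2-complex requires. *)
Lemma cball_dim_le n m (b : 'rV[R]_n -> 'rV[R]_m) : (n <= 2)%N ->
  {within cball R n, continuous b} ->
  (forall u v, cball R n u -> cball R n v -> b u = b v -> u = v) -> (n <= m)%N.
Proof.
move=> n2 cb bI; rewrite leqNgt; apply/negP => mn.
have [m0|m0] := eqVneq m 0%N.
  have n0 : (0 < n)%N by exact: leq_ltn_trans mn.
  have u0 : cball R n 0 by exact/oball_cball/oball0.
  pose v : 'rV[R]_n := \row_i (if (i : nat) == 0%N then 1 else 0).
  have v0 : cball R n v.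
    rewrite /cball /= (bigD1 (Ordinal n0))//= big1 ?addr0 ?mxE ?expr1n// => i i0.
    by rewrite mxE ifN ?expr0n//; apply: contraNneq i0 => i0; exact/eqP/val_inj.
  have := bI 0 v u0 v0 (cball0 _ _ m0) => /rowP /(_ (Ordinal n0)).
  by rewrite !mxE /= => /eqP; rewrite eq_sym oner_eq0.
have m1 : m = 1%N by move: mn n2 m0; case: m {b cb bI} => [|[|m]]//; case: n => [|[|[|]]].
have n2' : n = 2%N by move: mn n2; rewrite m1; case: n {b cb bI} => [|[|[|]]].
exact: no_embedding_disc_segment n2' m1 cb bI.
Qed.

End BallTopology.

Section Automorphisms.
Variables (R : realType) (T : topologicalType) (X : cw_complex R T).
Local Notation chi := (char_map X).
Local Notation ball_of c := (cball R (dim (c : cell X))).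
Local Notation oball_of c := (oball R (dim (c : cell X))).
Local Notation fset p := (@face_set R T X p).
Implicit Types (c d : cell X) (g h : cw_aut X).
Hypothesis combX : cw_combinatorial X.

Lemma interior_preimage c : ball_of c `&` chi c @^-1` open_cell X c = oball_of c.
Proof.
apply/seteqP; split => [u [uB uc]|u uo]; last by split; [exact: oball_cball|exists u].
by case: (cball_split uB) => // us; have := boundary_dim us uc; rewrite ltnn.
Qed.

Lemma int_faceP c : exists d, is_face d (oball_of c).
Proof.
exists c; rewrite /is_face interior_preimage; exists 0; first exact: oball0.
by rewrite connected_component_id//; [exact: oball0|exact: oball_connected].
Qed.

Definition int_face c : face X := Face (int_faceP c).

Lemma face_eq_set c (s : set 'rV[R]_(dim c)) ps qs : @Face _ _ X c s ps = @Face _ _ X c s qs.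
Proof. by congr Face; exact: Prop_irrelevance. Qed.

Lemma closed_cell_inj c d : closed_cell c `<=` closed_cell d -> closed_cell d `<=` closed_cell c -> c = d.
Proof.
have c0 c' : open_cell X c' (chi c' 0) by exists 0 => //; exact: oball0.
move=> cd dc.
have [//|cd'] := closed_cellP (cd _ (open_closed_cell (c0 c))) (c0 c).
have [//|dc'] := closed_cellP (dc _ (open_closed_cell (c0 d))) (c0 d).
by have := ltn_trans cd' dc'; rewrite ltnn.
Qed.

Lemma closed_cell_closure c : closed_cell c `<=` closure (open_cell X c).
Proof.
move=> _ [u uB <-] A nA.
have /subspace_continuousP cc : {within ball_of c, continuous (chi c)} by exact: cw_continuous.
have nA' := cc u uB A nA.
have [v [vo]] := cball_closure uB nA'.
by move=> /(_ (oball_cball vo)) Av; exists (chi c v); split=> //; exists v.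
Qed.

Section Induced.
Variables (g : cw_aut X) (f : T -> T) (f' : T -> T).
Hypotheses (cf : continuous f) (fK : cancel f f') (fg : induces f g).

Lemma induced_closed_cell p : f @` closed_cell (face_cell p) = closed_cell (face_cell (g p)).
Proof.
have [a [[b [ca cb sa sb [ab ba]]] fa _]] := fg p.
apply/seteqP; split => [_ [_ [u uB <-] <-]|_ [u uB <-]].
  by rewrite fa//; exists (a u) => //; exact: sa.
exists (chi (face_cell p) (b u)); first by exists (b u) => //; exact: sb.
by rewrite fa ?ba ?inE//; exact: sb.
Qed.

(** A priori the interior face of [c] could be sent to a face [s'] in the boundary of the ball of
    [c']. Since [s'] is a copy of an open cell [d'], the image of the open cell [c] is [d'], and
    taking closures puts the centre of [c'] in the closed cell [d']. But [d'] is [c'] or has smaller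
    dimension, so [d'] is [c']. *)
Lemma induced_int_face c :
  g (int_face c) = int_face (face_cell (g (int_face c))) /\
  f @` open_cell X c = open_cell X (face_cell (g (int_face c))).
Proof.
have [a [_ fa aE]] := fg (int_face c); have clE := induced_closed_cell (int_face c).
move: a fa aE clE; case: (g (int_face c)) => c' s' s'P /= a fa aE clE.
have [d' dP] := s'P; have [_ _ sur] := combX dP.
have inc : s' `<=` ball_of c' `&` chi c' @^-1` open_cell X d'.
  by case: dP => x _ ->; exact: connected_component_sub.
have foE : f @` open_cell X c = open_cell X d'.
  apply/seteqP; split => [_ [_ [u uo <-] <-]|x /sur[u us <-]].
    rewrite fa; last exact: oball_cball.
    have su : s' (a u) by rewrite -aE; exists u.
    by case: (inc _ su).
  move: us; rewrite -aE => -[v vo <-]; exists (chi c v); first by exists v.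
  by rewrite fa//; exact: oball_cball.
have cd : c' = d'.
  have [x xs] : s' !=set0.
    by rewrite -aE; exists (a 0); exists 0 => //; exact: oball0.
  have [//|dc] := closed_cellP (ex_intro2 _ _ x (inc x xs).1 erefl) (inc x xs).2.
  have c0 : open_cell X c' (chi c' 0) by exists 0 => //; exact: oball0.
  have : closed_cell d' (chi c' 0).
    have := open_closed_cell c0; rewrite -clE => -[y yc <-].
    apply: (@closed_cell_closed _ _ X d'); have := closed_cell_closure yc.
    move=> yy A nA; have [z [zc zA]] := yy _ (cf nA).
    exists (f z); split=> //; apply: open_closed_cell; rewrite -foE.
    by exists z.
  move=> /closed_cellP /(_ c0)[//|/(ltn_trans dc)].
  by rewrite ltnn.
subst d'; split=> //.
have sE : s' = oball_of c'.
  have [x] := dP; rewrite interior_preimage => xo ->.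
  by rewrite connected_component_id//; exact: oball_connected.
by move: s'P; rewrite sE => s'P; exact: face_eq_set.
Qed.

End Induced.

Definition cell_act (g : cw_aut X) c : cell X := face_cell (g (int_face c)).

Lemma aut_int_face g c : g (int_face c) = int_face (cell_act g c).
Proof.
by have [f [f' [cf _ _ _ [fg _]]]] := aut_homeo g; have [] := induced_int_face cf fg c.
Qed.

Lemma cell_actM g h c : cell_act (g * h)%g c = cell_act g (cell_act h c).
Proof. by rewrite {1}/cell_act -[(g * h)%g _]/(g (h (int_face c))) aut_int_face. Qed.

Lemma cell_actK g : cancel (cell_act g) (cell_act g^-1%g).
Proof. by move=> c; rewrite -cell_actM mulVg. Qed.

Lemma aut_face_cell g p : face_cell (g p) = cell_act g (face_cell p).
Proof.
have [f [f' [cf _ _ _ [fg _]]]] := aut_homeo g.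
apply: closed_cell_inj; rewrite -(induced_closed_cell fg) /cell_act;
  by rewrite -(induced_closed_cell fg (int_face (face_cell p))).
Qed.

Definition realizes (f : T -> T) (g : cw_aut X) :=
  [/\ continuous f, injective f & induces f g].

Lemma realizes_ex g : exists f, realizes f g.
Proof.
have [f [f' [cf _ fK _ [fg _]]]] := aut_homeo g; exists f; split=> //.
exact: can_inj fK.
Qed.

Lemma realizes_open f g c : realizes f g -> f @` open_cell X c = open_cell X (cell_act g c).
Proof. by move=> [cf _ fg]; have [] := induced_int_face cf fg c. Qed.

Lemma realizes_closed f g c : realizes f g -> f @` closed_cell c = closed_cell (cell_act g c).
Proof. by move=> [_ _ fg]; exact: (induced_closed_cell fg (int_face c)). Qed.

Definition cell_lift f g c (a : 'rV[R]_(dim c) -> 'rV[R]_(dim (cell_act g c))) :=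
  [/\ homeo (ball_of c) (ball_of (cell_act g c)) a,
      forall u, ball_of c u -> f (chi c u) = chi (cell_act g c) (a u) &
      forall u, ball_of c u -> (sphere R (dim c) u <-> sphere R (dim (cell_act g c)) (a u))].

Lemma realizes_face f g p : realizes f g ->
  exists2 a : 'rV[R]_(dim (face_cell p)) -> 'rV[R]_(dim (cell_act g (face_cell p))),
  cell_lift f a & forall pf, g p = @Face _ _ X (cell_act g (face_cell p)) (a @` fset p) pf.
Proof.
move=> rf; have [cf fI fg] := rf; have [a [ha fa aE]] := fg p.
have gE := aut_face_cell g p.
(* Generalised over the target cell, so that its equation with [cell_act g (face_cell p)] can be
   substituted in the dependent types. *)
have : forall c (s : set 'rV[R]_(dim c)) sP (a : 'rV[R]_(dim (face_cell p)) -> 'rV[R]_(dim c)),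
   c = cell_act g (face_cell p) -> g p = @Face _ _ X c s sP -> homeo (ball_of (face_cell p)) (ball_of c) a ->
   (forall u, ball_of (face_cell p) u -> f (chi (face_cell p) u) = chi c (a u)) -> a @` fset p = s ->
  exists2 a : 'rV[R]_(dim (face_cell p)) -> 'rV[R]_(dim (cell_act g (face_cell p))),
  cell_lift f a & forall pf, g p = @Face _ _ X (cell_act g (face_cell p)) (a @` fset p) pf.
  move=> c s sP b cE gpE hb fb bE; subst c; exists b; last first.
    by subst s => pf; rewrite gpE; exact: face_eq_set.
  split=> // u uB.
  have bB : ball_of (cell_act g (face_cell p)) (b u) by case: hb => ? [_ _ + _ _]; exact.
  split=> us.
    case: (cball_split bB) => // bo.
    have : open_cell X (cell_act g (face_cell p)) (f (chi _ u)) by rewrite fb//; exists (b u).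
    rewrite -(realizes_open _ rf) => -[y yo /fI ye]; rewrite ye in yo.
    by have := boundary_dim us yo; rewrite ltnn.
  case: (cball_split uB) => // uo.
  have : open_cell X (cell_act g (face_cell p)) (chi (cell_act g (face_cell p)) (b u)).
    by rewrite -fb// -(realizes_open _ rf); exists (chi _ u) => //; exists u.
  by move=> /(boundary_dim us); rewrite ltnn.
move=> K; apply: (K (face_cell (g p)) (fset (g p)) (faceP (g p)) a gE _ ha fa aE).
by case: (g p).
Qed.

End Automorphisms.

(** * The action of the automorphisms on the cellular chains *)

Section ChainAction.
Import multinomials.freeg.
Variables (R : realType) (T : topologicalType) (X : cw_complex R T).
Local Notation chi := (char_map X).
Local Notation ball_of c := (cball R (dim (c : cell X))).
Local Notation fset p := (@face_set R T X p).
Implicit Types (c d : cell X) (g h : cw_aut X).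
Hypotheses (combX : cw_combinatorial X) (dim2 : forall c, (dim c <= 2)%N).

Lemma realizes_cell f g c : realizes f g ->
  exists a : 'rV[R]_(dim c) -> 'rV[R]_(dim (cell_act g c)), cell_lift f a.
Proof. by move=> rf; have [a fa _] := realizes_face combX (int_face c) rf; exists a. Qed.

Lemma cell_lift_inj f g c (a : 'rV[R]_(dim c) -> 'rV[R]_(dim (cell_act g c))) u v :
  cell_lift f a -> ball_of c u -> ball_of c v -> a u = a v -> u = v.
Proof.
move=> [[b [_ _ _ _ [ab _]]] _ _] uB vB e.
by rewrite -(ab u) ?inE// -(ab v) ?inE// e.
Qed.

Lemma dim_act g c : dim (cell_act g c) = dim c.
Proof.
have le h d : (dim d <= dim (cell_act h d))%N.
  have [f rf] := realizes_ex h; have [a fa] := realizes_cell d rf.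
  apply: (@cball_dim_le R _ _ a) => //; first by case: fa => -[b []].
  by move=> u v; exact: cell_lift_inj fa.
by apply/eqP; rewrite eqn_leq le andbT -{2}(cell_actK combX g c) le.
Qed.

Definition kact g k (c : kcell X k) : kcell X k :=
  exist _ (cell_act g (kval c) : {classic cell X}) (introT eqP (etrans (dim_act g _) (dim_kval c))).

Lemma kval_kact g k (c : kcell X k) : kval (kact g c) = cell_act g (kval c).
Proof. by []. Qed.

Lemma kact1 k (c : kcell X k) : kact 1%g c = c.
Proof. exact: kval_inj. Qed.

Lemma kactM g h k (c : kcell X k) : kact (g * h)%g c = kact g (kact h c).
Proof. by apply: kval_inj; rewrite !kval_kact cell_actM. Qed.

Lemma realizes_vpt f g (v : kcell X 0) : realizes f g -> f (vpt v) = vpt (kact g v).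
Proof.
move=> rf; have [a [_ fa _]] := realizes_cell (kval v) rf.
rewrite /vpt fa; last exact/oball_cball/oball0.
by rewrite kval_kact; congr chi; apply: cball0; rewrite dim_act dim_kval.
Qed.

Lemma side_neq b : side R b <> side R (~~ b).
Proof. by case: b; rewrite /side /=; lra. Qed.

(** The preimage of the vertex lies in the two end points of the ball, whose connected subsets are
    single points. The two ends thus give different faces even when both are attached to the same
    vertex, and so a reversal of a loop edge is visible on faces. *)
Lemma end_faceP (e : kcell X 1) b : exists d, is_face d [set row_cst (dim (kval e)) (side R b)].
Proof.
have e1 := dim_kval e; have [v v0 vE] := edge_pt_vertex b e1.
have xS : sphere R (dim (kval e)) (row_cst _ (side R b)) by exact: row_cst_sphere.
have xv : open_cell X v (chi (kval e) (row_cst _ (side R b))).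
  by rewrite -[chi (kval e) _]vE; exists 0 => //; exact: oball0.
exists v; exists (row_cst _ (side R b)); first by split=> //; exact: sphere_cball.
apply/seteqP; split=> [_ ->|y [C [Cx Cin Cc] Cy]].
  by apply: connected_component_refl; split=> //; exact: sphere_cball.
have CE u : C u -> crd u 0 = 1 \/ crd u 0 = -1.
  move=> /Cin[uB uv]; case: (cball_split uB) => [uo|/(sphere1 e1)].
    have : kval e = v by apply: open_cell_eq uv; exists u.
    by move=> ev; rewrite -ev e1 in v0.
  by case=> ->; rewrite crd_row ?e1//; [left|right].
have /connected_intervalP Ci : connected ((fun u => crd u 0) @` C).
  by apply: connected_continuous_connected => //; exact: crd_cont.
rewrite /= -[y](row_cst_crd _ e1); congr row_cst.
have yC : ((fun u => crd u 0) @` C) (crd y 0) by exists y.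
have xC : ((fun u => crd u 0) @` C) (side R b).
  by exists (row_cst _ (side R b)) => //; rewrite crd_row ?e1.
apply: contrapT => yx.
have [u Cu u0] : ((fun u => crd u 0) @` C) 0.
  have := CE _ Cy; move: xC yC yx; rewrite /side; case: b {xS xv vE Cx} => xC yC yx [yE|yE]; rewrite yE in yx yC => //.
    by apply: (Ci _ _ yC xC); lra.
  by apply: (Ci _ _ xC yC); lra.
by case: (CE _ Cu); rewrite u0; lra.
Qed.

Definition end_face (e : kcell X 1) b : face X := Face (end_faceP e b).

Lemma end_face_inj (e : kcell X 1) b b' : end_face e b = end_face e b' -> b = b'.
Proof.
move=> /(congr1 (fun p : face X => fset p (row_cst (dim (face_cell p)) (side R b)))) /= h.
have : row_cst (dim (kval e)) (side R b) = row_cst _ (side R b').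
  by rewrite -[_ = _]h.
move=> /(congr1 (fun u : 'rV[R]_(dim (kval e)) => crd u 0)).
rewrite !crd_row ?dim_kval// => ss; case: (b =P b') => // bb'; exfalso.
by apply: (@side_neq b); rewrite ss; congr side; move: bb'; case: b {h ss}; case: b'.
Qed.

Lemma aut_inj g : injective g.
Proof. exact: can_inj (@aut_funK _ _ _ g). Qed.

(* Whether [g] reverses the orientation of [e]. *)
Definition sigma g (e : kcell X 1) : bool := `[< g (end_face e true) = end_face (kact g e) false >].

Lemma realizes_end_face f g (e : kcell X 1) b : realizes f g ->
  exists b' (a : 'rV[R]_(dim (kval e)) -> 'rV[R]_(dim (cell_act g (kval e)))),
  [/\ g (end_face e b) = end_face (kact g e) b', cell_lift f a &
      a (row_cst _ (side R b)) = row_cst _ (side R b')].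
Proof.
move=> rf; have [a fa gE] := realizes_face combX (end_face e b) rf.
have e1 := dim_kval e; have e1' : dim (cell_act g (kval e)) = 1%N by rewrite dim_act.
have xS : sphere R (dim (kval e)) (row_cst _ (side R b)) by exact: row_cst_sphere.
have aS : sphere R (dim (cell_act g (kval e))) (a (row_cst _ (side R b))).
  by case: fa => _ _ /(_ _ (sphere_cball xS))[+ _]; exact.
have [b' bE] : exists b', a (row_cst _ (side R b)) = row_cst _ (side R b').
  by case: (sphere1 e1' aS) => ->; [exists true|exists false].
exists b', a; split=> //.
have [d dP] := end_faceP (kact g e) b'.
have aE : a @` fset (end_face e b) = [set row_cst (dim (kval (kact g e))) (side R b')].
  by rewrite /= image_set1 bE.
have pf : exists d, is_face (X := X) (c := cell_act g (kval e)) d (a @` fset (end_face e b)).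
  by exists d; rewrite aE.
rewrite (gE pf) /end_face; move: pf; rewrite aE => pf; exact: face_eq_set.
Qed.

Lemma end_face_act g (e : kcell X 1) b : g (end_face e b) = end_face (kact g e) (b (+) sigma g e).
Proof.
have [f rf] := realizes_ex g.
have [b1 [_ [E1 _ _]]] := realizes_end_face e true rf.
have [b2 [_ [E2 _ _]]] := realizes_end_face e false rf.
have s1 : sigma g e = ~~ b1.
  rewrite /sigma; case: asboolP => [|h]; first by rewrite E1 => /end_face_inj ->.
  by case: b1 E1 h => // -> [].
have b12 : b2 = ~~ b1.
  have : b1 <> b2 by move=> b12; have := @aut_inj g _ _ (etrans E1 (etrans (congr1 _ b12) (esym E2))) => /end_face_inj.
  by case: b1 {E1 s1}; case: b2 {E2}.
by case: b; rewrite ?E1 ?E2 s1 ?b12 /=; case: (b1).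
Qed.

Lemma edge_lift f g (e : kcell X 1) : realizes f g ->
  exists2 a : 'rV[R]_(dim (kval e)) -> 'rV[R]_(dim (cell_act g (kval e))), cell_lift f a &
  forall b, a (row_cst _ (side R b)) = row_cst _ (side R (b (+) sigma g e)).
Proof.
move=> rf; have [b1 [a [E1 fa aE]]] := realizes_end_face e true rf.
exists a => //; have b1E : b1 = true (+) sigma g e.
  by move: E1; rewrite end_face_act => /end_face_inj.
have e1 := dim_kval e; have e1' : dim (cell_act g (kval e)) = 1%N by rewrite dim_act.
have rS b : sphere R (dim (kval e)) (row_cst _ (side R b)) by exact: row_cst_sphere.
case; first by rewrite aE b1E.
have aS : sphere R (dim (cell_act g (kval e))) (a (row_cst _ (side R false))).
  by case: fa => _ _ /(_ _ (sphere_cball (rS false)))[+ _]; exact.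
have [b' bE] : exists b', a (row_cst _ (side R false)) = row_cst _ (side R b').
  by case: (sphere1 e1' aS) => ->; [exists true|exists false].
rewrite bE; congr (row_cst _ (side _ _)).
have : b' <> b1.
  move=> bb; have : row_cst (dim (kval e)) (side R false) = row_cst _ (side R true).
    apply: (cell_lift_inj fa); try exact: sphere_cball.
    by rewrite bE aE bb.
  move=> /(congr1 (fun u : 'rV[R]_(dim (kval e)) => crd u 0)).
  by rewrite !crd_row ?e1// /side; lra.
by rewrite b1E; case: b' {bE}; case: (sigma g e).
Qed.

Lemma sigmaM g h (e : kcell X 1) : sigma (g * h)%g e = sigma g (kact h e) (+) sigma h e.
Proof.
have := end_face_act (g * h)%g e true.
rewrite -[(g * h)%g _]/(g (h (end_face e true))) !end_face_act kactM => /end_face_inj.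
by case: (sigma g _); case: (sigma h _); case: (sigma _ _).
Qed.

Lemma sigma1 (e : kcell X 1) : sigma 1%g e = false.
Proof.
apply: asboolF; rewrite kact1 => /end_face_inj.
by [].
Qed.

Lemma endpt_act g (e : kcell X 1) b : kact g (endpt e b) = endpt (kact g e) (b (+) sigma g e).
Proof.
have [f rf] := realizes_ex g; apply: vpt_inj; rewrite -(realizes_vpt _ rf) !endptE.
have [a [_ fa _] aE] := edge_lift e rf.
rewrite /edge_pt fa; last exact/sphere_cball/row_cst_sphere/dim_kval.
by rewrite aE.
Qed.

Definition act0 g := basis_ext (fun v : kcell X 0 => << kact g v >> : {freeg (kcell X 0) / rat}).
Definition act1 g := basis_ext (fun e : kcell X 1 =>
  (-1) ^+ sigma g e *: << kact g e >> : {freeg (kcell X 1) / rat}).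
HB.instance Definition _ g := GRing.Linear.on (act0 g).
HB.instance Definition _ g := GRing.Linear.on (act1 g).

Lemma act0E g v : act0 g << v >> = << kact g v >>.
Proof. exact: basis_extE. Qed.
Lemma act1E g e : act1 g << e >> = (-1) ^+ sigma g e *: << kact g e >>.
Proof. exact: basis_extE. Qed.

Lemma act0_1 y : act0 1%g y = y.
Proof. by move: y; apply: (@linear_eq_basis _ _ (act0 1%g) idfun) => v /=; rewrite act0E kact1. Qed.
Lemma act0_M g h y : act0 (g * h)%g y = act0 g (act0 h y).
Proof.
move: y; apply: (@linear_eq_basis _ _ (act0 _) (act0 g \o act0 h)) => v /=.
by rewrite !act0E kactM.
Qed.
Lemma act1_1 y : act1 1%g y = y.
Proof.
move: y; apply: (@linear_eq_basis _ _ (act1 1%g) idfun) => v /=.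
by rewrite act1E kact1 sigma1 expr0 scale1r.
Qed.
Lemma act1_M g h y : act1 (g * h)%g y = act1 g (act1 h y).
Proof.
move: y; apply: (@linear_eq_basis _ _ (act1 _) (act1 g \o act1 h)) => v /=.
rewrite !act1E linearZ /= act1E kactM sigmaM scalerA mulrC; congr (_ *: _).
by case: (sigma g _); case: (sigma h _); rewrite /= ?expr0 ?expr1 ?mulr1 ?mul1r ?mulN1r ?opprK.
Qed.

Lemma D1_act g z : D1 (act1 g z) = act0 g (D1 z).
Proof.
move: z; apply: (@linear_eq_basis _ _ (@D1 R T X \o act1 g) (act0 g \o @D1 R T X)) => e /=.
rewrite act1E linearZ /= !D1E [in RHS]linearB /= !act0E !endpt_act.
by case: (sigma g e); rewrite /= ?expr0 ?expr1 ?scale1r ?scaleN1r ?opprB.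
Qed.

(** The pullback of [phi] by [g]. Cochains are functions on all cells while signs exist for edges
    only, whence the choice by [xget], with 0 elsewhere. *)
Lemma cochain_act g (phi : cell X -> int) : exists phi' : cell X -> int, forall e : kcell X 1,
  phi' (kval e) = (-1) ^+ sigma g e * phi (cell_act g (kval e)).
Proof.
exists (fun d => xget 0 [set k : int | exists e : kcell X 1, kval e = d /\
  k = (-1) ^+ sigma g e * phi (cell_act g (kval e))]) => e.
case: xgetP => [k _ [e' [/kval_inj -> //]]|].
by move=> /(_ ((-1) ^+ sigma g e * phi (cell_act g (kval e)))); case; exists e.
Qed.

(** If [phi] vanishes on the boundary of the image cell, its angle extends over the image disc.
    Composed with the lift of [f] to the balls, it extends over the disc of [c], so its winding
    along the boundary of [c] is zero; and this winding is the value of the pulled back cochain. *)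
Lemma boundary_act0 g (c : kcell X 2) (phi : cell X -> int) :
  pair1 phi (D2 << kact g c >>) = 0 -> pair1 phi (act1 g (D2 << c >>)) = 0.
Proof.
move=> h0; have [f rf] := realizes_ex g; have [cf _ _] := rf.
have c2 := dim_kval c; have c2' : dim (cell_act g (kval c)) = 2%N by rewrite dim_act.
have [phi' phiE] := cochain_act g phi.
have -> : pair1 phi (act1 g (D2 << c >>)) = pair1 phi' (D2 << c >>).
  move: (D2 _); apply: (@linear_eq_basis _ rat^o (pair1 phi \o act1 g) (pair1 phi')) => e /=.
  rewrite act1E linearZ /= /pair1 !pairingE kval_kact phiE rmorphM rmorph_sign.
  by [].
apply: (@ratr_inj_eq R); rewrite -winding_boundary rmorph0.
have w0 : winding (edge_angle phi \o loop (cell_act g (kval c))) = 0.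
  by have := winding_boundary phi (kact g c); rewrite h0 rmorph0.
have [Lam cL LE] := @disc_extension R _ (edge_angle phi \o chi (cell_act g (kval c))) c2'
  (edge_angle_loop phi c2') w0.
have [a [ha fa aS]] := realizes_cell (kval c) rf.
have ca : {within ball_of (kval c), continuous a} by case: ha => b [].
have -> : 0 = winding ((edge_angle phi \o f) \o loop (kval c)).
  have cB t : ball_of (kval c) (circ _ t) by apply/sphere_cball/circ_sphere.
  rewrite (@windingE R _ (Lam \o (a \o circ _))).
    rewrite /=; have -> : circ (dim (kval c)) 0 = circ (dim (kval c)) 1 :> 'rV[R]_(dim (kval c)); last by rewrite subrr.
    by apply: circ_periodic; rewrite sub0r rpredN rpred1.
  split.
    apply: (@within_comp R _ R _ setT (a \o circ _) Lam) => //.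
      apply: (@within_comp R _ _ _ (ball_of (kval c)) (@circ R _) a) => //; exact: circ_cont.
    exact: continuous_subspaceT.
  move=> t _ /=; rewrite /loop fa//; apply: LE.
  by apply/(aS _ (cB t)); exact: circ_sphere.
have [F [fF F1 FP]] := loop_closed_cells c2; apply/esym.
have LamEx d : exists Lam : 'rV[R]_(dim d) -> R, forall e : kcell X 1, kval e = d ->
    is_lift (ball_of d) ((edge_angle phi \o f) \o chi d) Lam /\
    Lam (row_cst _ 1) - Lam (row_cst _ (-1)) = (phi' d)%:~R.
  have [d1|d1] := pselect (dim d = 1%N); last first.
    by exists (fun=> 0) => e ed; case: d1; rewrite -ed dim_kval.
  have [e ed] := kval_ex d1; subst d.
  have [b [hb fb bS] bE] := edge_lift e rf.
  have e1' : dim (cell_act g (kval e)) = 1%N by rewrite dim_act.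
  exists (fun u => (phi (cell_act g (kval e)))%:~R * ((crd (b u) 0 + 1) / 2)) => _ _.
  have cb : {within ball_of (kval e), continuous b} by case: hb => b' [].
  have bB u : ball_of (kval e) u -> ball_of (cell_act g (kval e)) (b u).
    by case: hb => b' [_ _ + _ _]; exact.
  split; first split.
  - apply: withinM; first exact: within_cst.
    apply: withinM; last exact: within_cst.
    apply: withinD; last exact: within_cst.
    apply: (@within_comp _ _ R _ setT b (fun u => crd u 0)) => //; exact: crd_cont.
  - by move=> u uB /=; rewrite fb//; apply: edge_angle_edge => //; exact: bB.
  - rewrite (bE true) (bE false).
    rewrite !crd_row ?e1'// phiE rmorphM rmorph_sign.
    by case: (sigma g e); rewrite /side /= ?expr0 ?expr1; field.
pose Lm d := projT1 (cid (LamEx d)).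
have LmP d : forall e : kcell X 1, kval e = d ->
    is_lift (ball_of d) ((edge_angle phi \o f) \o chi d) (Lm d) /\
    Lm d (row_cst _ 1) - Lm d (row_cst _ (-1)) = (phi' d)%:~R.
  exact: (projT2 (cid (LamEx d))).
apply: (@graph_winding _ _ X F (edge_angle phi \o f) (fun=> 0) Lm phi' (loop (kval c)) fF F1).
- move=> d Fd d1; have [e ed] := kval_ex d1; have [L1 L2] := LmP d e ed.
  by split=> //; rewrite subrr subr0 L2.
- move=> v v0; have [w wv] := kval_ex v0; rewrite subr0 /= -wv -/(vpt w) (realizes_vpt _ rf).
  by rewrite edge_angle_vertex ?rpred0// dim_kval.
- exact: loop_cont.
- exact: loop_closed.
- by move=> t _; exact: FP.
Qed.

(** Every integral cochain of finite support that kills one vector kills the other, so the two are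
    proportional. *)
Lemma boundary_act g (c : kcell X 2) : exists k : rat,
  act1 g (D2 << c >>) = k *: D2 << kact g c >>.
Proof.
apply: contrapT => nk; set w := D2 << kact g c >> in nk.
have [||v|[k _ kz]|f [fi fw fz]] := @separation _ [set k *: w | k in [set: rat]] [:: w] (act1 g (D2 << c >>)).
- by exists 0 => //; rewrite scale0r.
- move=> k _ _ [p _ <-] [q _ <-]; exists (k * p + q) => //.
  by rewrite scalerDl scalerA.
- by rewrite inE => /eqP ->; exists 1; rewrite ?scale1r.
- by apply: nk; exists k.
have [phi phiE] := kval_cochain fi.
have phi_pair x : pair1 phi x = pairing (fun e => coeff e f) x.
  by rewrite /pair1; congr pairing; apply/funext.
case/eqP: fz; rewrite -phi_pair; apply: boundary_act0.
by rewrite phi_pair; apply: fw; rewrite inE.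
Qed.

End ChainAction.

(** * Finiteness of the stabilisers *)

Lemma compact_locally_finite (U : topologicalType) (J : Type) (K : set U) (A : U -> set J) :
  compact K ->
  (forall x, K x -> exists2 N, nbhs x N & finite_set (\bigcup_(y in N) A y)) ->
  finite_set (\bigcup_(x in K) A x).
Proof.
move=> /compact_near_coveringP cK lf.
pose FF : set_system (set J) :=
  filter_from [set B | finite_set B] (fun B => [set C | B `<=` C]).
have FFF : Filter FF.
  apply: filter_from_filter; first by exists set0; exact: finite_set0.
  move=> B C fB fC; exists (B `|` C); first by rewrite /= finite_setU.
  by move=> D BCD; split=> c Hc; apply: BCD; [left|right].
have [|B fB BP] := cK (set J) FF (fun C x => A x `<=` C) FFF.
  move=> x Kx; have [N nN fN] := lf x Kx.
  exists (N, [set C | \bigcup_(y in N) A y `<=` C]).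
    by split=> //; exists (\bigcup_(y in N) A y).
  by move=> [y C] /= [Ny NC] c Ayc; apply: NC; exists y.
apply: sub_finite_set fB => c [x Kx Axc].
exact: (BP B (@subset_refl _ B) x Kx c Axc).
Qed.

Section RealLemmas.
Variable R : realType.

(** The lower of the two end values is taken once more on the other side of [m], by the intermediate
    value theorem. *)
Lemma no_interior_min (f : R -> R) p m q : p < m -> m < q ->
  {within `[p, q]%classic, continuous f} ->
  (forall s t, p <= s <= q -> p <= t <= q -> f s = f t -> s = t) ->
  f m <= f p -> f m <= f q -> False.
Proof.
move=> pm mq cf fI fmp fmq; have [pq|qp] := leP (f p) (f q).
  have [||t tmq ft] := @IVT R f m q (f p) (ltW mq) _ _.
  - by apply: continuous_subspaceW cf => x /=; rewrite !in_itv/= => /andP[mx ->]; rewrite (le_trans _ mx)// ltW.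
  - by rewrite ge_min fmp /= le_max pq orbT.
  move: tmq; rewrite in_itv/= => /andP[mt tq].
  have pt : p < t by exact: lt_le_trans pm mt.
  have := fI p t _ _ (esym ft); rewrite lexx (ltW (lt_trans pm mq)) (ltW pt) tq => /(_ isT isT) ptE.
  by rewrite ptE ltxx in pt.
have [||t tpm ft] := @IVT R f p m (f q) (ltW pm) _ _.
- by apply: continuous_subspaceW cf => x /=; rewrite !in_itv/= => /andP[-> xm] /=; rewrite (le_trans xm)// ltW.
- by rewrite ge_min fmq orbT /= le_max (ltW qp).
move: tpm; rewrite in_itv/= => /andP[pt tm].
have tq : t < q by exact: le_lt_trans tm mq.
have := fI t q _ _ ft; rewrite lexx (ltW (lt_trans pm mq)) (ltW tq) pt => /(_ isT isT) ptE.
by rewrite ptE ltxx in tq.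
Qed.

Lemma cs_lt1 (x : R) : 0 < x < 1 -> cs x < 1.
Proof.
move=> /andP[x0 x1]; rewrite lt_neqAle cos_le1 andbT; apply/eqP => /cs_eq1/intrP[k kE].
by move: x0 x1; rewrite kE ltr0z ltrz1; case: k {kE} => // -[].
Qed.

Lemma int_lt1 (x : R) : x \is a Num.int -> -1 < x < 1 -> x = 0.
Proof.
move=> /intrP[k ->] /andP[k0 k1].
have k0' : -1 < k by rewrite -(ltr_int R) rmorphN1.
have k1' : k < 1 by rewrite -(ltr_int R) rmorph1.
have -> : k = 0 by lia.
by rewrite rmorph0.
Qed.

Lemma cs_half : cs (2^-1 : R) = -1.
Proof.
have -> : cs (2^-1 : R) = cos pi; last exact: cospi.
by rewrite /cs; congr cos; field.
Qed.

End RealLemmas.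

Section Faces.
Variables (R : realType) (T : topologicalType) (X : cw_complex R T).
Local Notation chi := (char_map X).
Local Notation ball_of c := (cball R (dim (c : cell X))).
Implicit Types (c d : cell X) (g h : cw_aut X).
Hypotheses (combX : cw_combinatorial X) (dim2 : forall c, (dim c <= 2)%N)
  (lfX : cw_locally_finite X).

Lemma meets_finite d : finite_set [set c : cell X | closed_cell c `&` closed_cell d !=set0].
Proof.
have := @compact_locally_finite T (cell X) (closed_cell d) (fun x => [set c : cell X | closed_cell c x])
  (@closed_cell_compact R T X d).
have -> : \bigcup_(x in closed_cell d) [set c : cell X | closed_cell c x] =
    [set c : cell X | closed_cell c `&` closed_cell d !=set0].
  by apply/seteqP; split=> [c [x dx cx]|c [x [cx dx]]]; exists x.
apply=> x _; have [N nN fN] := lfX x; exists N => //.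
by apply: sub_finite_set fN => c [y Ny cy]; exists y.
Qed.

Lemma face_common c (s t : set 'rV[R]_(dim c)) u : (exists d, is_face (X := X) (c := c) d s) ->
  (exists d, is_face (X := X) (c := c) d t) -> s u -> t u -> s = t.
Proof.
move=> [d [x xd ->]] [d' [y yd ->]] su tu.
have [_ ud] := connected_component_sub su; have [_ ud'] := connected_component_sub tu.
have dd : d = d' by exact: open_cell_eq ud ud'.
subst d'; rewrite (same_connected_component su) (same_connected_component tu).
by [].
Qed.

(** Distinct faces of a ball are disjoint, so a finite set that meets all of them bounds their
    number. *)
Lemma sample_finite c (M : set 'rV[R]_(dim c)) : finite_set M ->
  (forall s, (exists d, is_face (X := X) (c := c) d s) -> exists2 u, M u & s u) ->
  finite_set [set p : face X | face_cell p = c].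
Proof.
move=> fM MP.
pose has_pt u : set (face X) := [set p | exists s sP, p = @Face _ _ X c s sP /\ s u].
pose pt u := if pselect (exists p, has_pt u p) is left h then projT1 (cid h) else int_face c.
apply: (@sub_finite_set _ _ (pt @` M)); last exact: finite_image.
move=> p pc; have [s [sP pE]] : exists s sP, p = @Face _ _ X c s sP.
  by case: p pc => c' s' s'P /= cc; subst c'; exists s', s'P.
have [u Mu su] := MP s sP; exists u => //; rewrite /pt; case: pselect => [h|]; last by case; exists p, s, sP.
case: (cid h) => q /= [t [tP [qE tu]]]; rewrite qE.
have st := face_common sP tP su tu; subst t.
by rewrite pE; exact: face_eq_set.
Qed.

Lemma face_in_ball c s : (exists d, is_face (X := X) (c := c) d s) -> s `<=` ball_of c.
Proof. by move=> [d [x _ ->]] u /connected_component_sub[]. Qed.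

Lemma face_nonempty c s : (exists d, is_face (X := X) (c := c) d s) -> s !=set0.
Proof. by move=> [d [x xd ->]]; exists x; exact: connected_component_refl. Qed.

Lemma face_oball c s u : (exists d, is_face (X := X) (c := c) d s) -> s u -> oball R (dim c) u -> s 0.
Proof.
move=> [d dP] su uo; have [x xd sE] := dP.
have [_ ud] : (ball_of c `&` chi c @^-1` open_cell X d) u by move: su; rewrite sE => /connected_component_sub.
have dc : d = c by apply: (open_cell_eq ud); exists u.
subst d; move: su; rewrite sE => /same_connected_component ->.
rewrite interior_preimage connected_component_id//; [exact: oball0|exact: oball_connected].
Qed.

Section Loop.
Variable c : cell X.
Hypothesis c2 : dim c = 2%N.

(** Its angle runs once around the circle along every edge: the cosine [C] is 1 exactly at the
    vertices, and it is -1 at the midpoints of the edges. *)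
Let one_cochain : cell X -> int := fun=> 1.
Local Notation angle := (edge_angle one_cochain).
Let C (t : R) : R := cs (angle (loop c t)).
Let S (t : R) : R := sn (angle (loop c t)).

Lemma angle_loop_cont (phi : cell X -> int) (K : set R) : circ_continuous K (edge_angle phi \o loop c).
Proof.
have [F [fF F1 FP]] := loop_closed_cells c2.
by apply: circ_continuous_comp (edge_angle_circ phi fF F1); [exact: loop_cont|].
Qed.

Let within_setT (f : R -> R) : {within setT, continuous f} -> continuous f.
Proof. by move=> cf; apply/continuous_subspace_setT. Qed.

Let C_cont : continuous C.
Proof. by apply: within_setT; have [] := angle_loop_cont one_cochain setT. Qed.
Let S_cont : continuous S.
Proof. by apply: within_setT; have [] := angle_loop_cont one_cochain setT. Qed.

Lemma loop_cell t : exists2 d, (dim d <= 1)%N & open_cell X d (loop c t).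
Proof.
have [d dt] := in_open_cell X (loop c t); exists d => //.
by rewrite -ltnS -c2; exact: boundary_dim (circ_sphere t c2) dt.
Qed.

Lemma edge_coord (e : cell X) (x : T) : dim e = 1%N -> open_cell X e x ->
  exists s : R, [/\ 0 < s < 1, x = edge_pt e (2 * s - 1) &
    forall phi : cell X -> int, edge_angle phi x = (phi e)%:~R * s].
Proof.
move=> e1 [u uo <-]; exists ((crd u 0 + 1) / 2); split.
- by move: uo; rewrite /oball /= (sqnorm1 _ e1) => h; apply/andP; split; nra.
- rewrite /edge_pt; congr chi; rewrite -[LHS](row_cst_crd _ e1); congr row_cst; by field.
- by move=> phi; rewrite /edge_angle glueE// ifT ?e1//.
Qed.

Lemma vertex_angle (v : cell X) (x : T) (phi : cell X -> int) : dim v = 0%N -> open_cell X v x -> edge_angle phi x = 0.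
Proof. by move=> v0 [u uo <-]; rewrite (cball0 u 0 v0) edge_angle_vertex. Qed.

Lemma loop_C1 t : C t = 1 <-> exists2 v, dim v = 0%N & open_cell X v (loop c t).
Proof.
split=> [Ct|[v v0 vt]]; last by rewrite /C (vertex_angle _ v0 vt) cs0.
have [d d1 dt] := loop_cell t; exists d => //.
move: d1; rewrite leq_eqVlt ltnS leqn0 => /orP[/eqP d1|/eqP//].
have [s [s01 _ sE]] := edge_coord d1 dt.
by have := cs_lt1 s01; rewrite -[s]mul1r -[1](@rmorph1 _ _ (intr : int -> R)) -(sE one_cochain) -/(C t) Ct ltxx.
Qed.

(** An arc of the loop inside one open cell is the image of a connected set, so it lies in a single
    face, where the characteristic map is injective by the combinatorial hypothesis. *)
Lemma loop_face_inj d t t' : t <= t' -> (forall s, t <= s <= t' -> open_cell X d (loop c s)) ->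
  loop c t = loop c t' -> t - t' \is a Num.int.
Proof.
move=> tt' dt e.
have cB s : ball_of c (circ _ s) by apply/sphere_cball/circ_sphere.
have tin : t <= t <= t' by rewrite lexx.
have tin' : t <= t' <= t' by rewrite lexx tt'.
pose s := connected_component (ball_of c `&` chi c @^-1` open_cell X d) (circ _ t).
have sP : is_face d s by exists (circ _ t) => //; split => //; exact: dt.
have [_ inj _] := combX sP.
have st : s (circ _ t) by apply: connected_component_refl; split=> //; exact: dt.
have st' : s (circ _ t').
  apply: (@connected_component_max _ _ (circ (dim c) @` `[t, t']%classic)).
  - by exists t => //; rewrite /= in_itv.
  - by move=> _ [r rt <-]; split=> //; apply: dt; move: rt; rewrite /= in_itv.
  - by apply: connected_continuous_connected; [exact: segment_connected|exact: circ_cont].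
  - by exists t' => //; rewrite /= in_itv.
by apply: (@circ_eq R (dim c)) => //; apply: inj; rewrite ?inE.
Qed.

(** An arc in the 0-skeleton stays at one vertex, since the indicator of a vertex is continuous
    there; injectivity on faces then forbids the loop to rest. *)
Lemma vertex_segment t t' : t <= t' -> (forall s, t <= s <= t' -> C s = 1) ->
  t - t' \is a Num.int.
Proof.
move=> tt' Cs; have [v v0 vt] : exists2 v, dim v = 0%N & open_cell X v (loop c t).
  by apply/loop_C1/Cs; rewrite lexx.
have [F [fF F1 FP]] := loop_cells c2.
pose g (x : T) : R := (`[< open_cell X v x >])%:R.
have cg : {within \bigcup_(d in F `&` [set d | dim d = 0%N]) closed_cell d, continuous g}.
  by apply: cells_glue => [|d [_ d0]]; [exact: finite_setIl|exact: within_dim0].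
have gv r : t <= r <= t' -> open_cell X v (loop c r).
  move=> /andP[tr rt'].
  have : g (loop c t) = g (loop c r).
    apply: (@integer_valued_constant R t r (fun s => g (loop c s))) => //; last by move=> s _; rewrite natr_int.
    apply: (@within_comp R T R _ (\bigcup_(d in F `&` [set d | dim d = 0%N]) closed_cell d) (loop c) g) => //.
      exact: loop_cont.
    move=> s; rewrite /= in_itv/= => /andP[ts sr].
    have [d Fd ds] := FP s; exists d; last exact: open_closed_cell.
    split=> //; have [w w0 ws] : exists2 v, dim v = 0%N & open_cell X v (loop c s).
      by apply/loop_C1/Cs; rewrite ts (le_trans sr).
    by rewrite /= (open_cell_eq ds ws).
  rewrite /g (asboolT vt); case: asboolP => // _ /eqP; rewrite oner_eq0//.
apply: (loop_face_inj tt' gv).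
have tin : t <= t <= t' by rewrite lexx.
have tin' : t <= t' <= t' by rewrite lexx tt'.
have [u uo <-] := gv t tin; have [u' uo' <-] := gv t' tin'.
by rewrite (cball0 u u' v0).
Qed.

(** The angle of the cochain of [e] alone is zero on all other cells of the graph, so the loop is
    inside [e] wherever the cosine of that angle is not 1. *)
Lemma edge_open e t : dim e = 1%N -> open_cell X e (loop c t) ->
  \forall s \near t, open_cell X e (loop c s).
Proof.
move=> e1 et; pose Ce s := cs (edge_angle (edge_ind e) (loop c s)).
have cCe : continuous Ce by apply: within_setT; have [] := angle_loop_cont (edge_ind e) setT.
have CeE s : Ce s != 1 -> open_cell X e (loop c s).
  move=> /eqP Cs; have [d d1 ds] := loop_cell s; have [<-//|de] := pselect (d = e).
  exfalso; apply: Cs; move: d1; rewrite leq_eqVlt ltnS leqn0 => /orP[/eqP d1|/eqP d0].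
    have [r [_ _ rE]] := edge_coord d1 ds.
    by rewrite /Ce rE /edge_ind asboolF// mul0r cs0.
  by rewrite /Ce (vertex_angle _ d0 ds) cs0.
have [r [r01 _ rE]] := edge_coord e1 et.
have Ct : Ce t < 1 by rewrite /Ce rE /edge_ind asboolT// mul1r; exact: cs_lt1.
have : nbhs (Ce t) [set r | r < 1] by exact: lt_nbhsl.
move=> /(cCe t); apply: (@filterS _ _ (nbhs_filter t)) => s /= sC.
by apply: CeE; rewrite lt_eqF.
Qed.

Lemma angle_inj_edge e s t : dim e = 1%N -> s <= t ->
  (forall r, s <= r <= t -> open_cell X e (loop c r)) ->
  C s = C t -> S s = S t -> s - t \is a Num.int.
Proof.
move=> e1 st er Cst Sst; apply: (loop_face_inj st er).
have [r [r01 rx rE]] : exists r : R, [/\ 0 < r < 1, loop c s = edge_pt e (2 * r - 1) &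
    forall phi : cell X -> int, edge_angle phi (loop c s) = (phi e)%:~R * r].
  by apply: edge_coord => //; apply: er; rewrite lexx.
have [r' [r01' rx' rE']] : exists r : R, [/\ 0 < r < 1, loop c t = edge_pt e (2 * r - 1) &
    forall phi : cell X -> int, edge_angle phi (loop c t) = (phi e)%:~R * r].
  by apply: edge_coord => //; apply: er; rewrite lexx st.
move: Cst Sst; rewrite /C /S rE rE' /one_cochain !mul1r => h1 h2.
have : r - r' = 0.
  by apply: int_lt1; [exact: cs_sn_int|move: r01 r01' => /andP[? ?] /andP[? ?]; apply/andP; split; lra].
by move/eqP; rewrite subr_eq0 rx rx' => /eqP ->.
Qed.

(** The parameters at vertices and at midpoints of edges. Every boundary face contains such a point,
    as it is a bijective copy of a vertex or of an open edge. *)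
Let marked (t : R) := C t = 1 \/ C t = -1.

(* Near a vertex of the loop [C] is positive; between two vertices it would have an interior
   minimum in an edge, although the loop is injective on each face. *)
Lemma marked_locally_finite t : exists2 e : R, 0 < e &
  finite_set [set s | `|s - t| < e /\ marked s].
Proof.
have [Ct|Ct] := pselect (C t = 1); last first.
  have [d d1 dt] := loop_cell t.
  have {}d1 : dim d = 1%N.
    move: d1; rewrite leq_eqVlt ltnS leqn0 => /orP[/eqP //|/eqP d0].
    by case: Ct; apply/loop_C1; exists d.
  have /nbhs_ballP[e /= e0 eP] := edge_open d1 dt.
  (* Radius at most 1/2 keeps differences of parameters below 1, so that integral ones vanish. *)
  have e'0 : 0 < Num.min e 2^-1 by rewrite lt_min e0 invr_gt0 ltr0n.
  exists (Num.min e 2^-1) => //.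
  set M := [set s | _].
  have MP s : M s -> [/\ t - e < s, s < t + e, t - 2^-1 < s & s < t + 2^-1].
    by move=> []; rewrite lt_min !ltr_distl => /andP[/andP[h1 h2] /andP[h3 h4]] _.
  have Mopen s : t - e < s -> s < t + e -> open_cell X d (loop c s).
    by move=> s1 s2; apply: eP; rewrite /ball /= distrC ltr_distl s1 s2.
  have Mmid s : M s -> C s = -1.
    move=> Ms; have [h1 h2 _ _] := MP s Ms; case: Ms => _ [|//] /loop_C1[v v0 vs].
    by have := open_cell_eq vs (Mopen s h1 h2) => vd; move: v0; rewrite vd d1.
  have uniq s s' : M s -> M s' -> s <= s' -> s = s'.
    move=> Ms Ms' ss'; have [h1 h2 h3 h4] := MP s Ms; have [h1' h2' h3' h4'] := MP s' Ms'.
    have sn0 r : M r -> S r = 0.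
      move=> Mr; have := cs2Dsn2 (angle (loop c r)); rewrite -/(C r) -/(S r) Mmid// sqrrN expr1n.
      by move=> h; apply/eqP; rewrite -sqrf_eq0; apply/eqP; lra.
    have := @angle_inj_edge d s s' d1 ss' _ _ _; rewrite !Mmid// !sn0//.
    move=> /(_ _ erefl erefl) h.
    have : s - s' = 0 by apply: int_lt1; [apply: h => r /andP[r1 r2]; apply: Mopen; lra|apply/andP; split; lra].
    by move/eqP; rewrite subr_eq0 => /eqP.
  have [[s Ms]|nM] := pselect (M !=set0); last first.
    by apply: sub_finite_set (finite_set0 R) => s Ms; apply: nM; exists s.
  apply: sub_finite_set (finite_set1 s) => s' Ms'.
  by have [ss|/ltW ss] := leP s s'; [rewrite (uniq s s')|rewrite (uniq s' s)].
have /nbhs_ballP[e /= e0 eP] : \forall s \near t, 0 < C s.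
  by have := C_cont; move=> /(_ t _ (lt_nbhsr (_ : 0 < C t))); apply; rewrite Ct ltr01.
have e'0 : 0 < Num.min e 2^-1 by rewrite lt_min e0 invr_gt0 ltr0n.
exists (Num.min e 2^-1) => //.
set M := [set s | _].
have MP s : M s -> [/\ t - e < s, s < t + e, t - 2^-1 < s & s < t + 2^-1].
  by move=> []; rewrite lt_min !ltr_distl => /andP[/andP[h1 h2] /andP[h3 h4]] _.
have Cpos s : t - e < s -> s < t + e -> 0 < C s.
  by move=> s1 s2; apply: eP; rewrite /ball /= distrC ltr_distl s1 s2.
have M1 s : M s -> C s = 1.
  move=> Ms; have [h1 h2 _ _] := MP s Ms; case: Ms => _ [//|] Cs.
  by have := Cpos s h1 h2; rewrite Cs; lra.
have uniq s1 s2 : M s1 -> M s2 -> s1 < s2 -> False.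
  move=> Ms1 Ms2 s12; have [h1 h2 h3 h4] := MP s1 Ms1; have [h1' h2' h3' h4'] := MP s2 Ms2.
  have [all1|] := pselect (forall s, s1 <= s <= s2 -> C s = 1).
    have : s1 - s2 = 0 by apply: (int_lt1 (vertex_segment (ltW s12) all1)); apply/andP; split; lra.
    by lra.
  move=> /existsNP[s /not_implyP[/andP[s1s ss2] Cs]].
  have cC : {within `[s1, s2]%classic, continuous C} by exact: continuous_subspaceT.
  have [m] := EVT_min (ltW s12) cC; rewrite in_itv/= => /andP[m1 m2] mmin.
  have Cm1 : C m < 1.
    have Cs1 : C s < 1 by rewrite lt_neqAle cos_le1 andbT; exact/eqP.
    by apply: le_lt_trans Cs1; apply: mmin; rewrite in_itv/= s1s.
  have sm1 : s1 < m by rewrite lt_neqAle m1 andbT; apply: contraTneq Cm1 => <-; rewrite M1// ltxx.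
  have sm2 : m < s2 by rewrite lt_neqAle m2 andbT; apply: contraTneq Cm1 => ->; rewrite M1// ltxx.
  have Cm0 : 0 < C m by apply: Cpos; lra.
  have [d d1 dm] := loop_cell m.
  have {}d1 : dim d = 1%N.
    move: d1; rewrite leq_eqVlt ltnS leqn0 => /orP[/eqP //|/eqP d0].
    have : C m = 1 by apply/loop_C1; exists d.
    by move=> h; rewrite h ltxx in Cm1.
  (* Near [m] the sine keeps its sign, so the cosine determines the angle; with the injectivity of
     the loop on the edge, this makes [C] injective around its minimum. *)
  have Sm0 : S m != 0.
    apply/eqP => Sm; have := cs2Dsn2 (angle (loop c m)); rewrite -/(C m) -/(S m) Sm expr0n addr0.
    by move/eqP; rewrite sqrf_eq1 => /orP[] /eqP h; rewrite h in Cm0 Cm1; lra.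
  have Ssign : \forall s \near m, 0 < S s * S m.
    have : 0 < S m * S m by rewrite -expr2 lt_def sqrf_eq0 Sm0 sqr_ge0.
    have cSS : {for m, continuous (fun s => S s * S m)} by apply: cvgM; [exact: S_cont|exact: cvg_cst].
    by move=> h; exact: cSS _ (lt_nbhsr h).
  have /nbhs_ballP[r /= r0 rP] : \forall s \near m, open_cell X d (loop c s) /\ 0 < S s * S m.
    by apply: filterI => //; exact: edge_open.
  pose q := Num.min (Num.min (r / 2) ((m - s1) / 2)) ((s2 - m) / 2).
  have [q0 qr q1 q2] : [/\ 0 < q, q < r, q < m - s1 & q < s2 - m].
    rewrite /q; split; rewrite ?lt_min ?gt_min.
    - by apply/andP; split; [apply/andP; split|]; lra.
    - by apply/orP; left; apply/orP; left; lra.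
    - by apply/orP; left; apply/orP; right; lra.
    - by apply/orP; right; lra.
  have near_m s' : m - q <= s' <= m + q -> open_cell X d (loop c s') /\ 0 < S s' * S m.
    by move=> /andP[a1 a2]; apply: rP; rewrite /ball /= ltr_distl; apply/andP; split; lra.
  apply: (@no_interior_min R C (m - q) m (m + q)); try lra.
  - exact: continuous_subspaceT.
  - have inj a b : m - q <= a <= m + q -> m - q <= b <= m + q -> a <= b -> C a = C b -> a = b.
      move=> aI bI ab Cab; have [oa Sa] := near_m a aI; have [ob Sb] := near_m b bI.
      have Sab : S a = S b.
        have := cs2Dsn2 (angle (loop c a)); have := cs2Dsn2 (angle (loop c b)).
        rewrite -/(C a) -/(C b) -/(S a) -/(S b) Cab => e1 e2.
        have /eqP : S a ^+ 2 = S b ^+ 2 by lra.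
        rewrite eqf_sqr => /orP[/eqP //|/eqP Sn]; move: Sa; rewrite Sn mulNr oppr_gt0.
        by move=> /(lt_trans Sb); rewrite ltxx.
      have : a - b = 0.
        apply: int_lt1.
          apply: (@angle_inj_edge d) => // r' /andP[r1 r2].
          by have [] := near_m r' _ => //; move: aI bI => /andP[? ?] /andP[? ?]; apply/andP; split; lra.
        by move: aI bI => /andP[? ?] /andP[? ?]; apply/andP; split; lra.
      by move/eqP; rewrite subr_eq0 => /eqP.
    move=> a b aI bI Cab; have [ab|/ltW ba] := leP a b; first exact: inj.
    by apply/esym/inj.
  - by apply: mmin; rewrite in_itv/=; apply/andP; split; lra.
  - by apply: mmin; rewrite in_itv/=; apply/andP; split; lra.
have [[s Ms]|nM] := pselect (M !=set0); last first.
  by apply: sub_finite_set (finite_set0 R) => s Ms; apply: nM; exists s.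
apply: sub_finite_set (finite_set1 s) => s' Ms'.
have [ss|ss|->//] := ltgtP s s'; first by have := uniq s s' Ms Ms' ss.
by have := uniq s' s Ms' Ms ss.
Qed.

Lemma marked_finite : finite_set [set t | 0 <= t <= 1 /\ marked t].
Proof.
have := @compact_locally_finite R R `[(0 : R), 1]%classic (fun t => [set s | s = t /\ marked s])
  (@segment_compact R _ _).
have -> : \bigcup_(t in `[(0 : R), 1]%classic) [set s | s = t /\ marked s] = [set t | 0 <= t <= 1 /\ marked t].
  apply/seteqP; split=> [s [t t01 [-> mt]]|t [t01 mt]]; last by exists t.
  by split=> //; move: t01; rewrite /= in_itv.
apply=> t _; have [e e0 fe] := marked_locally_finite t.
exists (ball t e); first exact: nbhsx_ballx.
apply: sub_finite_set fe => s [r tr [-> mr]]; split=> //.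
by move: tr; rewrite /ball /= distrC.
Qed.

Lemma disc_faces_finite : finite_set [set p : face X | face_cell p = c].
Proof.
apply: (@sample_finite c ([set 0] `|` (circ (dim c) @` [set t | 0 <= t <= 1 /\ marked t]))).
  rewrite finite_setU; split; first exact: finite_set1.
  exact/finite_image/marked_finite.
move=> s sP; have [u su] := face_nonempty sP.
have [uo|us] := cball_split (face_in_ball sP su).
  by exists 0; [left|exact: face_oball sP su uo].
have [d dP] := sP; have [_ inj sur] := combX dP.
have sd v : s v -> open_cell X d (chi c v).
  by move=> sv; have [x _ sE] := dP; have [] : (ball_of c `&` chi c @^-1` open_cell X d) v
    by move: sv; rewrite sE => /connected_component_sub.
have du := sd u su.
have : (dim d < 2)%N by have := boundary_dim us du; rewrite [X in (_ < X)%N]c2.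
rewrite ltnS leq_eqVlt ltnS leqn0 => /orP[/eqP d1|/eqP d0].
  have [v sv vE] : exists2 v, s v & chi c v = edge_pt d 0.
    have : open_cell X d (edge_pt d 0).
      by exists (row_cst _ 0) => //; apply: row_cst_oball => //; rewrite ltrN10 ltr01.
    by move=> /sur[v sv <-]; exists v.
  have vS : sphere R (dim c) v.
    case: (cball_split (face_in_ball sP sv)) => // vo.
    have cd : c = d by apply: (open_cell_eq _ (sd v sv)); exists v.
    by exfalso; move: d1; rewrite -cd c2.
  have [t t01 tE] := circ_surj c2 vS.
  exists v => //; right; exists t => //; split=> //; right.
  rewrite /C /loop tE vE /edge_pt /edge_angle glueE; last by apply: row_cst_oball => //; rewrite ltrN10 ltr01.
  by rewrite ifT ?d1// crd_row ?d1// add0r mul1r div1r cs_half.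
have [t t01 tE] := circ_surj c2 us.
exists u => //; right; exists t => //; split=> //; left.
by apply/loop_C1; exists d => //; rewrite /loop tE.
Qed.

End Loop.

Lemma faces_finite c : finite_set [set p : face X | face_cell p = c].
Proof.
have := dim2 c; rewrite leq_eqVlt => /orP[/eqP c2|]; first exact: disc_faces_finite.
rewrite ltnS leq_eqVlt ltnS leqn0 => /orP[/eqP c1|/eqP c0].
  apply: (@sample_finite c ([set 0] `|` [set row_cst _ 1] `|` [set row_cst _ (-1)])).
    by rewrite !finite_setU; split; [split|]; exact: finite_set1.
  move=> s sP; have [u su] := face_nonempty sP.
  have [uo|/(sphere1 c1) us] := cball_split (face_in_ball sP su).
    by exists 0; [left; left|exact: face_oball sP su uo].
  by exists u => //; case: us => ->; [left; right|right].
apply: (@sample_finite c [set 0]); first exact: finite_set1.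
move=> s sP; have [u su] := face_nonempty sP; exists u => //.
exact: cball0.
Qed.

End Faces.

Lemma finite_separated (A : Type) (I J : Type) (ev : A -> I -> J) (F : set I) (S : set A) :
  finite_set F -> (forall i, finite_set [set ev a i | a in S]) ->
  (forall a b, S a -> S b -> (forall i, F i -> ev a i = ev b i) -> a = b) -> finite_set S.
Proof.
move=> /(@finite_seqP {classic I})[s ->]; elim: s S => [|i s IH] S fS SI.
  have [[a Sa]|S0] := pselect (S !=set0).
    by apply: sub_finite_set (finite_set1 a) => b Sb; exact: SI.
  by apply: sub_finite_set (finite_set0 A) => a Sa; apply: S0; exists a.
apply: (@sub_finite_set _ _ (\bigcup_(v in [set ev a i | a in S]) [set a | S a /\ ev a i = v])).
  by move=> a Sa; exists (ev a i) => //; exists a.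
apply: bigcup_finite => // v _; apply: IH => [j|a b [Sa av] [Sb bv] ab].
  by apply: sub_finite_set (fS j) => _ [a [Sa _] <-]; exists a.
apply: SI => // j; rewrite /= inE => /orP[/eqP ->|js]; first by rewrite av bv.
exact: ab.
Qed.

Section Stabilizers.
Variables (R : realType) (T : topologicalType) (X : cw_complex R T).
Local Notation I01 := (`[(0 : R), 1]%classic).
Implicit Types (c d : cell X) (g h : cw_aut X).
Hypotheses (combX : cw_combinatorial X) (dim2 : forall c, (dim c <= 2)%N)
  (lfX : cw_locally_finite X).
Variables (H : T * R -> T) (x0 : T).
Hypotheses (Hc : {within [set: T] `*` I01, continuous H})
  (H0 : forall x, H (x, 0) = x) (H1 : forall x, H (x, 1) = x0).

(** The indicator of the union of the closed cells with property [P] is constant on each closed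
    cell, hence constant. *)
Lemma cells_connected (P : cell X -> Prop) c :
  P c -> (forall d e, P d -> closed_cell d `&` closed_cell e !=set0 -> P e) -> forall d, P d.
Proof.
move=> Pc Pm d; pose N (x : T) := exists e, closed_cell e x /\ P e.
pose g (x : T) : R := (`[< N x >])%:R.
have open_pt e : closed_cell e (char_map X e 0).
  by exists 0 => //; exact/oball_cball/oball0.
have gE : g (char_map X c 0) = g (char_map X d 0).
  apply: (constant_on_cells lfX Hc H0 H1) => [x|e u v uB vB]; first by rewrite natr_int.
  congr (_ : bool)%:R; suff NN u' v' : cball R (dim e) u' -> cball R (dim e) v' -> N (char_map X e u') -> N (char_map X e v').
    by apply/asboolP/asboolP => Nx; [apply: (NN u v)|apply: (NN v u)].
  move=> uB' vB' [e' [eu Pe']]; exists e; split; first by exists v'.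
  by apply: Pm Pe' _; exists (char_map X e u'); split=> //; exists u'.
have [e [ed Pe]] : N (char_map X d 0).
  move: gE; rewrite /g [in LHS]asboolT; last by exists c.
  by case: asboolP => // _ /eqP; rewrite oner_eq0.
by apply: Pm Pe _; exists (char_map X d 0).
Qed.

Variable Gamma : set (cw_aut X).
Hypothesis GammaM : forall x y, Gamma x -> Gamma y -> Gamma (x * y)%g.
Hypothesis GammaV : forall x, Gamma x -> Gamma x^-1%g.
Hypothesis Gamma_discrete : exists2 U : set (cw_aut X), open U & U `&` Gamma = [set 1%g].

Definition cell_stab c : set (cw_aut X) := [set g | Gamma g /\ cell_act g c = c].

(** Finiteness propagates from [c] through intersecting cells: if [e] meets [d], an image of [e]
    meets the corresponding image of [d], and a closed cell meets only finitely many others. *)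
Lemma cell_orbit_finite c d : finite_set [set cell_act g d | g in cell_stab c].
Proof.
apply: (@cells_connected (fun d => finite_set [set cell_act g d | g in cell_stab c]) c).
  by apply: sub_finite_set (finite_set1 c) => _ [g [_ gc] <-].
move=> {}d e fd [x [xd xe]].
apply: (@sub_finite_set _ _ (\bigcup_(d' in [set cell_act g d | g in cell_stab c])
    [set e' : cell X | closed_cell e' `&` closed_cell d' !=set0])).
  move=> _ [g gS <-]; exists (cell_act g d); first by exists g.
  have [f rf] := realizes_ex g; exists (f x).
  by rewrite -!(realizes_closed _ rf); split; exists x.
by apply: bigcup_finite => // d' _; exact: meets_finite.
Qed.

Lemma face_orbit_finite c (p : face X) : finite_set [set g p | g in cell_stab c].
Proof.
apply: (@sub_finite_set _ _ (\bigcup_(d in [set cell_act g (face_cell p) | g in cell_stab c])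
    [set q : face X | face_cell q = d])).
  by move=> _ [g gS <-]; exists (cell_act g (face_cell p)); [exists g|exact: aut_face_cell].
by apply: bigcup_finite => [|d _]; [exact: cell_orbit_finite|exact: faces_finite].
Qed.

(** Discreteness provides a finite set of faces whose pointwise stabiliser in [Gamma] is trivial. An
    element of the cell stabiliser is determined by its values on these faces, each of which has a
    finite orbit. *)
Lemma cell_stab_finite c : finite_set (cell_stab c).
Proof.
have [U oU UE] := Gamma_discrete; have [F fF FU] : exists2 F : set (face X), finite_set F &
    forall y : cw_aut X, (forall p, F p -> y p = p) -> U y.
  apply/(@aut_nbhsP _ _ _ 1%g)/open_nbhs_nbhs; split=> //.
  by have : [set 1%g] (1%g : cw_aut X) by []; rewrite -UE => -[].
apply: (@finite_separated _ _ _ (fun (g : cw_aut X) p => g p) F) => //; first exact: face_orbit_finite.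
move=> a b [Ga _] [Gb _] ab.
have : [set 1%g] (b^-1 * a)%g.
  rewrite -UE; split; last by apply: GammaM => //; exact: GammaV.
  by apply: FU => p Fp; rewrite -[(b^-1 * a)%g p]/(aut_inv b (a p)) ab// aut_funK.
by move=> /= e; rewrite -[a]mul1g -(mulgV b) -mulgA e mulg1.
Qed.

End Stabilizers.

(** * Finite subgroups *)

Section SubgroupType.
Variables (G : groupType) (H : subgroup G).

Definition subgroup_type := {x : G | `[< subgroup_set H x >]}.
HB.instance Definition _ := Choice.on subgroup_type.

Lemma subgroup_typeP (x : subgroup_type) : subgroup_set H (val x).
Proof. exact/asboolP/(valP x). Qed.

Definition subgroup_mk x (Hx : subgroup_set H x) : subgroup_type := exist _ x (asboolT Hx).
Definition subgroup_one := subgroup_mk (subgroup1 H).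
Definition subgroup_mul (x y : subgroup_type) :=
  subgroup_mk (subgroupM (subgroup_typeP x) (subgroup_typeP y)).
Definition subgroup_inv (x : subgroup_type) := subgroup_mk (subgroupV (subgroup_typeP x)).

Lemma subgroup_mulA : associative subgroup_mul.
Proof. by move=> x y z; apply: val_inj; rewrite /= mulgA. Qed.
Lemma subgroup_mul1 : left_id subgroup_one subgroup_mul.
Proof. by move=> x; apply: val_inj; rewrite /= mul1g. Qed.
Lemma subgroup_mulr1 : right_id subgroup_one subgroup_mul.
Proof. by move=> x; apply: val_inj; rewrite /= mulg1. Qed.
Lemma subgroup_mulV : left_inverse subgroup_one subgroup_inv subgroup_mul.
Proof. by move=> x; apply: val_inj; rewrite /= mulVg. Qed.
Lemma subgroup_mulrV : right_inverse subgroup_one subgroup_inv subgroup_mul.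
Proof. by move=> x; apply: val_inj; rewrite /= mulgV. Qed.

HB.instance Definition _ := isGroup.Build subgroup_type
  subgroup_mulA subgroup_mul1 subgroup_mulr1 subgroup_mulV subgroup_mulrV.

Lemma subgroup_valM (x y : subgroup_type) : val (x * y)%g = (val x * val y)%g. Proof. by []. Qed.

Lemma subgroup_presentation : finitely_presented H ->
  exists n (rels : seq (word n)) (x : 'I_n -> subgroup_type),
    (forall g, exists w, word_eval x w = g) /\
    (forall v w, word_eval x v = word_eval x w <-> word_conv rels v w).
Proof.
move=> [n [rels [x [rx xP]]]].
have xH i : subgroup_set H (x i).
  by rewrite -rx; exists [:: (i, true)] => //; rewrite /word_eval big_seq1.
pose y i := subgroup_mk (xH i).
have yE w : val (word_eval y w) = word_eval x w.
  elim: w => [|[i b] w IH]; first by rewrite /word_eval !big_nil.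
  rewrite /word_eval !big_cons subgroup_valM -/(word_eval y w) IH.
  by case: b.
exists n, rels, y; split=> [g|v w].
  have : range (word_eval x) (val g) by rewrite rx; exact: subgroup_typeP.
  by move=> [w _ wg]; exists w; apply: val_inj; rewrite yE.
by rewrite -xP -!yE; split=> [->|/val_inj].
Qed.

End SubgroupType.

Section BoundedSubgroups.
Import multinomials.freeg.
Variables (R : realType) (T : topologicalType) (X : cw_complex R T) (Gamma : subgroup (cw_aut X)).
Hypotheses (combX : cw_combinatorial X) (lfX : cw_locally_finite X) (dim2 : cw_has_dim X 2)
  (ctrX : contractible R T) (discr : discrete_subgroup Gamma) (fpG : finitely_presented Gamma).
Local Notation Gam := (subgroup_type Gamma).
Local Notation le2 := (proj1 dim2).

Definition cell_gset (k : nat) : gset Gam.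
Proof.
refine (@GSet Gam (kcell X k) (fun g a => kact combX le2 (val g) a) _ _).
- by move=> a; exact: kact1.
- by move=> g h a; exact: kactM.
Defined.

Lemma cell_gset_stabilizers k : finite_stabilizers (cell_gset k).
Proof.
have [H [x0 [Hc H0 H1]]] := ctrX.
have [U oU UE] := discr (subgroup1 Gamma).
move=> a /=.
have := @cell_stab_finite R T X combX le2 lfX H x0 Hc H0 H1 Gamma
  (@subgroupM _ Gamma) (@subgroupV _ Gamma) (ex_intro2 _ _ U oU UE) (kval a).
move=> fS; apply: (@finite_separated Gam unit (cw_aut X) (fun g _ => val g) [set tt]) => //.
- move=> _; apply: sub_finite_set fS => _ [g ga <-]; split; first exact: subgroup_typeP.
  by rewrite -[in RHS]ga.
- by move=> g h _ _ /(_ tt erefl) /val_inj.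
Qed.

Definition chain0 : monomial (cell_gset 0).
Proof.
refine (@Monomial Gam (cell_gset 0) (fun g => act0 combX le2 (val g)) _ _ _).
- by move=> y; exact: act0_1.
- by move=> g h y; exact: act0_M.
- by move=> g a; exists 1; rewrite scale1r; exact: act0E.
Defined.

Definition chain1 : monomial (cell_gset 1).
Proof.
refine (@Monomial Gam (cell_gset 1) (fun g => act1 combX le2 (val g)) _ _ _).
- by move=> y; exact: act1_1.
- by move=> g h y; exact: act1_M.
- by move=> g a; exists ((-1) ^+ sigma combX le2 (val g) a); exact: act1E.
Defined.

(** The factors are chosen separately for each [g] and [c]. That they form an action is forced by
    the injectivity of [D2], which intertwines them with the action on edges. *)
Definition act2 (g : cw_aut X) := basis_ext (fun c : kcell X 2 =>
  projT1 (cid (boundary_act combX le2 g c)) *: << kact combX le2 g c >> : {freeg (kcell X 2) / rat}).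
HB.instance Definition _ g := GRing.Linear.on (act2 g).

Lemma D2_act g z : D2 (act2 g z) = act1 combX le2 g (D2 z).
Proof.
move: z; apply: (@linear_eq_basis _ _ (@D2 R T X \o act2 g) (act1 combX le2 g \o @D2 R T X)) => c /=.
by rewrite /act2 basis_extE linearZ /=; case: cid => k /= <-.
Qed.

Lemma D2_eq (y z : {freeg (kcell X 2) / rat}) : D2 y = D2 z -> y = z.
Proof.
have [H [x0 [Hc H0 H1]]] := ctrX; move=> e; apply/eqP; rewrite -subr_eq0; apply/eqP.
by apply: (D2_inj lfX le2 Hc H0 H1); rewrite linearB /= e subrr.
Qed.

Definition chain2 : monomial (cell_gset 2).
Proof.
refine (@Monomial Gam (cell_gset 2) (fun g => act2 (val g)) _ _ _).
- by move=> y; apply: D2_eq; rewrite D2_act act1_1.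
- by move=> g h y; apply: D2_eq; rewrite !D2_act act1_M.
- by move=> g a; eexists; exact: basis_extE.
Defined.

Lemma vertex_ex : exists v : kcell X 0, True.
Proof.
have [c c2] := proj2 dim2.
have [d dt] := in_open_cell X (loop c 0).
have d2 : (dim d < 2)%N by rewrite -[X in (_ < X)%N]c2; exact: boundary_dim (circ_sphere 0 c2) dt.
move: d2; rewrite ltnS leq_eqVlt ltnS leqn0 => /orP[/eqP d1|/eqP d0].
  by have [e _] := kval_ex d1; exists (endpt e true).
by have [v _] := kval_ex d0; exists v.
Qed.

Lemma lattice_finite_subgroups_bounded : exists m : nat, forall S : seq (cw_aut X),
  (forall g, g \in S -> subgroup_set Gamma g) -> uniq S -> 1%g \in S ->
  {in S &, forall a b, (a * b)%g \in S} -> {in S, forall a, a^-1%g \in S} -> (size S <= m)%N.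
Proof.
have [n [rels [x [sx xP]]]] := subgroup_presentation fpG.
have [H [x0 [Hc H0 H1]]] := ctrX; have [v0 _] := vertex_ex.
have [||||||||m mP] := @finite_subgroups_bounded Gam n rels x sx xP _ _ _ chain0 chain1 chain2
  (@cell_gset_stabilizers 0) (@cell_gset_stabilizers 1) (@cell_gset_stabilizers 2) (@D1 R T X) (@D2 R T X) v0.
- by move=> g z; exact: D1_act.
- by move=> g z; exact: D2_act.
- move=> g; apply: (@linear_eq_basis _ rat^o (basis_ext (fun=> 1 : rat^o) \o act0 combX le2 (val g)) (basis_ext (fun=> 1 : rat^o))) => v /=.
  by rewrite act0E !basis_extE.
- exact: e0_D1.
- exact: D1_D2.
- move=> y ye; apply: (exact_D1 lfX le2 Hc H0 H1 v0); exact: ye.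
- move=> y ye; apply: (exact_D2 lfX le2 Hc H0 H1); exact: ye.
- move=> y ye; apply: (D2_inj lfX le2 Hc H0 H1); exact: ye.
exists m => S SG uS S1 SM SV.
pose S' : seq Gam := pmap insub S.
have S'E : map val S' = S.
  rewrite /S' pmap_filter; last exact: insubK.
  by apply/all_filterP/allP => g /SG Gg; rewrite isSome_insub; apply/asboolP.
have memS (g : Gam) : (g \in S') = (val g \in S) by rewrite -S'E mem_map//; exact: val_inj.
rewrite -S'E size_map; apply: mP; first by rewrite -(map_inj_uniq val_inj) S'E.
- by rewrite memS.
- by move=> a b; rewrite !memS; exact: SM.
- by move=> a; rewrite !memS; exact: SV.
Qed.

End BoundedSubgroups.

(** * Haar measure and covolume *)

Section GroupTopology.
Variable G : topologicalGroupType.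
Implicit Types (g h x y : G) (A U : set G).

Definition translate g A : set G := [set (g * x)%g | x in A].

Lemma translateE g A : translate g A = [set y | A (g^-1 * y)%g].
Proof.
apply/seteqP; split=> [_ [x Ax <-]|y Ay]; first by rewrite /= mulKg.
by exists (g^-1 * y)%g => //; rewrite mulVKg.
Qed.

Lemma mulg_cont (U : topologicalType) (f h : U -> G) :
  continuous f -> continuous h -> continuous (fun u => f u * h u)%g.
Proof.
move=> cf ch u; apply: (@cvg_comp _ _ _ (fun u => (f u, h u)) (fun p => p.1 * p.2)%g).
  exact: cvg_pair (cf u) (ch u).
exact: (@mulg_continuous G (f u, h u)).
Qed.

Lemma lmul_cont g : continuous (fun x => g * x)%g.
Proof. by apply: mulg_cont => x; [exact: cvg_cst|exact: cvg_id]. Qed.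

Lemma rmul_cont g : continuous (fun x => x * g)%g.
Proof. by apply: mulg_cont => x; [exact: cvg_id|exact: cvg_cst]. Qed.

Lemma open_translate g A : open A -> open (translate g A).
Proof. by move=> oA; rewrite translateE; apply: open_comp => // x _; exact: lmul_cont. Qed.

Lemma compact_translate g A : compact A -> compact (translate g A).
Proof.
by move=> cA; apply: continuous_compact => //; apply: continuous_subspaceT; exact: lmul_cont.
Qed.

Lemma open_subgroup_closed (W : subgroup G) : open (W : set G) -> closed (W : set G).
Proof.
move=> oW x clx; have [|y [Wy]] := clx (translate x W).
  apply: open_nbhs_nbhs; split; first exact: open_translate.
  by exists 1%g; [exact: subgroup1|rewrite mulg1].
move=> [w Ww wE]; rewrite -[x](mulgK w) wE.
by apply: subgroupM => //; exact: subgroupV.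
Qed.

(** Each translate of [W] contains at most one element of [Gamma]. *)
Lemma discrete_compact_finite (Gamma W : subgroup G) (K : set G) : open (W : set G) ->
  (forall g, subgroup_set Gamma g -> subgroup_set W g -> g = 1%g) -> compact K -> finite_set (K `&` Gamma).
Proof.
move=> oW WG cK.
have := @compact_locally_finite G G K (fun x => [set h | subgroup_set Gamma h /\ h = x]) cK.
have -> : \bigcup_(x in K) [set h | subgroup_set Gamma h /\ h = x] = K `&` Gamma.
  by apply/seteqP; split=> [h [x Kx [Gh hx]]|h [Kh Gh]]; [rewrite -hx in Kx|exists h].
apply=> x _; exists (translate x W).
  apply: open_nbhs_nbhs; split; first exact: open_translate.
  by exists 1%g; [exact: subgroup1|rewrite mulg1].
set B := \bigcup_(_ in _) _.
have Beq a b : B a -> B b -> a = b.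
  move=> [_ [w Ww <-] [Ga aE]] [_ [w' Ww' <-] [Gb bE]]; rewrite aE in Ga; rewrite bE in Gb.
  rewrite aE bE; congr (_ * _)%g.
  apply: (@mulgI _ w^-1%g); rewrite mulVg; apply/esym/WG; last first.
    by apply: subgroupM => //; exact: subgroupV.
  have -> : (w^-1 * w')%g = ((x * w)^-1 * (x * w'))%g by rewrite invgM -mulgA mulKg.
  by apply: subgroupM => //; exact: subgroupV.
have [[a Ba]|B0] := pselect (B !=set0).
  by apply: sub_finite_set (finite_set1 a) => b Bb; exact: Beq.
by apply: sub_finite_set (finite_set0 G) => a Ba; apply: B0; exists a.
Qed.

Lemma compact_cosets (W : subgroup G) (K : set G) : open (W : set G) -> compact K ->
  exists s : seq G, forall y, K y -> exists2 g, g \in s & subgroup_set W (g^-1 * y)%g.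
Proof.
move=> oW cK; pose r x := get (translate x W).
have r_in x : translate x W (r x).
  by apply: (@getI _ _ x); exists 1%g; [exact: subgroup1|rewrite mulg1].
have r_eq x y : translate x W y -> r x = r y.
  move=> [w Ww <-]; rewrite /r; congr get; apply/seteqP; split=> z.
    move=> [v Wv <-]; exists (w^-1 * v)%g; last by rewrite -mulgA mulVKg.
    by apply: subgroupM => //; exact: subgroupV.
  by move=> [v Wv <-]; exists (w * v)%g; [exact: subgroupM|rewrite mulgA].
have /finite_seqP[s sE] : finite_set (\bigcup_(x in K) [set r x]).
  apply: compact_locally_finite => // x _; exists (translate x W).
    apply: open_nbhs_nbhs; split; first exact: open_translate.
    by exists 1%g; [exact: subgroup1|rewrite mulg1].
  by apply: sub_finite_set (finite_set1 (r x)) => _ [y xy ->]; rewrite /= (r_eq _ _ xy).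
exists s => y Ky; exists (r y).
  have : (\bigcup_(x in K) [set r x]) (r y) by exists y.
  by rewrite sE.
have [w Ww <-] := r_in y; rewrite invgM -mulgA mulVg mulg1.
exact: subgroupV.
Qed.

End GroupTopology.

Section Haar.
Variables (R : realType) (G : topologicalGroupType) (mu : borel_measure R G).
Hypotheses (mu_haar : is_haar mu) (haus : hausdorff_space G).
Hypothesis open_subgroup_basis : forall A : set G, nbhs 1%g A ->
  exists2 W : subgroup G, open (W : set G) & (W : set G) `<=` A.
Implicit Types (g h x y : G) (A B : set G).
Local Notation borel := (g_sigma_algebraType (@open G)).
Local Notation mble := (measurable : set (set borel)).

Lemma open_mble A : open A -> mble A.
Proof. exact: sub_sigma_algebra. Qed.

Lemma compact_mble A : compact A -> mble A.
Proof.
move=> cA; rewrite -[A]setCK; apply: measurableC; apply: open_mble.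
by rewrite openC; exact: compact_closed.
Qed.

Lemma translate_mble g A : mble A -> mble (translate g A).
Proof.
have : measurable_fun setT ((fun x => g^-1 * x)%g : borel -> borel).
  apply: (@measurability _ _ borel borel setT _ (@open G)) => // _ [B oB <-]; rewrite setTI.
  by apply: open_mble; apply: open_comp => // x _; exact: lmul_cont.
by move=> mf mA; rewrite translateE; have := mf measurableT A mA; rewrite setTI.
Qed.

Lemma mu_translate g A : mble A -> mu (translate g A) = mu A.
Proof. by case: mu_haar => + _ _ _ _ mA; exact. Qed.

Lemma mu_mono A B : mble A -> mble B -> A `<=` B -> (mu A <= mu B)%E.
Proof. by move=> mA mB AB; apply: le_measure; rewrite ?inE. Qed.

Lemma mu_cover (s : seq G) (E A : set G) : mble E -> mble A ->
  (forall y, A y -> exists2 g, g \in s & E (g^-1 * y)%g) ->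
  (mu A <= (size s)%:R%:E * mu E)%E.
Proof.
move=> mE; elim: s A => [|g s IH] A mA cov.
  rewrite mul0e (_ : A = set0) ?measure0//.
  by apply/seteqP; split=> // y /cov[].
have mg := translate_mble g mE.
have -> : A = (A `&` translate g E) `|` (A `\` translate g E) by rewrite setUIDK.
rewrite measureU//; [|exact: measurableI|exact: measurableD|]; last first.
  by apply/seteqP; split=> // y [[_ ?] [_]].
rewrite /= -natr1 EFinD addeC ge0_muleDl ?lee_fin ?ler0n ?ler01//.
rewrite mul1e; apply: leeD.
  rewrite -(mu_translate g mE); apply: mu_mono => //; exact: measurableI.
apply: IH; first exact: measurableD.
move=> y [/cov[h + hE] gE]; rewrite inE => /orP[/eqP hg|hs]; last by exists h.
by case: gE; rewrite translateE /= -hg.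
Qed.

Lemma compact_mu_pos : exists2 K : set G, compact K & (0 < mu K)%E.
Proof.
have [_ _ _ inner mu0] := mu_haar.
have : (0 < mu [set: G])%E by rewrite lt_neqAle measure_ge0 andbT; apply/eqP => /esym.
by rewrite (inner _ openT) => /ereal_sup_gt[_ [K [cK _] <-]]; exists K.
Qed.

Lemma compact_mu_fin K : compact K -> mu K \is a fin_num.
Proof.
by have [_ fin _ _ _] := mu_haar; move=> cK; rewrite ge0_fin_numE ?measure_ge0//; exact: fin.
Qed.

(* Steinhaus: if [K] is compact and [mu K > 0], then [K K^-1] is a neighbourhood of [1]. *)
Lemma compact_open_subgroup : exists U : subgroup G, open (U : set G) /\ compact (U : set G).
Proof.
have [K cK K0] := compact_mu_pos; have [_ _ outer _ _] := mu_haar.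
have mK := compact_mble cK; have fK := compact_mu_fin cK.
(* Outer regularity gives an open [V] around [K] of measure less than twice that of [K]. If [w K],
   contained in [V], were disjoint from [K], the two together would exceed that measure. *)
have : (mu K < mu K + mu K)%E by rewrite lteDl.
rewrite [ltLHS](outer K mK) => /ereal_inf_lt[_ [V [oV KV] <-] VK].
have nV : \forall w \near (1%g : G), K `<=` [set x | V (w * x)%g].
  move/compact_near_coveringP : cK => /(_ G (nbhs (1%g : G)) (fun w x => V (w * x)%g) _); apply.
  move=> x Kx.
  have : nbhs (1%g, x) [set p : G * G | V (p.1 * p.2)%g].
    by apply: (@mulg_continuous G (1%g, x) V); rewrite /= mul1g; apply: open_nbhs_nbhs; split=> //; exact: KV.
  move=> [[A B] /= [nA nB] AB].
  by exists (B, A) => // -[y w] /= [By Aw]; exact: (AB (w, y)).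
have [U oU UV] := open_subgroup_basis nV.
exists U; split=> //.
apply: (@subclosed_compact _ _ [set (x * y^-1)%g | x in K & y in K]).
- exact: open_subgroup_closed.
- have -> : [set (x * y^-1)%g | x in K & y in K] = (fun p => p.1 * p.2^-1)%g @` (K `*` K).
    by apply/seteqP; split=> [_ [x Kx [y Ky <-]]|_ [[x y] [Kx Ky] <-]]; [exists (x, y)|exists x => //; exists y].
  apply: continuous_compact; last exact: compact_setX.
  apply: continuous_subspaceT; apply: mulg_cont => p; first exact: cvg_fst.
  by apply: (@cvg_comp _ _ _ snd (fun x => x^-1)%g); [exact: cvg_snd|exact: invg_continuous].
move=> w Uw; apply: contrapT => nw.
have mwK := translate_mble w mK.
have wKV : translate w K `<=` V by move=> _ [x Kx <-]; exact: UV.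
have : (mu K + mu K <= mu V)%E.
  rewrite -{1}(mu_translate w mK) -measureU//; last first.
    apply/seteqP; split=> // _ [[x Kx <-] Kwx]; apply: nw; exists (w * x)%g => //.
    by exists x => //; rewrite mulgK.
  apply: mu_mono; [exact: measurableU|exact: open_mble|].
  by move=> x [/wKV|/KV].
by move=> /(lt_le_trans VK); rewrite ltxx.
Qed.

(** Finitely many translates of [U] cover a compact set of positive measure. *)
Lemma open_mu_pos (U : subgroup G) : open (U : set G) -> (0 < mu (U : set G))%E.
Proof.
move=> oU; have [K cK K0] := compact_mu_pos; have [s sP] := compact_cosets oU cK.
rewrite lt_neqAle measure_ge0 andbT; apply/eqP => U0.
have := mu_cover (open_mble oU) (compact_mble cK) sP.
by rewrite -U0 mule0 leNgt K0.
Qed.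

End Haar.

(** * Covolume and double cosets *)

Section Covolume.
Variables (R : realType) (G : topologicalGroupType) (mu : borel_measure R G) (Gamma : subgroup G).
Hypotheses (mu_haar : is_haar mu) (haus : hausdorff_space G).
Hypothesis open_subgroup_basis : forall A : set G, nbhs 1%g A ->
  exists2 W : subgroup G, open (W : set G) & (W : set G) `<=` A.
Hypotheses (discr : discrete_subgroup Gamma) (covol : finite_covolume mu Gamma).
Variables (e : nat -> G) (m : nat).
Hypotheses (e_Gamma : forall n, subgroup_set Gamma (e n))
  (e_surj : forall h, subgroup_set Gamma h -> exists n, e n = h).
Hypothesis bounded : forall S : seq G, (forall g, g \in S -> subgroup_set Gamma g) ->
  uniq S -> 1%g \in S -> {in S &, forall a b, (a * b)%g \in S} ->
  {in S, forall a, a^-1%g \in S} -> (size S <= m)%N.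
Implicit Types (g h x y : G) (A B : set G).
Local Notation borel := (g_sigma_algebraType (@open G)).
Local Notation mble := (measurable : set (set borel)).

Section DoubleCosets.
Variable U : subgroup G.
Hypotheses (oU : open (U : set G)) (cU : compact (U : set G)).
Variable F : set G.
Hypotheses (mF : mble F) (F_fund : forall y, exists! x, F x /\
  exists2 h, subgroup_set Gamma h & y = (h * x)%g).
Hypothesis F_fin : (mu F < +oo)%E.

Definition double_coset g : set G := \bigcup_(h in (Gamma : set G)) translate h (translate g U).

Lemma open_double_coset g : open (double_coset g).
Proof. by apply: bigcup_open => h _; apply/open_translate/open_translate. Qed.

Let conj g a := subgroup_set U (g^-1 * a * g)%g.

Let conj1 g : conj g 1%g.
Proof. by rewrite /conj mulg1 mulVg; exact: subgroup1. Qed.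

Let conjM g a b : conj g a -> conj g b -> conj g (a * b)%g.
Proof. by move=> ca /(subgroupM ca); rewrite /conj !mulgA mulgK. Qed.

Let conjV g a : conj g a -> conj g a^-1%g.
Proof. by move=> /subgroupV; rewrite /conj !invgM invgK mulgA. Qed.

Let conj_translate g a y : conj g a -> translate g U y -> translate g U (a * y)%g.
Proof. by rewrite !translateE /= => ca /(subgroupM ca); rewrite -!mulgA mulVKg. Qed.

Let translate_conj g y z : translate g U y -> translate g U z -> conj g (y * z^-1)%g.
Proof.
by rewrite !translateE /= => yU /subgroupV /(subgroupM yU); rewrite /conj invgM invgK !mulgA.
Qed.

(** The conjugate of [U] by [g] is compact, so it meets the discrete group in a finite subgroup. The
    bound [m] does not depend on [g]. *)
Lemma conj_finite g : exists s : seq G, [/\ uniq s, (size s <= m)%N &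
  forall a, (a \in s) = `[< subgroup_set Gamma a /\ conj g a >]].
Proof.
have [V oV VE] := discr (subgroup1 Gamma).
have [|W oW WV] := open_subgroup_basis (A := V).
  apply: open_nbhs_nbhs; split=> //.
  by have : [set 1%g] (1%g : G) by []; rewrite -VE => -[].
have WG h : subgroup_set Gamma h -> subgroup_set W h -> h = 1%g.
  by move=> Gh /WV Vh; have : [set 1%g] h by rewrite -VE.
have cK : compact ((fun x => x * g^-1)%g @` translate g U).
  apply: continuous_compact; last exact: compact_translate.
  by apply: continuous_subspaceT; exact: rmul_cont.
have /finite_seqP[s sE] := discrete_compact_finite oW WG cK.
have mem_s a : (a \in undup s) = `[< subgroup_set Gamma a /\ conj g a >].
  rewrite mem_undup; apply/idP/asboolP => [sa|[Ga ca]].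
    have : [set` s] a by [].
    rewrite -sE => -[[y yg yE] Ga]; split=> //.
    by move: yg; rewrite translateE /conj /= -yE -mulgA mulgVK.
  suff : [set` s] a by [].
  rewrite -sE; split=> //; exists (a * g)%g; last by rewrite mulgK.
  by rewrite translateE /= mulgA.
exists (undup s); split=> //; first exact: undup_uniq.
apply: bounded => [a|||a b|a].
- by rewrite mem_s => /asboolP[].
- exact: undup_uniq.
- by rewrite mem_s; apply/asboolP; split; [exact: subgroup1|exact: conj1].
- rewrite !mem_s => /asboolP[Ga ca] /asboolP[Gb cb]; apply/asboolP.
  by split; [exact: subgroupM|exact: conjM].
- rewrite !mem_s => /asboolP[Ga ca]; apply/asboolP.
  by split; [exact: subgroupV|exact: conjV].
Qed.

(* Along a transversal of the finite group [Gamma `&` g U g^-1] in [Gamma], the translates of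
   [g U] are disjoint; each of them is cut by [F] in a translate of a piece of [g U], and
   these pieces cover [g U] up to that finite group. *)
Lemma double_coset_mass g : (mu (U : set G) <= m%:R%:E * mu (double_coset g `&` F))%E.
Proof.
have [s [us sm mem_s]] := conj_finite g.
have mU : mble (U : set G) by exact: open_mble.
have mgU : mble (translate g U) by exact: translate_mble.
(* Selects the first index of each left coset of the finite group in the enumeration [e]. This gives
   the transversal, and also discards the repetitions of [e]. *)
pose J n := forall k, (k < n)%N -> ~ conj g ((e n)^-1 * e k)%g.
pose P n : set G := if pselect (J n) is left _ then
  translate g U `&` translate (e n)^-1%g F else set0.
have mP n : mble (P n).
  rewrite /P; case: pselect => _; last exact: measurable0.
  by apply: measurableI => //; exact: translate_mble.
have PE n y : P n y -> [/\ J n, translate g U y & F (e n * y)%g].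
  by rewrite /P; case: pselect => // Jn [gy]; rewrite translateE /= invgK.
have mPs : mble (\bigcup_n P n) by exact: bigcupT_measurable.
(* With [y = h x] and [x] in [F], let [n] be the first index for which [e n] lies in the coset of
   [h^-1]. The element [(e n)^-1 h^-1] of the finite group then moves [y] into the piece [P n]. *)
have cover y : translate g U y -> exists2 h, h \in s & (\bigcup_n P n) (h^-1 * y)%g.
  move=> gy; have [x [[Fx [h Gh yE]] _]] := F_fund y.
  have ex_n : exists n, `[< conj g ((e n)^-1 * h^-1)%g >].
    have [n nE] := e_surj (subgroupV Gh); exists n; apply/asboolP.
    by rewrite nE invgK mulgV.
  case: (ex_minnP ex_n) => n /asboolP cn nmin.
  exists ((e n)^-1 * h^-1)^-1%g.
    rewrite mem_s; apply/asboolP; split; last exact: conjV.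
    by apply: subgroupV; apply: subgroupM; apply: subgroupV.
  exists n => //; rewrite /P; case: pselect => [_|nJ].
    rewrite invgK; split; first exact: conj_translate.
    by rewrite translateE /= invgK yE -mulgA mulVKg mulKg.
  case: nJ => k kn ck; have := nmin k; rewrite leqNgt kn => K; suff : false by [].
  apply: K; apply/asboolP.
  have -> : ((e k)^-1 * h^-1 = ((e n)^-1 * e k)^-1 * ((e n)^-1 * h^-1))%g.
    by rewrite invgM invgK -mulgA mulVKg.
  by apply: conjM => //; exact: conjV.
have c1 := mu_cover mu_haar mPs mgU cover.
rewrite (mu_translate mu_haar g mU) in c1; apply: le_trans c1 _.
have le1 : (mu (\bigcup_n P n) <= mu (double_coset g `&` F))%E.
  apply: (@le_trans _ _ (\sum_(0 <= n <oo) mu (P n))%E).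
    exact: measure_sigma_subadditive.
  under eq_eseriesr => n _ do rewrite -(mu_translate mu_haar (e n) (mP n)).
  have mT n : mble (translate (e n) (P n)) by exact: translate_mble.
  rewrite -measure_semi_bigcup//; last first.
  - exact: bigcupT_measurable.
  - apply/trivIsetP => i j _ _ ij; apply/seteqP; split=> // z [].
    rewrite !translateE => /PE[Ji gi _] /PE[Jj gj _]; case/negP: ij; apply/eqP.
    have cij : conj g ((e i)^-1 * e j)%g.
      have := translate_conj gi gj; rewrite invgM invgK.
      by rewrite mulgA mulgK.
    have cji : conj g ((e j)^-1 * e i)%g by have := conjV cij; rewrite invgM invgK.
    by case: (ltngtP i j) => [/Jj|/Ji|].
  apply: mu_mono => //; first exact: bigcupT_measurable.
    apply: measurableI => //; apply: open_mble; exact: open_double_coset.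
  move=> z [n _ [y /PE[_ gy Fy] <-]]; split=> //.
  by exists (e n) => //; exists y.
apply: (@le_trans _ _ (m%:R%:E * mu (\bigcup_n P n))%E).
  by apply: lee_wpmul2r => //; rewrite lee_fin ler_nat.
by apply: lee_wpmul2l => //; rewrite lee_fin ler0n.
Qed.

Let mass A := fine (mu (A `&` F)).

(** As long as the listed double cosets do not exhaust the group, a further one is disjoint from
    them and adds at least the measure of [U] divided by [m] to the mass inside [F]. *)
Lemma disjoint_double_cosets N :
  (exists s : seq G, (N%:R * fine (mu (U : set G)) <= m%:R * mass (\bigcup_(g in [set` s]) double_coset g))) \/
  (exists s : seq G, forall y, exists2 g, g \in s & double_coset g y).
Proof.
have fin A : open A -> mu (A `&` F) \is a fin_num.
  move=> oA; rewrite ge0_fin_numE; last exact: measure_ge0.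
  apply: le_lt_trans F_fin; apply: mu_mono => //.
  by apply: measurableI => //; exact: open_mble.
have oD (s : seq G) : open (\bigcup_(g in [set` s]) double_coset g).
  by apply: bigcup_open => g _; exact: open_double_coset.
elim: N => [|N [[s sN]|]]; [|have [cov|ncov] := pselect (forall y, exists2 g, g \in s & double_coset g y)|].
- by left; exists [::]; rewrite mul0r mulr_ge0// fine_ge0.
- by right; exists s.
- left; move/existsNP: ncov => [y ny]; exists (y :: s).
  have -> : \bigcup_(g in [set` y :: s]) double_coset g =
      double_coset y `|` \bigcup_(g in [set` s]) double_coset g.
    apply/seteqP; split=> [z [g]|z [yz|[g gs gz]]].
    - by rewrite /= inE => /orP[/eqP ->|gs]; [left|right; exists g].
    - by exists y; rewrite //= mem_head.
    - by exists g; rewrite //= inE gs orbT.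
  have -> : mass (double_coset y `|` \bigcup_(g in [set` s]) double_coset g) =
      mass (double_coset y) + mass (\bigcup_(g in [set` s]) double_coset g).
    rewrite /mass -fineD; [|exact/fin/open_double_coset|exact: fin].
    rewrite setIUl measureU//.
    - by apply: measurableI => //; apply: open_mble; exact: open_double_coset.
    - by apply: measurableI => //; exact: open_mble.
    apply/seteqP; split=> // z [[[h Gh [_ [u Uu <-] zE]] _] [[g gs [h' Gh' [_ [u' Uu' <-] zE']]] _]].
    apply: ny; exists g => //; exists (h^-1 * h')%g.
      by apply: subgroupM => //; exact: subgroupV.
    exists (g * (u' * u^-1))%g.
      by exists (u' * u^-1)%g => //; apply: subgroupM => //; exact: subgroupV.
    apply: (@mulgI _ h); apply: (@mulIg _ u).
    by rewrite -[RHS]mulgA zE -zE' -!mulgA mulVKg mulVg mulg1.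
  have := double_coset_mass y; rewrite -(fineK (fin _ (open_double_coset y))).
  rewrite -(fineK (compact_mu_fin mu_haar cU)) -EFinM lee_fin -/(mass _) => h.
  by rewrite -natr1 mulrDl mul1r mulrDr addrC lerD.
- by right.
Qed.

Lemma finite_double_cosets : exists s : seq G, forall y, exists2 g, g \in s & double_coset g y.
Proof.
pose u := fine (mu (U : set G)); pose f := fine (mu F).
have u0 : 0 < u.
  rewrite fine_gt0// (open_mu_pos mu_haar haus oU) /=.
  by rewrite -ge0_fin_numE ?measure_ge0//; exact: compact_mu_fin.
have f0 : 0 <= f by rewrite fine_ge0.
(* For this many double cosets the mass inside [F] would exceed that of [F]. *)
have [[s sN]|//] := disjoint_double_cosets (Num.bound (m%:R * f / u)).
have : m%:R * f / u < (Num.bound (m%:R * f / u))%:R.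
  by apply: archi_boundP; rewrite divr_ge0 ?mulr_ge0 ?ler0n// ltW.
rewrite ltr_pdivrMr// => /lt_le_trans /(_ sN); rewrite ltNge ler_wpM2l ?ler0n//.
apply: fine_le; last apply: mu_mono => //.
- rewrite ge0_fin_numE; last exact: measure_ge0.
  apply: le_lt_trans F_fin; apply: mu_mono => //.
  apply: measurableI => //; apply: open_mble; apply: bigcup_open => g _.
  exact: open_double_coset.
- by rewrite ge0_fin_numE// measure_ge0.
- apply: measurableI => //; apply: open_mble; apply: bigcup_open => g _.
  exact: open_double_coset.
Qed.

End DoubleCosets.

Theorem bounded_finite_subgroups_uniform : is_uniform Gamma.
Proof.
have [U [oU cU]] := compact_open_subgroup mu_haar haus open_subgroup_basis.
have [F [mF Ff Ffin]] := covol.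
have [s sP] := finite_double_cosets oU cU mF Ff Ffin.
pose p : G -> orbit_space Gamma := \pi_(orbit_space Gamma)%qT.
rewrite /is_uniform; have -> : [set: orbit_space Gamma] = \big[setU/set0]_(g <- s) (p @` translate g U).
  rewrite -bigcup_seq; apply/seteqP; split=> // q _.
  have [g gs [h Gh [y gy yE]]] := sP (repr q); exists g => //; exists y => //.
  rewrite -[q]reprK; apply/eqmodP; apply/asboolP.
  by rewrite -yE mulgK.
apply: bigsetU_compact => g _; apply: continuous_compact; last exact: compact_translate.
by apply: continuous_subspaceT; exact: pi_continuous.
Qed.

End Covolume.

(** A finitely generated group is countable, as countable additivity over the elements of [Gamma]
    requires. *)
Lemma word_enumeration (G : groupType) n (x : 'I_n -> G) : exists e : nat -> G, range e = range (word_eval x).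
Proof.
exists (fun k => if unpickle k is Some w then word_eval x w else word_eval x [::]).
apply/seteqP; split=> [_ [k _ <-]|_ [w _ <-]]; last by exists (pickle w) => //; rewrite pickleK.
by case: unpickle => [w|]; [exists w|exists [::]].
Qed.

Section AutTopology.
Variables (R : realType) (T : topologicalType) (X : cw_complex R T).

Lemma cw_aut_hausdorff : hausdorff_space (cw_aut X).
Proof.
move=> x y xy; apply: cw_aut_eq => p.
have N (z : cw_aut X) : nbhs z [set w : cw_aut X | w p = z p].
  by apply/aut_nbhsP; exists [set p] => // w wp; exact: wp.
by have [w [/= <- <-]] := xy _ _ (N x) (N y).
Qed.

Lemma cw_aut_open_subgroup_basis (A : set (cw_aut X)) : nbhs 1%g A ->
  exists2 W : subgroup (cw_aut X), open (W : set (cw_aut X)) & (W : set (cw_aut X)) `<=` A.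
Proof.
move=> /aut_nbhsP[F fF FA].
pose W : set (cw_aut X) := [set g | forall p, F p -> g p = p].
have W1 : W 1%g by [].
have WM x y : W x -> W y -> W (x * y)%g.
  by move=> Wx Wy p Fp; rewrite -[LHS]/(x (y p)) Wy// Wx.
have WV x : W x -> W x^-1%g.
  by move=> Wx p Fp; rewrite -[LHS]/(aut_inv x p) -{1}(Wx p Fp) aut_funK.
exists (Subgroup W1 WM WV); last by move=> x Wx; exact: FA.
rewrite openE => x Wx; apply/aut_nbhsP; exists F => // y yx p Fp.
by rewrite yx// Wx.
Qed.

End AutTopology.

Theorem corollary3p6 (R : realType) (T : topologicalType)
    (X : cw_complex R T)
    (X_combinatorial : cw_combinatorial X)
    (X_locally_finite : cw_locally_finite X)
    (X_dim2 : cw_has_dim X 2)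
    (X_contractible : contractible R T)
    (Gamma : subgroup (cw_aut X))
    (Gamma_lattice : is_nonuniform_lattice R Gamma) :
  ~ finitely_presented Gamma.
Proof.
move=> fp; have [[discr [mu mu_haar covol]] nonuniform] := Gamma_lattice.
have [m mP] := lattice_finite_subgroups_bounded X_combinatorial X_locally_finite X_dim2
  X_contractible discr fp.
have [n [rels [x [rx _]]]] := fp; have [e eE] := word_enumeration x.
apply: nonuniform; apply: (@bounded_finite_subgroups_uniform R _ mu Gamma mu_haar
  (@cw_aut_hausdorff _ _ X) (@cw_aut_open_subgroup_basis _ _ X) discr covol e m) => //.
- by move=> k; rewrite -rx -eE; exists k.
- by move=> h; rewrite -rx -eE => -[k _ <-]; exists k.
Qed.
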